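(* Let $\mathcal C$ be an ECGW category and $\mathcal D$ any double category. Then the functor double category $\mathcal C^{\mathcal D}$ admits the structure of an ECGW category as follows: (1) the good squares in the category of m-morphisms of $\mathcal C^{\mathcal D}$ are the commutative squares of m-natural transformations whose component cubes of naturality squares between m-morphisms are good cubes; good squares of e-morphisms are defined dually; (2) the functors $k$ and $c$ are defined pointwise from those of $\mathcal C$, as is $\star$, in the sense that the $\star$-pushout of a span of $\mathcal D$-shaped diagrams in $\mathcal C$ is the $\mathcal D$-shaped diagram of pointwise $\star$-pushouts; distinguished squares are also given pointwise.
   Context: DOUBLE CATEGORIES. A double category $\mathcal C$ has objects, two categories $\mathcal M,\mathcal E$ on these objects (maps: m-morphisms $\rightarrowtail$, resp. e-morphisms $\rightsquigarrow$), and squares with two opposite m-sides and two opposite e-sides, composable in both directions, with identities and interchange. $(A,B;A',B')$ denotes a diagram of m-morphisms $A\rightarrowtail B$, $A'\rightarrowtail B'$ and e-morphisms $A\rightsquigarrow A'$, $B\rightsquigarrow B'$; it ''is a square'' if it bounds a square of $\mathcal C$. $\mathrm{Ar}_\circlearrowleft\mathcal M$ (resp. $\mathrm{Ar}_\circlearrowleft\mathcal E$) has objects the m- (resp. e-)morphisms and maps the squares. $\mathcal C$ has shared isomorphisms if there is a groupoid $I$ with identity-on-objects functors $\mathcal M\leftarrow I\to\mathcal E$ creating isomorphisms (so $I$ is identified with the isomorphisms of both), and for isomorphisms $f,f'$ and m-morphisms $g,g'$ there is a (unique) square with e-sides $f,f'$ and m-sides $g,g'$ iff the corresponding diagram commutes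 in $\mathcal M$; similarly for $\mathcal E$. ECGW CATEGORIES. For a category $\mathcal X$, $\mathrm{Ar}_\triangle\mathcal X$ has objects the morphisms of $\mathcal X$ and maps $(A\to B)\to(A'\to B')$ the commutative squares with $A\to A'$ an isomorphism. If all morphisms of $\mathcal X$ are monic, a class of good squares is a class of commutative squares, all pullbacks, containing all squares of $\mathrm{Ar}_\triangle\mathcal X$; $\mathrm{Ar}_g\mathcal X$ has objects the morphisms and maps the good squares. An ECGW category is a double category $\mathcal C=(\mathcal M,\mathcal E)$ with shared isomorphisms, with classes of good squares in $\mathcal M$ and $\mathcal E$ and equivalences of categories $k:\mathrm{Ar}_\circlearrowleft\mathcal E\to\mathrm{Ar}_g\mathcal M$, $c:\mathrm{Ar}_\circlearrowleft\mathcal M\to\mathrm{Ar}_g\mathcal E$. Here $k$ sends $p:A\rightsquigarrow A'$ to some $k(p):\ker p\rightarrowtail A'$, and a square $(A,B;A',B')$ with e-sides $p,p'$ to a good square with sides $k(p),k(p')$, $A'\rightarrowtail B'$ and an induced $\ker p\rightarrowtail\ker p'$; $c$ sends $i:A\rightarrowtail B$ to some $c(i):\mathrm{coker}\,i\rightsquigarrow B$, and a square $(A,B;A',B')$ with m-sides $i,i'$ to a good square with sides $c(i),c(i')$, $B\rightsquigarrow B'$ and an induced $\mathrm{coker}\,i\rightsquigarrow\mathrm{coker}\,i'$. Write $B/A=\mathrm{coker}(A\rightarrowtail B)$, $B\backslash A=\ker(A\rightsquigarrow B)$. Axioms: (Z) $\mathcal M,\mathcal E$ have initial objects which agree (denoted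 $\varnothing$). (M) All m- and e-morphisms are monic (in $\mathcal M$, resp. $\mathcal E$). (D) $k$ sends a square into $\mathrm{Ar}_\triangle\mathcal M$ iff $c$ sends it into $\mathrm{Ar}_\triangle\mathcal E$; such squares are called distinguished. (K) For each $f:A\rightarrowtail B$ there is a distinguished square $(\varnothing,B/A;A,B)$ with sides $f,c(f)$; for each $g:A\rightsquigarrow B$ there is a distinguished square $(\varnothing,A;B\backslash A,B)$ with sides $g,k(g)$. ($\star$) For a span $C\leftarrowtail A\rightarrowtail B$, if the category of good squares in $\mathcal M$ completing it to $B\rightarrowtail D\leftarrowtail C$ (maps: $D\rightarrowtail D'$ under $B,C$) is nonempty, it has an initial object $D=B\star_AC$ (the $\star$-pushout), and the induced maps $B/A\rightarrowtail(B\star_AC)/C$, $C/A\rightarrowtail(B\star_AC)/B$ are isomorphisms; dually for e-spans. (PO) For every m-span that category is nonempty (not required for e-spans). (PBL) If $(B,C;B',C')$ and the composite $(A,C;A',C')$ are squares, so is $(A,B;A',B')$; similarly for e-direction composites. (POL) If in a commutative diagram with rows $A\rightarrowtail B\rightarrowtail D$ and $C\rightarrowtail B\star_AC\rightarrowtail E$ (left square the $\star$-pushout square) the outer square is good, so is the right one; same for e-morphisms when the $\star$-pushout exists. FUNCTOR DOUBLE CATEGORY. An m-natural transformation $\mu:F\Rightarrow G$ of double functors $\mathcal D\to\mathcal C$ consists of m-morphisms $\mu_x:Fx\rightarrowtail Gx$ for objects $x$ of $\mathcal D$ and squares $(Fx,Gx;Fy,Gy)$ for each e-morphism $x\rightsquigarrow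 y$, functorial in e-morphisms and natural with respect to m-morphisms and squares of $\mathcal D$ (equivalently a double functor $\mathcal D\times\mathbb H\to\mathcal C$, $\mathbb H$ the double category with a single nonidentity m-morphism). e-natural transformations are dual. $\mathcal C^{\mathcal D}$ is the double category with objects all double functors $\mathcal D\to\mathcal C$; m-morphisms the m-natural transformations whose naturality squares of m-morphisms are good; e-morphisms the e-natural transformations whose naturality squares of e-morphisms are good; squares all modifications between these (families of squares of $\mathcal C$, one for each object of $\mathcal D$, coherent with the naturality squares of the four transformations). GOOD CUBES. A commutative cube of m-morphisms in $\mathcal C$ from a square with vertices $A,B,C,D$ ($A$ initial, $D$ final vertex) to a square with vertices $A',B',C',D'$ is a good cube if each face is a good square and, for the induced m-morphism $B\star_AC\rightarrowtail B'\star_{A'}C'$ between $\star$-pushouts (compatible with $B\rightarrowtail B'$ and $C\rightarrowtail C'$), the square with vertices $B\star_AC,\ B'\star_{A'}C',\ D,\ D'$ is good. (This condition is independent of the chosen direction of the cube.) Good cubes of e-morphisms are defined in the same way. *)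

(* Defs.v *)
From Stdlib Require Import FunctionalExtensionality ProofIrrelevance.

Set Implicit Arguments.
Unset Strict Implicit.
Unset Printing Implicit Defensive.

Declare Scope cat_scope.
Open Scope cat_scope.

Record CatOn (Ob : Type) : Type := {
  hom :> Ob -> Ob -> Type;
  idm : forall A, hom A A;
  comp : forall A B C, hom A B -> hom B C -> hom A C;
  comp_idl : forall A B (f : hom A B), comp (idm A) f = f;
  comp_idr : forall A B (f : hom A B), comp f (idm B) = f;
  comp_assoc : forall A B C D (f : hom A B) (g : hom B C) (h : hom C D),
    comp (comp f g) h = comp f (comp g h)
}.

Arguments idm {Ob} c A.
Arguments comp {Ob c A B C} f g.

(* Composition is written in diagrammatic order. *)
Notation "f ;; g" := (comp f g) (at level 45, left associativity) : cat_scope.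

Section CatNotions.
Variables (Ob : Type) (X : CatOn Ob).

Definition is_iso A B (f : X A B) : Prop :=
  exists g : X B A, f ;; g = idm X A /\ g ;; f = idm X B.

Definition is_monic A B (f : X A B) : Prop :=
  forall Z (g h : X Z A), g ;; f = h ;; f -> g = h.

Definition is_initial A : Prop :=
  forall B, exists f : X A B, forall g : X A B, g = f.

(* Squares are always given in the order  A -> B, A -> C, B -> D, C -> D. *)
Definition is_pullback A B C D
    (f : X A B) (g : X A C) (h : X B D) (k : X C D) : Prop :=
  f ;; h = g ;; k /\
  forall Z (u : X Z B) (v : X Z C), u ;; h = v ;; k ->
    exists! w : X Z A, w ;; f = u /\ w ;; g = v.

(* The square, read as a map from A -> B to C -> D, is a map of the category
   of arrows and commutative squares with invertible domain component. *)
Definition in_triangle A B C D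
    (f : X A B) (g : X A C) (h : X B D) (k : X C D) : Prop :=
  f ;; h = g ;; k /\ is_iso g.

Record Arr : Type := MkArr { src : Ob; tgt : Ob; arr : X src tgt }.

End CatNotions.

Arguments is_initial {Ob} X A.
Arguments MkArr {Ob X src tgt} arr.

Definition pull_cat (O P : Type) (X : CatOn P) (phi : O -> P) : CatOn O := {|
  hom := fun A B => X (phi A) (phi B);
  idm := fun A => idm X (phi A);
  comp := fun A B C f g => f ;; g;
  comp_idl := fun A B f => comp_idl f;
  comp_idr := fun A B f => comp_idr f;
  comp_assoc := fun A B C D f g h => comp_assoc f g h
|}.

Record FunctorOn (O P : Type) (phi : O -> P) (X : CatOn O) (Y : CatOn P) : Type := {
  fmap :> forall A B, X A B -> Y (phi A) (phi B);
  fmap_id : forall A, fmap (idm X A) = idm Y (phi A);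
  fmap_comp : forall A B C (f : X A B) (g : X B C),
    fmap (f ;; g) = fmap f ;; fmap g
}.

Arguments fmap {O P phi X Y} _ {A B} _.

Record Functor (O P : Type) (X : CatOn O) (Y : CatOn P) : Type := {
  fobj :> O -> P;
  farr : FunctorOn fobj X Y
}.

Definition functor_id (O : Type) (X : CatOn O) : Functor X X := {|
  fobj := fun A => A;
  farr := @Build_FunctorOn O O (fun A => A) X X (fun A B f => f)
            (fun A => eq_refl) (fun A B C f g => eq_refl)
|}.

Lemma functor_comp_id (O P Q : Type) (X : CatOn O) (Y : CatOn P) (Z : CatOn Q)
    (F : Functor X Y) (G : Functor Y Z) A :
  fmap (farr G) (fmap (farr F) (idm X A)) = idm Z (G (F A)).
Proof. now rewrite !fmap_id. Qed.

Lemma functor_comp_comp (O P Q : Type) (X : CatOn O) (Y : CatOn P) (Z : CatOn Q)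
    (F : Functor X Y) (G : Functor Y Z) A B C (f : X A B) (g : X B C) :
  fmap (farr G) (fmap (farr F) (f ;; g)) =
  fmap (farr G) (fmap (farr F) f) ;; fmap (farr G) (fmap (farr F) g).
Proof. now rewrite !fmap_comp. Qed.

Definition functor_comp (O P Q : Type) (X : CatOn O) (Y : CatOn P) (Z : CatOn Q)
    (F : Functor X Y) (G : Functor Y Z) : Functor X Z := {|
  fobj := fun A => G (F A);
  farr := @Build_FunctorOn O Q (fun A => G (F A)) X Z
            (fun A B f => fmap (farr G) (fmap (farr F) f))
            (functor_comp_id F G) (functor_comp_comp F G)
|}.

Definition nat_iso (O P : Type) (X : CatOn O) (Y : CatOn P)
    (F G : Functor X Y) : Prop :=
  exists eta : forall A, Y (F A) (G A),
    (forall A, is_iso (eta A)) /\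
    forall A B (f : X A B), fmap (farr F) f ;; eta B = eta A ;; fmap (farr G) f.

Definition is_equivalence (O P : Type) (X : CatOn O) (Y : CatOn P)
    (F : Functor X Y) : Prop :=
  exists G : Functor Y X,
    nat_iso (functor_comp F G) (functor_id X) /\
    nat_iso (functor_comp G F) (functor_id Y).

Section SqEq.
Variables (Ob : Type) (M E : CatOn Ob).
Variable Sq : forall A B A' B' : Ob, M A B -> M A' B' -> E A A' -> E B B' -> Type.

(* Equality of squares whose boundaries need not be convertible: the boundaries
   coincide and, under this identification, so do the squares. *)
Inductive sq_eq A B A' B' (f : M A B) (f' : M A' B') (p : E A A') (q : E B B')
    (s : Sq f f' p q) :
    forall (g : M A B) (g' : M A' B') (r : E A A') (t : E B B'),
      Sq g g' r t -> Prop :=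
| sq_refl : sq_eq s s.

Section Facts.
Variables (A B A' B' : Ob).

Lemma sq_eq_bd (f g : M A B) (f' g' : M A' B') (p r : E A A') (q t : E B B')
    (x : Sq f f' p q) (y : Sq g g' r t) :
  sq_eq x y -> f = g /\ f' = g' /\ p = r /\ q = t.
Proof. now intros []. Qed.

Lemma sq_eq_sym (f g : M A B) (f' g' : M A' B') (p r : E A A') (q t : E B B')
    (x : Sq f f' p q) (y : Sq g g' r t) :
  sq_eq x y -> sq_eq y x.
Proof. now intros []. Qed.

Lemma sq_eq_trans (f g h : M A B) (f' g' h' : M A' B') (p r a : E A A')
    (q t b : E B B') (x : Sq f f' p q) (y : Sq g g' r t) (z : Sq h h' a b) :
  sq_eq x y -> sq_eq y z -> sq_eq x z.
Proof. intros [] H; exact H. Qed.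

Lemma sq_eq_eq (f : M A B) (f' : M A' B') (p : E A A') (q : E B B')
    (x y : Sq f f' p q) :
  sq_eq x y -> x = y.
Proof.
intros H.
pose (T := {g : M A B & {g' : M A' B' & {r : E A A' & {t : E B B' & Sq g g' r t}}}}).
assert (K : (existT _ f (existT _ f' (existT _ p (existT _ q x))) : T) =
            existT _ f (existT _ f' (existT _ p (existT _ q y)))).
{ now destruct H. }
repeat apply ProofIrrelevanceTheory.EqdepTheory.inj_pair2 in K; exact K.
Qed.

Lemma eq_sq_eq (f : M A B) (f' : M A' B') (p : E A A') (q : E B B')
    (x y : Sq f f' p q) :
  x = y -> sq_eq x y.
Proof. now intros ->. Qed.

End Facts.
End SqEq.

Arguments sq_refl {Ob M E Sq A B A' B' f f' p q s}.

(* M is the category of m-morphisms and E the category of e-morphisms;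
   [Sq f f' p q] is the type of squares (A,B;A',B') with m-sides f : A -> B,
   f' : A' -> B' and e-sides p : A -> A', q : B -> B'. *)
Record DoubleCat : Type := {
  Ob :> Type;
  M : CatOn Ob;
  E : CatOn Ob;
  Sq : forall A B A' B' : Ob, M A B -> M A' B' -> E A A' -> E B B' -> Type;
  hid : forall A A' (p : E A A'), Sq (idm M A) (idm M A') p p;
  vid : forall A B (f : M A B), Sq f f (idm E A) (idm E B);
  hcomp : forall A B C A' B' C' (f : M A B) (g : M B C) (f' : M A' B') (g' : M B' C')
    (p : E A A') (q : E B B') (r : E C C'),
    Sq f f' p q -> Sq g g' q r -> Sq (f ;; g) (f' ;; g') p r;
  vcomp : forall A A' A'' B B' B'' (p : E A A') (p' : E A' A'') (q : E B B') (q' : E B' B'')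
    (f : M A B) (f' : M A' B') (f'' : M A'' B''),
    Sq f f' p q -> Sq f' f'' p' q' -> Sq f f'' (p ;; p') (q ;; q');
  hcomp_idl : forall A B A' B' (f : M A B) (f' : M A' B') (p : E A A') (q : E B B')
    (s : Sq f f' p q), sq_eq (hcomp (hid p) s) s;
  hcomp_idr : forall A B A' B' (f : M A B) (f' : M A' B') (p : E A A') (q : E B B')
    (s : Sq f f' p q), sq_eq (hcomp s (hid q)) s;
  hcomp_assoc : forall A B C D A' B' C' D'
    (f : M A B) (g : M B C) (h : M C D) (f' : M A' B') (g' : M B' C') (h' : M C' D')
    (p : E A A') (q : E B B') (r : E C C') (t : E D D')
    (x : Sq f f' p q) (y : Sq g g' q r) (z : Sq h h' r t),
    sq_eq (hcomp (hcomp x y) z) (hcomp x (hcomp y z));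
  vcomp_idl : forall A B A' B' (f : M A B) (f' : M A' B') (p : E A A') (q : E B B')
    (s : Sq f f' p q), sq_eq (vcomp (vid f) s) s;
  vcomp_idr : forall A B A' B' (f : M A B) (f' : M A' B') (p : E A A') (q : E B B')
    (s : Sq f f' p q), sq_eq (vcomp s (vid f')) s;
  vcomp_assoc : forall A B C D A' B' C' D'
    (f : E A B) (g : E B C) (h : E C D) (f' : E A' B') (g' : E B' C') (h' : E C' D')
    (p : M A A') (q : M B B') (r : M C C') (t : M D D')
    (x : Sq p q f f') (y : Sq q r g g') (z : Sq r t h h'),
    sq_eq (vcomp (vcomp x y) z) (vcomp x (vcomp y z));
  hid_vid : forall A, hid (idm E A) = vid (idm M A);
  hid_comp : forall A A' A'' (p : E A A') (p' : E A' A''),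
    sq_eq (hid (p ;; p')) (vcomp (hid p) (hid p'));
  vid_comp : forall A B C (f : M A B) (g : M B C),
    sq_eq (vid (f ;; g)) (hcomp (vid f) (vid g));
  interchange : forall A B C A' B' C' A'' B'' C''
    (f : M A B) (g : M B C) (f' : M A' B') (g' : M B' C') (f'' : M A'' B'') (g'' : M B'' C'')
    (p : E A A') (q : E B B') (r : E C C') (p' : E A' A'') (q' : E B' B'') (r' : E C' C'')
    (w : Sq f f' p q) (x : Sq g g' q r) (y : Sq f' f'' p' q') (z : Sq g' g'' q' r'),
    vcomp (hcomp w x) (hcomp y z) = hcomp (vcomp w y) (vcomp x z)
}.

Arguments M : clear implicits.
Arguments E : clear implicits.
Arguments Sq {d A B A' B'} f f' p q.
Arguments hid {d A A'} p.
Arguments vid {d A B} f.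
Arguments hcomp {d A B C A' B' C' f g f' g' p q r} x y.
Arguments vcomp {d A A' A'' B B' B'' p p' q q' f f' f''} x y.

Lemma hcomp_cong (C : DoubleCat) (a b c a' b' c' : C)
    (f f1 : M C a b) (g g1 : M C b c) (f' f1' : M C a' b') (g' g1' : M C b' c')
    (p p1 : E C a a') (q q1 : E C b b') (r r1 : E C c c')
    (x : Sq f f' p q) (x1 : Sq f1 f1' p1 q1)
    (y : Sq g g' q r) (y1 : Sq g1 g1' q1 r1) :
  sq_eq x x1 -> sq_eq y y1 -> sq_eq (hcomp x y) (hcomp x1 y1).
Proof.
intros H K.
destruct (sq_eq_bd H) as (? & ? & ? & ?), (sq_eq_bd K) as (? & ? & ? & ?); subst.
apply sq_eq_eq in H; apply sq_eq_eq in K; subst; constructor.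
Qed.

Lemma vcomp_cong (C : DoubleCat) (a b c a' b' c' : C)
    (p p1 : E C a b) (q q1 : E C b c) (p' p1' : E C a' b') (q' q1' : E C b' c')
    (f f1 : M C a a') (g g1 : M C b b') (h h1 : M C c c')
    (x : Sq f g p p') (x1 : Sq f1 g1 p1 p1')
    (y : Sq g h q q') (y1 : Sq g1 h1 q1 q1') :
  sq_eq x x1 -> sq_eq y y1 -> sq_eq (vcomp x y) (vcomp x1 y1).
Proof.
intros H K.
destruct (sq_eq_bd H) as (? & ? & ? & ?), (sq_eq_bd K) as (? & ? & ? & ?); subst.
apply sq_eq_eq in H; apply sq_eq_eq in K; subst; constructor.
Qed.

(* The transpose of a double category exchanges m- and e-morphisms; every
   notion for e-morphisms below is the one for m-morphisms in the transpose. *)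
Lemma sq_eq_tr (Ob : Type) (M E : CatOn Ob)
    (Sq : forall A B A' B' : Ob, M A B -> M A' B' -> E A A' -> E B B' -> Type)
    A B A' B' (f g : M A B) (f' g' : M A' B') (p r : E A A') (q t : E B B')
    (x : Sq _ _ _ _ f f' p q) (y : Sq _ _ _ _ g g' r t) :
  sq_eq x y ->
  @sq_eq Ob E M (fun A A' B B' p q f f' => Sq A B A' B' f f' p q)
    A A' B B' p q f f' x r t g g' y.
Proof. now intros []. Qed.

Definition tr (C : DoubleCat) : DoubleCat.
Proof.
refine (@Build_DoubleCat (Ob C) (E C) (M C)
  (fun A A' B B' p q f f' => Sq f f' p q)
  (fun A B f => vid f) (fun A A' p => hid p)
  (fun _ _ _ _ _ _ _ _ _ _ _ _ _ x y => vcomp x y)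
  (fun _ _ _ _ _ _ _ _ _ _ _ _ _ x y => hcomp x y)
  _ _ _ _ _ _ _ _ _ _).
- intros; apply sq_eq_tr, vcomp_idl.
- intros; apply sq_eq_tr, vcomp_idr.
- intros; apply sq_eq_tr, vcomp_assoc.
- intros; apply sq_eq_tr, hcomp_idl.
- intros; apply sq_eq_tr, hcomp_idr.
- intros; apply sq_eq_tr, hcomp_assoc.
- intros; symmetry; apply hid_vid.
- intros; apply sq_eq_tr, vid_comp.
- intros; apply sq_eq_tr, hid_comp.
- intros; symmetry; apply interchange.
Defined.

(* The category with objects the e-morphisms and maps the squares; its
   counterpart with objects the m-morphisms is [ArSq (tr C)]. *)
Record ArSq_hom (C : DoubleCat) (p q : Arr (E C)) : Type := {
  ar_top : M C (src p) (src q);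
  ar_bot : M C (tgt p) (tgt q);
  ar_sq : Sq ar_top ar_bot (arr p) (arr q)
}.

Lemma ArSq_hom_eq (C : DoubleCat) (p q : Arr (E C)) (x y : ArSq_hom p q) :
  sq_eq (ar_sq x) (ar_sq y) -> x = y.
Proof.
destruct x as [f f' s], y as [g g' t]; simpl; intros H.
destruct (sq_eq_bd H) as (? & ? & _); subst.
apply sq_eq_eq in H; now subst.
Qed.

Definition ArSq (C : DoubleCat) : CatOn (Arr (E C)).
Proof.
refine (@Build_CatOn (Arr (E C)) (@ArSq_hom C)
  (fun p => Build_ArSq_hom (hid (arr p)))
  (fun p q r x y => Build_ArSq_hom (hcomp (ar_sq x) (ar_sq y))) _ _ _).
- intros; apply ArSq_hom_eq, hcomp_idl.
- intros; apply ArSq_hom_eq, hcomp_idr.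
- intros; apply ArSq_hom_eq, hcomp_assoc.
Defined.

(* An identity-on-objects functor I -> X creates isomorphisms when every
   isomorphism of X has a unique preimage. *)
Definition creates_isos (O : Type) (I X : CatOn O) (F : FunctorOn (fun A => A) I X) : Prop :=
  forall A B (f : X A B), is_iso f -> exists! i : I A B, fmap F i = f.

Record SharedIso (C : DoubleCat) : Type := {
  si_cat : CatOn (Ob C);
  si_grpd : forall A B (i : si_cat A B), is_iso i;
  si_M : FunctorOn (fun A => A) si_cat (M C);
  si_E : FunctorOn (fun A => A) si_cat (E C);
  si_M_creates : creates_isos si_M;
  si_E_creates : creates_isos si_E;
  si_sq_M : forall A B A' B' (f : si_cat A A') (f' : si_cat B B')
    (g : M C A B) (g' : M C A' B'),
    inhabited (Sq g g' (fmap si_E f) (fmap si_E f')) <->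
    fmap si_M f ;; g' = g ;; fmap si_M f';
  si_sq_M_unique : forall A B A' B' (f : si_cat A A') (f' : si_cat B B')
    (g : M C A B) (g' : M C A' B')
    (s t : Sq g g' (fmap si_E f) (fmap si_E f')), s = t;
  si_sq_E : forall A B A' B' (f : si_cat A A') (f' : si_cat B B')
    (g : E C A B) (g' : E C A' B'),
    inhabited (Sq (fmap si_M f) (fmap si_M f') g g') <->
    fmap si_E f ;; g' = g ;; fmap si_E f';
  si_sq_E_unique : forall A B A' B' (f : si_cat A A') (f' : si_cat B B')
    (g : E C A B) (g' : E C A' B')
    (s t : Sq (fmap si_M f) (fmap si_M f') g g'), s = t
}.

(* Being good is a property of a commutative square, not of one of its two
   readings as a map of arrows; hence [good_sym].  Closure under composition
   makes the arrows and good squares a category. *)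
Record GoodClass (O : Type) (X : CatOn O) : Type := {
  good : forall A B C D, X A B -> X A C -> X B D -> X C D -> Prop;
  good_pullback : forall A B C D (f : X A B) (g : X A C) (h : X B D) (k : X C D),
    good f g h k -> is_pullback f g h k;
  good_sym : forall A B C D (f : X A B) (g : X A C) (h : X B D) (k : X C D),
    good f g h k -> good g f k h;
  good_triangle : forall A B C D (f : X A B) (g : X A C) (h : X B D) (k : X C D),
    in_triangle f g h k -> good f g h k;
  good_comp : forall A B A' B' A'' B'' (f : X A B) (f' : X A' B') (f'' : X A'' B'')
    (g : X A A') (h : X B B') (g' : X A' A'') (h' : X B' B''),
    good f g h f' -> good f' g' h' f'' -> good f (g ;; g') (h ;; h') f''
}.

Arguments good {O X} _ {A B C D} _ _ _ _.

Lemma good_id (O : Type) (X : CatOn O) (G : GoodClass X) A B (f : X A B) :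
  good G f (idm X A) (idm X B) f.
Proof.
apply good_triangle; split.
- now rewrite comp_idl, comp_idr.
- exists (idm X A); now rewrite comp_idl.
Qed.

Record ArG_hom (O : Type) (X : CatOn O) (G : GoodClass X) (f f' : Arr X) : Type := {
  ag_top : X (src f) (src f');
  ag_bot : X (tgt f) (tgt f');
  ag_good : good G (arr f) ag_top ag_bot (arr f')
}.

Lemma ArG_hom_eq (O : Type) (X : CatOn O) (G : GoodClass X) (f f' : Arr X)
    (x y : ArG_hom G f f') :
  ag_top x = ag_top y -> ag_bot x = ag_bot y -> x = y.
Proof.
destruct x as [a b H], y as [a' b' H']; simpl; intros -> ->.
now rewrite (proof_irrelevance _ H H').
Qed.

Definition ArG (O : Type) (X : CatOn O) (G : GoodClass X) : CatOn (Arr X).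
Proof.
refine (@Build_CatOn (Arr X) (@ArG_hom O X G)
  (fun f => Build_ArG_hom (good_id G (arr f)))
  (fun f f' f'' x y => Build_ArG_hom (good_comp (ag_good x) (ag_good y))) _ _ _).
- intros; apply ArG_hom_eq; apply comp_idl.
- intros; apply ArG_hom_eq; apply comp_idr.
- intros; apply ArG_hom_eq; apply comp_assoc.
Defined.

Section Star.
Variables (O : Type) (X : CatOn O) (G : GoodClass X).

(* (D, h, k) is initial among the good completions of the span (f, g). *)
Definition is_star A B C D (f : X A B) (g : X A C) (h : X B D) (k : X C D) : Prop :=
  good G f g h k /\
  forall D' (h' : X B D') (k' : X C D'), good G f g h' k' ->
    exists! d : X D D', h ;; d = h' /\ k ;; d = k'.

Definition has_good_completion A B C (f : X A B) (g : X A C) : Prop :=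
  exists D (h : X B D) (k : X C D), good G f g h k.

Definition POL : Prop :=
  forall A B C P D F (f : X A B) (g : X A C) (h : X B P) (k : X C P)
    (d : X B D) (e : X P F) (m : X D F),
    is_star f g h k -> d ;; m = h ;; e ->
    good G (f ;; d) g m (k ;; e) -> good G d h m e.

(* The cube from the square (A,B,C,D) to the square (A',B',C',D') along
   a, b, c, d. *)
Definition good_cube A B C D A' B' C' D'
    (ab : X A B) (ac : X A C) (bd : X B D) (cd : X C D)
    (ab' : X A' B') (ac' : X A' C') (bd' : X B' D') (cd' : X C' D')
    (a : X A A') (b : X B B') (c : X C C') (d : X D D') : Prop :=
  (good G ab ac bd cd /\ good G ab' ac' bd' cd' /\
   good G ab a b ab' /\ good G ac a c ac' /\
   good G bd b d bd' /\ good G cd c d cd') /\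
  exists P (h : X B P) (k : X C P) P' (h' : X B' P') (k' : X C' P')
    (w : X P P') (u : X P D) (u' : X P' D'),
    is_star ab ac h k /\ is_star ab' ac' h' k' /\
    (h ;; w = b ;; h' /\ k ;; w = c ;; k') /\
    (h ;; u = bd /\ k ;; u = cd) /\ (h' ;; u' = bd' /\ k' ;; u' = cd') /\
    good G w u u' d.

End Star.

(* A functor k from [ArSq C] to [ArG G] preserving codomains: on p : A -> A' in
   E it is [kmor p : ker p -> A'] in M. *)
Record KerData (C : DoubleCat) (G : GoodClass (M C)) : Type := {
  ker : forall A A', E C A A' -> Ob C;
  kmor : forall A A' (p : E C A A'), M C (ker p) A';
  kmap : forall A B A' B' (f : M C A B) (f' : M C A' B') (p : E C A A') (q : E C B B'),
    Sq f f' p q -> M C (ker p) (ker q);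
  kmap_good : forall A B A' B' (f : M C A B) (f' : M C A' B') (p : E C A A') (q : E C B B')
    (s : Sq f f' p q), good G (kmor p) (kmap s) f' (kmor q);
  kmap_id : forall A A' (p : E C A A'), kmap (hid p) = idm (M C) (ker p);
  kmap_comp : forall A B D A' B' D' (f : M C A B) (g : M C B D) (f' : M C A' B')
    (g' : M C B' D') (p : E C A A') (q : E C B B') (r : E C D D')
    (s : Sq f f' p q) (t : Sq g g' q r),
    kmap (hcomp s t) = kmap s ;; kmap t
}.

Arguments ker {C G} k {A A'} p.
Arguments kmor {C G} k {A A'} p.
Arguments kmap {C G} k {A B A' B' f f' p q} s.

Definition kfunctor (C : DoubleCat) (G : GoodClass (M C)) (k : KerData G) :
  Functor (ArSq C) (ArG G).
Proof.
refine (@Build_Functor _ _ (ArSq C) (ArG G) (fun p => MkArr (kmor k (arr p)))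
  (@Build_FunctorOn _ _ (fun p => MkArr (kmor k (arr p))) (ArSq C) (ArG G)
  (fun p q x => @Build_ArG_hom _ _ G (MkArr (kmor k (arr p))) (MkArr (kmor k (arr q)))
     _ _ (kmap_good k (ar_sq x))) _ _)).
- intros; apply ArG_hom_eq; [apply kmap_id | reflexivity].
- intros; apply ArG_hom_eq; [apply kmap_comp | reflexivity].
Defined.

(* k sends s into the category of arrows and [in_triangle] squares. *)
Definition ktriangle (C : DoubleCat) (G : GoodClass (M C)) (k : KerData G)
    A B A' B' (f : M C A B) (f' : M C A' B') (p : E C A A') (q : E C B B')
    (s : Sq f f' p q) : Prop :=
  in_triangle (kmor k p) (kmap k s) f' (kmor k q).

(* [cok f] and [cmor f] stand for coker f and c(f) : coker f -> B.  The map
   coker f -> coker k induced by a good square (f,g,h,k) is the m-side r of the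
   square with e-sides c(f), c(k) and other m-side h; faithfulness of k makes it
   unique, since all m-morphisms are monic. *)
Definition star_axiom (C : DoubleCat) (G : GoodClass (M C))
    (cok : forall A B : C, M C A B -> Ob C)
    (cmor : forall (A B : C) (f : M C A B), E C (cok A B f) B) : Prop :=
  forall (A B D : C) (f : M C A B) (g : M C A D),
  has_good_completion G f g ->
  (exists (P : C) (h : M C B P) (k : M C D P), is_star G f g h k) /\
  forall (P : C) (h : M C B P) (k : M C D P), is_star G f g h k ->
    (exists (r : M C (cok _ _ f) (cok _ _ k)) (_ : Sq r h (cmor _ _ f) (cmor _ _ k)),
       is_iso r) /\
    (exists (r : M C (cok _ _ g) (cok _ _ h)) (_ : Sq r k (cmor _ _ g) (cmor _ _ h)),
       is_iso r).

Definition PBL (C : DoubleCat) : Prop :=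
  forall (a b c a' b' c' : C) (f : M C a b) (g : M C b c) (f' : M C a' b') (g' : M C b' c')
    (p : E C a a') (q : E C b b') (r : E C c c'),
    inhabited (Sq g g' q r) -> inhabited (Sq (f ;; g) (f' ;; g') p r) ->
    inhabited (Sq f f' p q).

(* The functor c is given as [KerData] on the transpose: for f : A -> B in M,
   [ker cD f] is coker f and [kmor cD f] is c(f) : coker f -> B in E. *)
Record ECGW (C : DoubleCat) : Type := {
  shared : SharedIso C;
  goodM : GoodClass (M C);
  goodE : GoodClass (M (tr C));
  kD : KerData goodM;
  cD : @KerData (tr C) goodE;
  k_equiv : is_equivalence (kfunctor kD);
  c_equiv : is_equivalence (kfunctor cD);
  empty : Ob C;
  axZ_M : is_initial (M C) empty;
  axZ_E : is_initial (E C) empty;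
  axM_M : forall A B (f : M C A B), is_monic f;
  axM_E : forall A B (f : E C A B), is_monic f;
  axD : forall A B A' B' (f : M C A B) (f' : M C A' B') (p : E C A A') (q : E C B B')
    (s : Sq f f' p q), ktriangle kD s <-> @ktriangle (tr C) goodE cD _ _ _ _ p q f f' s;
  axK_M : forall A B (f : M C A B),
    exists (i : M C empty (ker cD f)) (e : E C empty A) (s : Sq i f e (kmor cD f)),
      ktriangle kD s;
  axK_E : forall A B (g : E C A B),
    exists (i : M C empty A) (e : E C empty (ker kD g)) (s : Sq i (kmor kD g) e g),
      ktriangle kD s;
  axStar_M : @star_axiom C goodM (fun A B f => ker cD f) (fun A B f => kmor cD f);
  axStar_E : @star_axiom (tr C) goodE (fun A B g => ker kD g) (fun A B g => kmor kD g);
  axPO : forall A B D (f : M C A B) (g : M C A D), has_good_completion goodM f g;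
  axPBL_M : PBL C;
  axPBL_E : PBL (tr C);
  axPOL_M : POL goodM;
  axPOL_E : POL goodE
}.

Definition distinguished (C : DoubleCat) (S : ECGW C)
    (A B A' B' : C) (f : M C A B) (f' : M C A' B') (p : E C A A') (q : E C B B')
    (s : Sq f f' p q) : Prop := ktriangle (kD S) s.

Record DFun (D C : DoubleCat) : Type := {
  dobj :> D -> C;
  dM : FunctorOn dobj (M D) (M C);
  dE : FunctorOn dobj (E D) (E C);
  dSq : forall A B A' B' (f : M D A B) (f' : M D A' B') (p : E D A A') (q : E D B B'),
    Sq f f' p q -> Sq (fmap dM f) (fmap dM f') (fmap dE p) (fmap dE q);
  dSq_hid : forall A A' (p : E D A A'), sq_eq (dSq (hid p)) (hid (fmap dE p));
  dSq_vid : forall A B (f : M D A B), sq_eq (dSq (vid f)) (vid (fmap dM f));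
  dSq_hcomp : forall A B B1 A' B' B1' (f : M D A B) (g : M D B B1)
    (f' : M D A' B') (g' : M D B' B1') (p : E D A A') (q : E D B B') (r : E D B1 B1')
    (x : Sq f f' p q) (y : Sq g g' q r),
    sq_eq (dSq (hcomp x y)) (hcomp (dSq x) (dSq y));
  dSq_vcomp : forall A A' A'' B B' B'' (p : E D A A') (p' : E D A' A'')
    (q : E D B B') (q' : E D B' B'') (f : M D A B) (f' : M D A' B') (f'' : M D A'' B'')
    (x : Sq f f' p q) (y : Sq f' f'' p' q'),
    sq_eq (dSq (vcomp x y)) (vcomp (dSq x) (dSq y))
}.

Arguments dM {D C} _.
Arguments dE {D C} _.
Arguments dSq {D C} _ {A B A' B' f f' p q} _.

Definition trF (D C : DoubleCat) (F : DFun D C) : DFun (tr D) (tr C).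
Proof.
refine (@Build_DFun (tr D) (tr C) (dobj F) (dE F) (dM F)
  (fun _ _ _ _ _ _ _ _ s => dSq F s) _ _ _ _).
- intros; exact (sq_eq_tr (dSq_vid F p)).
- intros; exact (sq_eq_tr (dSq_hid F f)).
- intros; exact (sq_eq_tr (dSq_vcomp F x y)).
- intros; exact (sq_eq_tr (dSq_hcomp F x y)).
Defined.

(* m-natural transformations; an e-natural transformation F => G is an
   [MNat (trF F) (trF G)]. *)
Record MNat (D C : DoubleCat) (F G : DFun D C) : Type := {
  nm :> forall x : D, M C (F x) (G x);
  nsq : forall (x y : D) (u : E D x y), Sq (nm x) (nm y) (fmap (dE F) u) (fmap (dE G) u);
  nsq_id : forall x : D, sq_eq (nsq (idm (E D) x)) (vid (nm x));
  nsq_comp : forall (x y z : D) (u : E D x y) (v : E D y z),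
    sq_eq (nsq (u ;; v)) (vcomp (nsq u) (nsq v));
  nm_nat : forall (x y : D) (f : M D x y), fmap (dM F) f ;; nm y = nm x ;; fmap (dM G) f;
  nsq_nat : forall (x y x' y' : D) (f : M D x y) (f' : M D x' y')
    (u : E D x x') (v : E D y y') (s : Sq f f' u v),
    sq_eq (hcomp (dSq F s) (nsq v)) (hcomp (nsq u) (dSq G s))
}.

Arguments nsq {D C F G} _ {x y} u.

Lemma MNat_eq (D C : DoubleCat) (F G : DFun D C) (m n : MNat F G) :
  (forall x, nm m x = nm n x) ->
  (forall (x y : D) (u : E D x y), sq_eq (nsq m u) (nsq n u)) -> m = n.
Proof.
destruct m as [m1 m2 m3 m4 m5 m6], n as [n1 n2 n3 n4 n5 n6]; simpl; intros H K.
assert (m1 = n1) as e by (apply functional_extensionality_dep; exact H).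
destruct e.
assert (m2 = n2) as e.
{ do 3 (apply functional_extensionality_dep; intro). apply sq_eq_eq, K. }
destruct e; f_equal; apply proof_irrelevance.
Qed.

Definition idNat (D C : DoubleCat) (F : DFun D C) : MNat F F.
Proof.
refine (@Build_MNat D C F F (fun x => idm (M C) (F x))
  (fun x y u => hid (fmap (dE F) u)) _ _ _ _).
- intros x; rewrite fmap_id, hid_vid; apply sq_refl.
- intros x y z u v; rewrite fmap_comp; apply hid_comp.
- intros; now rewrite comp_idl, comp_idr.
- intros; eapply sq_eq_trans; [apply hcomp_idr | apply sq_eq_sym, hcomp_idl].
Defined.

Definition compNat (D C : DoubleCat) (F G H : DFun D C) (m : MNat F G) (n : MNat G H) :
  MNat F H.
Proof.
refine (@Build_MNat D C F H (fun x => m x ;; n x)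
  (fun x y u => hcomp (nsq m u) (nsq n u)) _ _ _ _).
- intros x; eapply sq_eq_trans; [apply hcomp_cong; apply nsq_id |].
  apply sq_eq_sym, vid_comp.
- intros x y z u v; eapply sq_eq_trans; [apply hcomp_cong; apply nsq_comp |].
  apply eq_sq_eq; symmetry; apply interchange.
- intros x y f; now rewrite <- comp_assoc, nm_nat, comp_assoc, nm_nat, <- comp_assoc.
- intros x y x' y' f f' u v s.
  eapply sq_eq_trans; [apply sq_eq_sym, hcomp_assoc |].
  eapply sq_eq_trans; [apply hcomp_cong; [apply nsq_nat | apply sq_refl] |].
  eapply sq_eq_trans; [apply hcomp_assoc |].
  eapply sq_eq_trans; [apply hcomp_cong; [apply sq_refl | apply nsq_nat] |].
  apply sq_eq_sym, hcomp_assoc.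
Defined.

(* The m-morphisms of the functor double category. *)
Record GNat (D C : DoubleCat) (GM : GoodClass (M C)) (F G : DFun D C) : Type := {
  gnat :> MNat F G;
  gnat_good : forall (x y : D) (f : M D x y),
    good GM (fmap (dM F) f) (gnat x) (gnat y) (fmap (dM G) f)
}.

Lemma GNat_eq (D C : DoubleCat) (GM : GoodClass (M C)) (F G : DFun D C)
    (m n : GNat GM F G) :
  gnat m = gnat n -> m = n.
Proof.
destruct m as [m p], n as [n q]; simpl; intros e; destruct e; f_equal.
apply proof_irrelevance.
Qed.

Definition FunM (D C : DoubleCat) (GM : GoodClass (M C)) : CatOn (DFun D C).
Proof.
refine (@Build_CatOn (DFun D C) (@GNat D C GM)
  (fun F => @Build_GNat D C GM F F (idNat F) (fun x y f => good_id GM _))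
  (fun F G H m n => @Build_GNat D C GM F H (compNat m n)
    (fun x y f => good_comp (gnat_good m f) (gnat_good n f))) _ _ _).
- intros F G m; apply GNat_eq, MNat_eq; intros; [apply comp_idl | apply hcomp_idl].
- intros F G m; apply GNat_eq, MNat_eq; intros; [apply comp_idr | apply hcomp_idr].
- intros F G H K m n o; apply GNat_eq, MNat_eq; intros;
    [apply comp_assoc | apply hcomp_assoc].
Defined.

Definition FunE (D C : DoubleCat) (GE : GoodClass (M (tr C))) : CatOn (DFun D C) :=
  pull_cat (@FunM (tr D) (tr C) GE) (@trF D C).

Section FunctorDoubleCategory.
Variables (C : DoubleCat) (GM : GoodClass (M C)) (GE : GoodClass (M (tr C)))
  (D : DoubleCat).

Definition mm (F G : DFun D C) (m : FunM D GM F G) (x : D) : M C (F x) (G x) :=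
  nm (gnat m) x.

Definition msq (F G : DFun D C) (m : FunM D GM F G) (x y : D) (u : E D x y) :
    Sq (mm m x) (mm m y) (fmap (dE F) u) (fmap (dE G) u) :=
  nsq (gnat m) u.

Definition em (F G : DFun D C) (p : FunE D GE F G) (x : D) : E C (F x) (G x) :=
  nm (gnat p) x.

Definition esq (F G : DFun D C) (p : FunE D GE F G) (x y : D) (f : M D x y) :
    Sq (fmap (dM F) f) (fmap (dM G) f) (em p x) (em p y) :=
  nsq (gnat p) f.

Lemma mm_eq (F G : DFun D C) (m n : FunM D GM F G) :
  (forall x, mm m x = mm n x) ->
  (forall (x y : D) (u : E D x y), sq_eq (msq m u) (msq n u)) -> m = n.
Proof. intros H K; now apply GNat_eq, MNat_eq. Qed.

Record Mod (F G F' G' : DFun D C) (m : FunM D GM F G) (m' : FunM D GM F' G')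
    (p : FunE D GE F F') (q : FunE D GE G G') : Type := {
  md :> forall x : D, Sq (mm m x) (mm m' x) (em p x) (em q x);
  md_M : forall (x y : D) (f : M D x y),
    sq_eq (hcomp (esq p f) (md y)) (hcomp (md x) (esq q f));
  md_E : forall (x y : D) (u : E D x y),
    sq_eq (vcomp (msq m u) (md y)) (vcomp (md x) (msq m' u))
}.

Lemma Mod_eq (F G F' G' : DFun D C)
    (m n : FunM D GM F G) (m' n' : FunM D GM F' G')
    (p r : FunE D GE F F') (q t : FunE D GE G G') (a : Mod m m' p q) (b : Mod n n' r t) :
  m = n -> m' = n' -> p = r -> q = t ->
  (forall x, sq_eq (a x) (b x)) ->
  @sq_eq (DFun D C) (FunM D GM) (FunE D GE) Mod _ _ _ _ _ _ _ _ a _ _ _ _ b.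
Proof.
intros; subst n n' r t.
enough (a = b) as -> by apply sq_refl.
destruct a as [a1 a2 a3], b as [b1 b2 b3]; simpl in *.
assert (a1 = b1) as e.
{ apply functional_extensionality_dep; intro; now apply sq_eq_eq. }
destruct e; f_equal; apply proof_irrelevance.
Qed.

Definition Mod_hid (F F' : DFun D C) (p : FunE D GE F F') :
  Mod (idm (FunM D GM) F) (idm (FunM D GM) F') p p.
Proof.
refine (@Build_Mod _ _ _ _ (idm (FunM D GM) F) (idm (FunM D GM) F') p p
  (fun x => hid (em p x)) _ _).
- intros; eapply sq_eq_trans; [apply hcomp_idr | apply sq_eq_sym, hcomp_idl].
- intros x y u.
  eapply sq_eq_trans; [apply sq_eq_sym, hid_comp |].
  eapply sq_eq_trans; [| apply hid_comp].
  pose proof (nm_nat (gnat p) u) as e; simpl in e.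
  change (fmap (dE F) u ;; em p y = em p x ;; fmap (dE F') u) in e.
  rewrite e; apply sq_refl.
Defined.

Definition Mod_vid (F G : DFun D C) (m : FunM D GM F G) :
  Mod m m (idm (FunE D GE) F) (idm (FunE D GE) G).
Proof.
refine (@Build_Mod _ _ _ _ m m (idm (FunE D GE) F) (idm (FunE D GE) G)
  (fun x => vid (mm m x)) _ _).
- intros x y f.
  eapply sq_eq_trans; [apply sq_eq_sym, vid_comp |].
  eapply sq_eq_trans; [| apply vid_comp].
  pose proof (nm_nat (gnat m) f) as e; simpl in e.
  change (fmap (dM F) f ;; mm m y = mm m x ;; fmap (dM G) f) in e.
  rewrite e; apply sq_refl.
- intros; eapply sq_eq_trans; [apply vcomp_idr | apply sq_eq_sym, vcomp_idl].
Defined.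

Definition Mod_hcomp (F G H F' G' H' : DFun D C)
    (m : FunM D GM F G) (n : FunM D GM G H) (m' : FunM D GM F' G') (n' : FunM D GM G' H')
    (p : FunE D GE F F') (q : FunE D GE G G') (r : FunE D GE H H')
    (a : Mod m m' p q) (b : Mod n n' q r) : Mod (m ;; n) (m' ;; n') p r.
Proof.
refine (@Build_Mod _ _ _ _ (m ;; n) (m' ;; n') p r (fun x => hcomp (a x) (b x)) _ _).
- intros x y f.
  eapply sq_eq_trans; [apply sq_eq_sym, hcomp_assoc |].
  eapply sq_eq_trans; [apply hcomp_cong; [apply md_M | apply sq_refl] |].
  eapply sq_eq_trans; [apply hcomp_assoc |].
  eapply sq_eq_trans; [apply hcomp_cong; [apply sq_refl | apply md_M] |].
  apply sq_eq_sym, hcomp_assoc.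
- intros x y u.
  eapply sq_eq_trans; [apply eq_sq_eq, (interchange (msq m u) (msq n u)) |].
  eapply sq_eq_trans; [apply hcomp_cong; apply md_E |].
  apply eq_sq_eq; symmetry; apply (interchange (a x) (b x) (msq m' u) (msq n' u)).
Defined.

Definition Mod_vcomp (F F' F'' G G' G'' : DFun D C)
    (p : FunE D GE F F') (p' : FunE D GE F' F'') (q : FunE D GE G G') (q' : FunE D GE G' G'')
    (m : FunM D GM F G) (m' : FunM D GM F' G') (m'' : FunM D GM F'' G'')
    (a : Mod m m' p q) (b : Mod m' m'' p' q') : Mod m m'' (p ;; p') (q ;; q').
Proof.
refine (@Build_Mod _ _ _ _ m m'' (p ;; p') (q ;; q') (fun x => vcomp (a x) (b x)) _ _).
- intros x y f.
  eapply sq_eq_trans;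
    [apply eq_sq_eq; symmetry; apply (interchange (esq p f) (a y) (esq p' f) (b y)) |].
  eapply sq_eq_trans; [apply vcomp_cong; apply md_M |].
  apply eq_sq_eq, (interchange (a x) (esq q f) (b x) (esq q' f)).
- intros x y u.
  eapply sq_eq_trans; [apply sq_eq_sym, vcomp_assoc |].
  eapply sq_eq_trans; [apply vcomp_cong; [apply md_E | apply sq_refl] |].
  eapply sq_eq_trans; [apply vcomp_assoc |].
  eapply sq_eq_trans; [apply vcomp_cong; [apply sq_refl | apply md_E] |].
  apply sq_eq_sym, vcomp_assoc.
Defined.

Definition FunDC : DoubleCat.
Proof.
refine (@Build_DoubleCat (DFun D C) (FunM D GM) (FunE D GE) Mod
  Mod_hid Mod_vid Mod_hcomp Mod_vcomp _ _ _ _ _ _ _ _ _ _).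
- intros; apply Mod_eq; trivial; try apply comp_idl; intro; apply hcomp_idl.
- intros; apply Mod_eq; trivial; try apply comp_idr; intro; apply hcomp_idr.
- intros; apply Mod_eq; trivial; try apply comp_assoc; intro; apply hcomp_assoc.
- intros; apply Mod_eq; trivial; try apply comp_idl; intro; apply vcomp_idl.
- intros; apply Mod_eq; trivial; try apply comp_idr; intro; apply vcomp_idr.
- intros; apply Mod_eq; trivial; try apply comp_assoc; intro; apply vcomp_assoc.
- intros F; apply sq_eq_eq, Mod_eq; trivial; intro; apply eq_sq_eq, hid_vid.
- intros; apply Mod_eq; trivial; intro; apply hid_comp.
- intros; apply Mod_eq; trivial; intro; apply vid_comp.
- intros; apply sq_eq_eq, Mod_eq; trivial; intro; apply eq_sq_eq, interchange.
Defined.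

End FunctorDoubleCategory.

(* Commuting squares of m-natural transformations whose component cubes, one for
   each m-morphism f : x -> y of D, are good cubes. *)
Definition good_nat_square (D C : DoubleCat) (GM : GoodClass (M C))
    (F G H K : DFun D C) (a : FunM D GM F G) (b : FunM D GM F H)
    (g : FunM D GM G K) (h : FunM D GM H K) : Prop :=
  a ;; g = b ;; h /\
  forall (x y : D) (f : M D x y),
    good_cube GM (mm a x) (mm b x) (mm g x) (mm h x)
      (mm a y) (mm b y) (mm g y) (mm h y)
      (fmap (dM F) f) (fmap (dM G) f) (fmap (dM H) f) (fmap (dM K) f).

Definition functor_category (C : DoubleCat) (S : ECGW C) (D : DoubleCat) : DoubleCat :=
  FunDC (goodM S) (goodE S) D.

(* Main.v *)
(* In an ECGW category a square is determined by its boundary, so naturality and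
   modification data are properties and the problem becomes pointwise existence of
   squares and goodness of squares.  Up to isomorphism f and p = c(f) determine each
   other ([cpl]), and good squares of m-morphisms correspond to squares between their
   cokernels.  Two facts carry the proof.  First, e-morphisms between the corners of
   spans extend uniquely to star-pushouts: the kernel of the extension is the
   star-pushout of the kernels, by a 3x3 argument.  Second, if s is a square with upper
   m-side f and right e-side q, then A' *_(ker p) ker q -> B' has cokernel
   coker f ~> B ~> B'; hence a cube of kernels is good exactly when the upper m-sides
   are natural with good squares.  Everything except (PO) is self-dual, so each
   argument also gives its counterpart for e-morphisms. *)

Require Import Defs.
From Stdlib Require Import FunctionalExtensionality ProofIrrelevance ClassicalEpsilon.

Set Implicit Arguments.
Unset Strict Implicit.
Unset Printing Implicit Defensive.

(** * Good squares, star-pushouts and good cubes *)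

(** The obstacle is that (PO) has no counterpart for e-spans. Extending e-morphisms to star-pushouts
    requires a star-pushout of their kernels, and the transposed argument may not obtain it from
    (PO). The extension lemma therefore assumes a good completion of the span of kernels. For
    arbitrary m-spans (PO) supplies it; for a span that already has a good completion, the kernels
    of that completion supply it. Two rigidity facts replace diagram chases. A cospan of an m- and
    an e-morphism completes to a square in at most one way up to isomorphism, because kernel squares
    are pullbacks. A good square is a star-pushout exactly when its map of cokernels is invertible;
    the converse half is a five lemma obtained from (D). Good cubes enter through the universal
    property: for pointwise star-pushouts, the cube condition says that the induced transformation
    has good naturality squares. Pointwise objects and maps are selected by choice, and their
    functoriality comes from uniqueness. *)

Section Isomorphisms.
Variables (O : Type) (X : CatOn O).

Lemma iso_id A : is_iso (idm X A).
Proof. exists (idm X A); now rewrite comp_idl. Qed.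

Lemma iso_comp A B C (f : X A B) (g : X B C) : is_iso f -> is_iso g -> is_iso (f ;; g).
Proof.
intros (f' & H1 & H2) (g' & H3 & H4); exists (g' ;; f'); split.
- now rewrite comp_assoc, <- (comp_assoc g), H3, comp_idl.
- now rewrite comp_assoc, <- (comp_assoc f'), H2, comp_idl.
Qed.

Lemma iso_inverse A B (f : X A B) :
  is_iso f -> exists g, is_iso g /\ f ;; g = idm X A /\ g ;; f = idm X B.
Proof. intros (g & H & K); exists g; repeat split; trivial; now exists f. Qed.

Lemma iso_cancel_l A B C (f : X A B) (g : X B C) : is_iso f -> is_iso (f ;; g) -> is_iso g.
Proof.
intros (f' & H1 & H2) H.
replace g with (f' ;; (f ;; g)) by now rewrite <- comp_assoc, H2, comp_idl.
apply iso_comp; trivial; now exists f.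
Qed.

Lemma iso_cancel_r A B C (f : X A B) (g : X B C) : is_iso g -> is_iso (f ;; g) -> is_iso f.
Proof.
intros (g' & H1 & H2) H.
replace f with ((f ;; g) ;; g') by now rewrite comp_assoc, H1, comp_idr.
apply iso_comp; trivial; now exists g.
Qed.

Lemma initial_unique A B (f g : X A B) : is_initial X A -> f = g.
Proof. intros H; destruct (H B) as (h & K); now rewrite (K f), (K g). Qed.

Lemma iso_initial A B (f : X A B) : is_iso f -> is_initial X B -> is_initial X A.
Proof.
intros (g & H & K) I D; destruct (I D) as (d & L); exists (f ;; d); intros d'.
rewrite <- (L (g ;; d')), <- comp_assoc, H; symmetry; apply comp_idl.
Qed.

Lemma initial_initial A B (f : X A B) : is_initial X A -> is_initial X B -> is_iso f.
Proof.
intros HA HB; destruct (HB A) as (g & _); exists g.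
split; now apply initial_unique.
Qed.

End Isomorphisms.

(** * Pasting laws for star-pushouts and good cubes *)

Section StarFacts.
Variables (O : Type) (X : CatOn O) (G : GoodClass X).

Lemma good_comm A B C D (f : X A B) (g : X A C) (h : X B D) (k : X C D) :
  good G f g h k -> f ;; h = g ;; k.
Proof. intros H; apply (good_pullback H). Qed.

Lemma good_comp_r A B C A' B' C' (f : X A B) (f' : X B C) (g : X A' B') (g' : X B' C')
    (a : X A A') (b : X B B') (c : X C C') :
  good G f a b g -> good G f' b c g' -> good G (f ;; f') a c (g ;; g').
Proof. intros H K; apply good_sym; exact (good_comp (good_sym H) (good_sym K)). Qed.

(** Pasting with the triangle square whose domain map is the identity of [A] moves [g'] to the
    opposite side. *)
Lemma good_restrict A B C C' D (f : X A B) (g : X A C) (g' : X C C') (h : X B D) (k : X C' D) :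
  good G f (g ;; g') h k -> good G f g h (g' ;; k).
Proof.
intros H; apply good_sym; rewrite <- (comp_idl f).
refine (good_comp _ (good_sym H)).
apply good_triangle; split; [now rewrite comp_idl | apply iso_id].
Qed.

Lemma star_sym A B C P (f : X A B) (g : X A C) (h : X B P) (k : X C P) :
  is_star G f g h k -> is_star G g f k h.
Proof.
intros (H & K); split; [now apply good_sym |].
intros D h' k' L; destruct (K D k' h' (good_sym L)) as (d & (H1 & H2) & H3).
exists d; split; [now split |]; intros d' (? & ?); now apply H3.
Qed.

Lemma star_lift A B C P D (f : X A B) (g : X A C) (h : X B P) (k : X C P)
    (h' : X B D) (k' : X C D) :
  is_star G f g h k -> good G f g h' k' -> exists d : X P D, h ;; d = h' /\ k ;; d = k'.
Proof. intros (_ & H) K; destruct (H _ _ _ K) as (d & L & _); now exists d. Qed.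

(** The legs of a star-pushout are jointly epic only on maps whose composites with them form a good
    square, whence the goodness hypothesis. *)
Lemma star_ext A B C P D (f : X A B) (g : X A C) (h : X B P) (k : X C P) (d d' : X P D) :
  is_star G f g h k -> good G f g (h ;; d) (k ;; d) ->
  h ;; d = h ;; d' -> k ;; d = k ;; d' -> d = d'.
Proof.
intros (_ & H) K H1 H2; destruct (H _ _ _ K) as (e & _ & L).
rewrite <- (L d), <- (L d'); split; congruence.
Qed.

Lemma star_unique A B C P P' (f : X A B) (g : X A C) (h : X B P) (k : X C P)
    (h' : X B P') (k' : X C P') :
  is_star G f g h k -> is_star G f g h' k' ->
  exists i : X P P', is_iso i /\ h ;; i = h' /\ k ;; i = k'.
Proof.
intros H H'.
destruct (star_lift H (proj1 H')) as (i & H1 & H2).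
destruct (star_lift H' (proj1 H)) as (j & H3 & H4).
exists i; repeat split; trivial; exists j; split.
- symmetry; apply (star_ext H); rewrite ?comp_idr, <- ?comp_assoc, ?H1, ?H2; auto.
  apply (proj1 H).
- symmetry; apply (star_ext H'); rewrite ?comp_idr, <- ?comp_assoc, ?H3, ?H4; auto.
  apply (proj1 H').
Qed.

Lemma star_post_iso A B C P P' (f : X A B) (g : X A C) (h : X B P) (k : X C P) (i : X P P') :
  is_star G f g h k -> is_iso i -> is_star G f g (h ;; i) (k ;; i).
Proof.
intros H Hi; split.
{ rewrite <- (comp_idr g); refine (good_comp (proj1 H) _).
  apply good_triangle; split; [now rewrite comp_idl | apply iso_id]. }
intros D h' k' K; destruct (star_lift H K) as (d & <- & <-).
destruct Hi as (j & H1 & H2); exists (j ;; d); split.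
- now rewrite !comp_assoc, <- (comp_assoc i), H1, comp_idl.
- intros d' (H3 & H4); rewrite !comp_assoc in H3, H4.
  rewrite (star_ext H K (eq_sym H3) (eq_sym H4)).
  now rewrite <- comp_assoc, H2, comp_idl.
Qed.

Lemma star_iso_leg A B C (f : X A B) (g : X A C) (g' : X C A) :
  g ;; g' = idm X A -> g' ;; g = idm X C -> is_star G f g (idm X B) (g' ;; f).
Proof.
intros H K; split.
- apply good_triangle; split; [| now exists g'].
  now rewrite <- comp_assoc, H, comp_idl, comp_idr.
- intros D h k L; apply good_comm in L; exists h; split.
  + now rewrite comp_idl, comp_assoc, L, <- comp_assoc, K, comp_idl.
  + intros d (L1 & _); now rewrite <- L1, comp_idl.
Qed.

(** Two side faces and the far face of a cube give a good completion of the near span; this is the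
    input of [star_lift] that induces maps between star-pushouts. *)
Lemma good_span A B C A' B' C' D (f : X A B) (g : X A C) (f' : X A' B') (g' : X A' C')
    (a : X A A') (b : X B B') (c : X C C') (h : X B' D) (k : X C' D) :
  good G f a b f' -> good G g a c g' -> good G f' g' h k ->
  good G f g (b ;; h) (c ;; k).
Proof.
intros H K L; apply good_restrict; rewrite (good_comm K); exact (good_comp H L).
Qed.

Hypothesis HPOL : POL G.

(** The outer square demanded by (POL) is the face [K] pasted with the far square [L]. *)
Lemma star_face A B C A' B' C' P P' (f : X A B) (g : X A C) (f' : X A' B') (g' : X A' C')
    (a : X A A') (b : X B B') (c : X C C') (h : X B P) (k : X C P)
    (h' : X B' P') (k' : X C' P') (w : X P P') :
  good G f a b f' -> good G g a c g' -> is_star G f g h k -> good G f' g' h' k' ->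
  h ;; w = b ;; h' -> k ;; w = c ;; k' -> good G b h h' w.
Proof.
intros H K S L H1 H2; apply (HPOL S (eq_sym H1)).
rewrite H2, (good_comm H); apply good_sym; exact (good_comp K (good_sym L)).
Qed.

Lemma star_trans A B B2 C P P2 (f : X A B) (f2 : X B B2) (g : X A C)
    (h : X B P) (k : X C P) (h2 : X B2 P2) (k2 : X P P2) :
  is_star G f g h k -> is_star G f2 h h2 k2 -> is_star G (f ;; f2) g h2 (k ;; k2).
Proof.
intros H H2; split; [exact (good_comp_r (proj1 H) (proj1 H2)) |].
intros D h' k' K.
assert (L : good G f g (f2 ;; h') k').
{ apply good_sym, good_restrict, good_sym, K. }
destruct (star_lift H L) as (d & H3 & H4).
assert (N : good G f2 h h' d).
{ apply (HPOL H (eq_sym H3)); now rewrite H4. }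
destruct (star_lift H2 N) as (e & H5 & H6); exists e; split.
- now rewrite H5, comp_assoc, H6.
- intros e' (H7 & H8); apply (star_ext H2); rewrite ?H5, ?H6, ?H7; trivial.
  symmetry; apply (star_ext H); rewrite <- !comp_assoc, <- ?(good_comm (proj1 H2)), ?H8, ?H4;
    trivial; now rewrite comp_assoc, H7.
Qed.

Lemma star_cancel A B B2 C P P2 (f : X A B) (f2 : X B B2) (g : X A C)
    (h : X B P) (k : X C P) (h2 : X B2 P2) (k2 : X P P2) :
  is_star G f g h k -> is_star G (f ;; f2) g h2 (k ;; k2) -> f2 ;; h2 = h ;; k2 ->
  is_star G f2 h h2 k2.
Proof.
intros H H2 e; split; [apply (HPOL H e), (proj1 H2) |].
intros D h' k' K.
assert (L : good G (f ;; f2) g h' (k ;; k')) by exact (good_comp_r (proj1 H) K).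
destruct (star_lift H2 L) as (d & H3 & H4); exists d; split.
- split; trivial; symmetry; apply (star_ext H).
  + rewrite <- (good_comm K); apply good_sym, good_restrict, good_sym, L.
  + now rewrite <- (comp_assoc h), <- e, comp_assoc, H3, (good_comm K).
  + now rewrite <- H4, comp_assoc.
- intros d' (H5 & H6); apply (star_ext H2); rewrite ?H3, ?H4; trivial.
  + now rewrite H5.
  + now rewrite comp_assoc, H6.
Qed.

Hypothesis Hstar : forall A B C (f : X A B) (g : X A C), has_good_completion G f g ->
  exists P (h : X B P) (k : X C P), is_star G f g h k.

Lemma good_star A B C D (f : X A B) (g : X A C) (h : X B D) (k : X C D) :
  good G f g h k ->
  exists P (h' : X B P) (k' : X C P) (u : X P D),
    is_star G f g h' k' /\ h' ;; u = h /\ k' ;; u = k.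
Proof.
intros H; destruct (Hstar (ex_intro _ D (ex_intro _ h (ex_intro _ k H)))) as (P & h' & k' & S).
destruct (star_lift S H) as (u & H1 & H2); now exists P, h', k', u.
Qed.

Section Cube.
Variables (A B C D A' B' C' D' : O)
  (ab : X A B) (ac : X A C) (bd : X B D) (cd : X C D)
  (ab' : X A' B') (ac' : X A' C') (bd' : X B' D') (cd' : X C' D')
  (a : X A A') (b : X B B') (c : X C C') (d : X D D').

Definition good_faces : Prop :=
  good G ab ac bd cd /\ good G ab' ac' bd' cd' /\
  good G ab a b ab' /\ good G ac a c ac' /\
  good G bd b d bd' /\ good G cd c d cd'.

Lemma good_cube_intro :
  good_faces ->
  (forall P (h : X B P) (k : X C P) P' (h' : X B' P') (k' : X C' P')
     (w : X P P') (u : X P D) (u' : X P' D'),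
     is_star G ab ac h k -> is_star G ab' ac' h' k' ->
     h ;; w = b ;; h' -> k ;; w = c ;; k' ->
     h ;; u = bd -> k ;; u = cd -> h' ;; u' = bd' -> k' ;; u' = cd' ->
     w ;; u' = u ;; d -> good G w u u' d) ->
  good_cube G ab ac bd cd ab' ac' bd' cd' a b c d.
Proof.
intros HF H; split; [exact HF |]; destruct HF as (H1 & H2 & H3 & H4 & H5 & H6).
destruct (good_star H1) as (P & h & k & u & S & e1 & e2).
destruct (good_star H2) as (P' & h' & k' & u' & S' & e1' & e2').
destruct (star_lift S (good_span H3 H4 (proj1 S'))) as (w & e3 & e4).
exists P, h, k, P', h', k', w, u, u'; repeat (split; trivial).
apply (H P h k P' h' k'); trivial; apply (star_ext S).
- rewrite <- !comp_assoc, e3, e4, !comp_assoc, e1', e2'; exact (good_span H3 H4 H2).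
- now rewrite <- !comp_assoc, e3, e1, comp_assoc, e1', (good_comm H5).
- now rewrite <- !comp_assoc, e4, e2, comp_assoc, e2', (good_comm H6).
Qed.

(** The star-pushouts recorded in [good_cube] may be replaced by any others: the comparison
    isomorphisms form a triangle square, which is pasted in front. *)
Lemma good_cube_elim P (h : X B P) (k : X C P) P' (h' : X B' P') (k' : X C' P')
    (w : X P P') (u : X P D) (u' : X P' D') :
  good_cube G ab ac bd cd ab' ac' bd' cd' a b c d ->
  is_star G ab ac h k -> is_star G ab' ac' h' k' ->
  h ;; w = b ;; h' -> k ;; w = c ;; k' ->
  h ;; u = bd -> k ;; u = cd -> h' ;; u' = bd' -> k' ;; u' = cd' -> good G w u u' d.
Proof.
intros (HF & P0 & h0 & k0 & P0' & h0' & k0' & w0 & u0 & u0' & S0 & S0' &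
  (e1 & e2) & (e3 & e4) & (e5 & e6) & L) S S' e1' e2' e3' e4' e5' e6'.
destruct HF as (H1 & H2 & H3 & H4 & H5 & H6).
destruct (star_unique S S0) as (i & Hi & i1 & i2).
destruct (star_unique S' S0') as (i' & Hi' & i1' & i2').
assert (u = i ;; u0) as ->.
{ apply (star_ext S); rewrite <- ?comp_assoc, ?i1, ?i2; congruence. }
assert (u' = i' ;; u0') as ->.
{ apply (star_ext S'); rewrite <- ?comp_assoc, ?i1', ?i2'; congruence. }
refine (good_comp _ L); apply good_triangle; split; trivial.
apply (star_ext S).
- rewrite <- !comp_assoc, e1', e2', !comp_assoc, i1', i2'.
  exact (good_span H3 H4 (proj1 S0')).
- now rewrite <- !comp_assoc, e1', i1, comp_assoc, i1', e1.
- now rewrite <- !comp_assoc, e2', i2, comp_assoc, i2', e2.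
Qed.

End Cube.

Section CubeComp.
Variables (A B C D A' B' C' D' : O)
  (ab : X A B) (ac : X A C) (bd : X B D) (cd : X C D)
  (ab' : X A' B') (ac' : X A' C') (bd' : X B' D') (cd' : X C' D')
  (a : X A A') (b : X B B') (c : X C C') (d : X D D').

Lemma good_cube_sym :
  good_cube G ab ac bd cd ab' ac' bd' cd' a b c d ->
  good_cube G ac ab cd bd ac' ab' cd' bd' a c b d.
Proof.
intros K; pose proof K as ((H1 & H2 & H3 & H4 & H5 & H6) & _).
apply good_cube_intro; [repeat split; trivial; now apply good_sym |].
intros P h k P' h' k' w u u' S S' e1 e2 e3 e4 e5 e6 _.
exact (good_cube_elim K (star_sym S) (star_sym S') e2 e1 e4 e3 e6 e5).
Qed.

(** [D] and [D'] themselves serve as star-pushouts, so the comparison square has identity sides. *)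
Lemma good_cube_star :
  is_star G ab ac bd cd -> is_star G ab' ac' bd' cd' ->
  good G ab a b ab' -> good G ac a c ac' -> bd ;; d = b ;; bd' -> cd ;; d = c ;; cd' ->
  good_cube G ab ac bd cd ab' ac' bd' cd' a b c d.
Proof.
intros S S' H K e1 e2; split.
- repeat split; trivial; try apply S; try apply S'; apply good_sym.
  + exact (star_face H K S (proj1 S') e1 e2).
  + exact (star_face K H (star_sym S) (good_sym (proj1 S')) e2 e1).
- exists D, bd, cd, D', bd', cd', d, (idm X D), (idm X D').
  repeat split; rewrite ?comp_idr; trivial; try apply S; try apply S'.
  apply good_id.
Qed.

(** The star-pushout along an isomorphism [ac] is [B], so the comparison square is the face on
    [bd]. *)
Lemma good_cube_iso :
  is_iso ac -> is_iso ac' -> ab ;; bd = ac ;; cd -> ab' ;; bd' = ac' ;; cd' ->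
  good G ab a b ab' -> good G ac a c ac' -> good G bd b d bd' -> good G cd c d cd' ->
  good_cube G ab ac bd cd ab' ac' bd' cd' a b c d.
Proof.
intros Hi Hi' e e' H1 H2 H3 H4; split.
- repeat split; trivial; now apply good_triangle.
- destruct Hi as (i & i1 & i2), Hi' as (i' & i1' & i2').
  exists B, (idm X B), (i ;; ab), B', (idm X B'), (i' ;; ab'), b, bd, bd'.
  split; [now apply star_iso_leg |]; split; [now apply star_iso_leg |].
  rewrite !comp_idl, comp_idr, !comp_assoc, e, e', <- !comp_assoc, i2, i2', !comp_idl.
  repeat split; trivial; [| now apply good_sym].
  rewrite !comp_assoc, (good_comm H1), <- !(comp_assoc _ _ ab').
  f_equal.
  rewrite <- (comp_idr (i ;; a)), <- i1', !comp_assoc, <- (comp_assoc a), <- (good_comm H2).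
  now rewrite <- !comp_assoc, i2, comp_idl.
Qed.

End CubeComp.

Lemma good_cube_comp (A B C D F K A' B' C' D' F' K' : O)
    (ab : X A B) (cd : X C D) (fk : X F K) (ac : X A C) (bd : X B D) (cf : X C F) (dk : X D K)
    (ab' : X A' B') (cd' : X C' D') (fk' : X F' K')
    (ac' : X A' C') (bd' : X B' D') (cf' : X C' F') (dk' : X D' K')
    (a : X A A') (b : X B B') (c : X C C') (d : X D D') (f : X F F') (k : X K K') :
  good_cube G ab ac bd cd ab' ac' bd' cd' a b c d ->
  good_cube G cd cf dk fk cd' cf' dk' fk' c d f k ->
  good_cube G ab (ac ;; cf) (bd ;; dk) fk ab' (ac' ;; cf') (bd' ;; dk') fk' a b f k.
Proof.
intros Q1 Q2; pose proof Q1 as ((H1 & H2 & H3 & H4 & H5 & H6) & _).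
pose proof Q2 as ((K1 & K2 & K3 & K4 & K5 & K6) & _).
split.
{ repeat split; trivial.
  - exact (good_comp H1 K1).
  - exact (good_comp H2 K2).
  - exact (good_comp_r H4 K4).
  - exact (good_comp_r H5 K5). }
(* P = B * C over A, R = P * F over C is also B * F over A, and D * F over C is
   D * R over P. *)
destruct (good_star H1) as (P & h & l & u & S & s1 & s2).
destruct (good_star H2) as (P' & h' & l' & u' & S' & s1' & s2').
destruct (star_lift S (good_span H3 H4 (proj1 S'))) as (w & w1 & w2).
pose proof (good_cube_elim Q1 S S' w1 w2 s1 s2 s1' s2') as L1.
pose proof (star_face H4 H3 (star_sym S) (good_sym (proj1 S')) w2 w1) as L2.
destruct (good_star K1) as (T & m & n & v & ST & t1 & t2).
destruct (good_star K2) as (T' & m' & n' & v' & ST' & t1' & t2').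
destruct (star_lift ST (good_span K3 K4 (proj1 ST'))) as (z & z1 & z2).
pose proof (good_cube_elim Q2 ST ST' z1 z2 t1 t2 t1' t2') as L3.
rewrite <- s2 in ST; rewrite <- s2' in ST'.
assert (G1 : good G l cf (u ;; m) n).
{ apply good_sym, good_restrict, good_sym, (proj1 ST). }
assert (G1' : good G l' cf' (u' ;; m') n').
{ apply good_sym, good_restrict, good_sym, (proj1 ST'). }
destruct (good_star G1) as (R & x & y & r & SR & r1 & r2).
destruct (good_star G1') as (R' & x' & y' & r' & SR' & r1' & r2').
assert (L2' : good G l c w l') by (now apply good_sym).
destruct (star_lift SR (good_span L2' K4 (proj1 SR'))) as (q & q1 & q2).
assert (SU : is_star G u x m r).
{ apply (star_cancel SR); [rewrite r2; exact ST | now rewrite r1]. }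
assert (SU' : is_star G u' x' m' r').
{ apply (star_cancel SR'); [rewrite r2'; exact ST' | now rewrite r1']. }
assert (L4 : good G w x x' q) by exact (star_face L2' K4 SR (proj1 SR') q1 q2).
assert (L5 : good G q r r' z).
{ assert (e : r ;; z = q ;; r').
  { apply (star_ext SR).
    - rewrite <- !comp_assoc, r1, r2, z2, (comp_assoc u), z1.
      rewrite <- comp_assoc, <- (good_comm L1), !comp_assoc.
      refine (good_span L2' K4 _); exact G1'.
    - rewrite <- !comp_assoc, r1, q1, (comp_assoc u), z1, (comp_assoc w), r1'.
      now rewrite <- !comp_assoc, (good_comm L1).
    - rewrite <- !comp_assoc, r2, q2, z2, (comp_assoc f); now rewrite r2'. }
  refine (star_face (a := w) (f := x) (g := u) (g' := u') (f' := x')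
    (c := d) (h := r) (k := m) (k' := m') (w := z) _ _ _ _ _ _).
  - now apply good_sym.
  - now apply good_sym.
  - apply star_sym, SU.
  - apply good_sym, (proj1 SU').
  - exact e.
  - exact z1. }
(* [R] is the star-pushout for the composite cube. Its comparison square pastes the square from [R]
   to [T] with the comparison square of the second cube. *)
exists R, (h ;; x), y, R', (h' ;; x'), y', q, (r ;; v), (r' ;; v').
split; [apply star_sym; refine (star_trans (star_sym S) _); apply star_sym, SR |].
split; [apply star_sym; refine (star_trans (star_sym S') _); apply star_sym, SR' |].
repeat split.
- now rewrite comp_assoc, q1, <- !comp_assoc, w1.
- trivial.
- now rewrite !comp_assoc, <- (comp_assoc x), r1, comp_assoc, t1, <- comp_assoc, s1.
- now rewrite <- comp_assoc, r2.
- now rewrite !comp_assoc, <- (comp_assoc x'), r1', comp_assoc, t1', <- comp_assoc, s1'.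
- now rewrite <- comp_assoc, r2'.
- exact (good_comp L5 L3).
Qed.

End StarFacts.

(** * Self-dual ECGW structure *)

Definition has_sq (C : DoubleCat) (A B A' B' : C) (f : M C A B) (f' : M C A' B')
    (p : E C A A') (q : E C B B') : Prop :=
  inhabited (Sq f f' p q).

Section Squares.
Variable C : DoubleCat.

Lemma has_sq_hcomp (a b c a' b' c' : C) (f : M C a b) (g : M C b c)
    (f' : M C a' b') (g' : M C b' c') (p : E C a a') (q : E C b b') (r : E C c c') :
  has_sq f f' p q -> has_sq g g' q r -> has_sq (f ;; g) (f' ;; g') p r.
Proof. intros [s] [t]; exact (inhabits (hcomp s t)). Qed.

Lemma has_sq_vcomp (a b c a' b' c' : C) (p : E C a b) (q : E C b c)
    (p' : E C a' b') (q' : E C b' c') (f : M C a a') (g : M C b b') (h : M C c c') :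
  has_sq f g p p' -> has_sq g h q q' -> has_sq f h (p ;; q) (p' ;; q').
Proof. intros [s] [t]; exact (inhabits (vcomp s t)). Qed.

(** Since [sq_eq] includes equality of boundaries, this also makes the upper side a function of the
    other three. *)
Definition thin : Prop :=
  forall (A B A' B' : C) (f g : M C A B) (f' : M C A' B') (p : E C A A') (q : E C B B')
    (s : Sq f f' p q) (t : Sq g f' p q), sq_eq s t.

Definition k_full (G : GoodClass (M C)) (k : KerData G) : Prop :=
  forall (A B A' B' : C) (p : E C A A') (q : E C B B') (g : M C (ker k p) (ker k q))
    (f' : M C A' B'),
  good G (kmor k p) g f' (kmor k q) -> exists f : M C A B, has_sq f f' p q.

Definition axiomK (G : GoodClass (M C)) (k : KerData G) (empty : C)
    (cok : forall A B : C, M C A B -> Ob C)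
    (cmor : forall (A B : C) (f : M C A B), E C (cok A B f) B) : Prop :=
  forall (A B : C) (f : M C A B),
    exists (i : M C empty (cok _ _ f)) (e : E C empty A) (s : Sq i f e (cmor _ _ f)),
      ktriangle k s.

End Squares.

(* The part of the structure of an ECGW category that is invariant under
   exchanging m- and e-morphisms, with the equivalences k and c replaced by
   fullness and thinness (axiom K makes them essentially surjective). *)
Record PreECGW (C : DoubleCat) : Type := {
  sharedP : SharedIso C;
  goodMP : GoodClass (M C);
  goodEP : GoodClass (M (tr C));
  kP : KerData goodMP;
  cP : @KerData (tr C) goodEP;
  thinM : thin C;
  thinE : thin (tr C);
  kP_full : k_full kP;
  cP_full : k_full cP;
  emptyP : Ob C;
  emptyM : is_initial (M C) emptyP;
  emptyE : is_initial (E C) emptyP;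
  monoM : forall A B (f : M C A B), is_monic f;
  monoE : forall A B (f : E C A B), is_monic f;
  distP : forall A B A' B' (f : M C A B) (f' : M C A' B') (p : E C A A') (q : E C B B')
    (s : Sq f f' p q), ktriangle kP s <-> @ktriangle (tr C) goodEP cP _ _ _ _ p q f f' s;
  axK_MP : axiomK kP emptyP (fun A B f => kmor cP f);
  axK_EP : @axiomK (tr C) goodEP cP emptyP (fun A B p => ker kP p) (fun A B p => kmor kP p);
  starMP : star_axiom goodMP (fun A B f => kmor cP f);
  starEP : @star_axiom (tr C) goodEP (fun A B g => ker kP g) (fun A B g => kmor kP g);
  pblM : PBL C;
  pblE : PBL (tr C);
  polM : POL goodMP;
  polE : POL goodEP
}.

Arguments thinM {C} _ {A B A' B' f g f' _ q} s t.
Arguments thinE {C} _ {A B A' B' f g f' _ q} s t.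
Arguments kP_full {C} _ {A B A' B' _ q g f'}.
Arguments cP_full {C} _ {A B A' B' _ q g f'}.
Arguments emptyM {C} _.
Arguments emptyE {C} _.
Arguments monoM {C} _ {A B} f.
Arguments monoE {C} _ {A B} f.
Arguments distP {C} _ {A B A' B' f f' _ q} s.
Arguments axK_MP {C} _ {A B} f.
Arguments axK_EP {C} _ {A B} f.
Arguments starMP {C} _.
Arguments starEP {C} _.
Arguments pblM {C} _.
Arguments pblE {C} _.
Arguments polM {C} _.
Arguments polE {C} _.

Definition tr_shared (C : DoubleCat) (S : SharedIso C) : SharedIso (tr C).
Proof.
refine (@Build_SharedIso (tr C) (si_cat S) (@si_grpd C S) (si_E S) (si_M S)
  (si_E_creates S) (si_M_creates S) _ _ _ _).
- exact (@si_sq_E C S).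
- exact (@si_sq_E_unique C S).
- exact (@si_sq_M C S).
- exact (@si_sq_M_unique C S).
Defined.

(** [tr (tr C)] and [C] have convertible data but are not convertible as records, so the fields are
    restated. *)
Definition tr_KerData (C : DoubleCat) (G : GoodClass (M C)) (k : KerData G) :
  @KerData (tr (tr C)) G.
Proof.
refine (@Build_KerData (tr (tr C)) G (@ker C G k) (@kmor C G k)
  (fun A B A' B' f f' p q s => @kmap C G k A B A' B' f f' p q s) _ _ _).
- exact (@kmap_good C G k).
- exact (@kmap_id C G k).
- exact (@kmap_comp C G k).
Defined.

Definition tr_pre (C : DoubleCat) (P : PreECGW C) : PreECGW (tr C).
Proof.
refine (@Build_PreECGW (tr C) (tr_shared (sharedP P)) (goodEP P) (goodMP P)
  (cP P) (tr_KerData (kP P)) (@thinE C P) _ (@cP_full C P) (@kP_full C P) (emptyP P)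
  (emptyE P) (emptyM P) (@monoE C P) (@monoM C P) _ (@axK_EP C P) _ (starEP P) (starMP P)
  (pblE P) (pblM P) (polE P) (polM P)).
- intros A B A' B' f g f' p q s t; exact (sq_eq_tr (sq_eq_tr (thinM P s t))).
- intros A B A' B' f f' p q s; split; apply (@distP C P).
- exact (@axK_MP C P).
Defined.

(** * Complements *)

Definition over_iso (O : Type) (X : CatOn O) A A' B (f : X A B) (g : X A' B) : Prop :=
  exists i : X A A', is_iso i /\ i ;; g = f.

Section OverIso.
Variables (O : Type) (X : CatOn O).

Lemma over_iso_refl A B (f : X A B) : over_iso f f.
Proof. exists (idm X A); split; [apply iso_id | apply comp_idl]. Qed.

Lemma over_iso_sym A A' B (f : X A B) (g : X A' B) : over_iso f g -> over_iso g f.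
Proof.
intros (i & Hi & <-); destruct (iso_inverse Hi) as (j & Hj & _ & e).
exists j; split; trivial; now rewrite <- comp_assoc, e, comp_idl.
Qed.

Lemma over_iso_trans A A' A'' B (f : X A B) (g : X A' B) (h : X A'' B) :
  over_iso f g -> over_iso g h -> over_iso f h.
Proof.
intros (i & Hi & <-) (j & Hj & <-); exists (i ;; j); split; [now apply iso_comp |].
apply comp_assoc.
Qed.

Lemma over_iso_pre A A' B (i : X A A') (f : X A' B) : is_iso i -> over_iso (i ;; f) f.
Proof. intros H; now exists i. Qed.

Lemma over_iso_post A A' B B' (f : X A B) (g : X A' B) (h : X B B') :
  over_iso f g -> over_iso (f ;; h) (g ;; h).
Proof. intros (i & Hi & <-); exists i; split; trivial; symmetry; apply comp_assoc. Qed.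

End OverIso.

(** * Shared isomorphisms and subobjects determined by their kernels *)

Section IsoPairs.
Variables (C : DoubleCat) (P : PreECGW C).

Definition iso_pair (A B : C) (f : M C A B) (p : E C A B) : Prop :=
  exists i : si_cat (sharedP P) A B, fmap (si_M (sharedP P)) i = f /\ fmap (si_E (sharedP P)) i = p.

Lemma functor_iso (O : Type) (X Y : CatOn O) (F : FunctorOn (fun A => A) X Y) A B (i : X A B) :
  is_iso i -> is_iso (fmap F i).
Proof.
intros (j & H & K); exists (fmap F j); split;
  (etransitivity; [symmetry; exact (fmap_comp F _ _) |]).
- rewrite H; exact (fmap_id F A).
- rewrite K; exact (fmap_id F B).
Qed.

Lemma iso_pair_isoM (A B : C) (f : M C A B) (p : E C A B) : iso_pair f p -> is_iso f.
Proof. intros (i & <- & _); apply functor_iso, si_grpd. Qed.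

Lemma iso_pair_isoE (A B : C) (f : M C A B) (p : E C A B) : iso_pair f p -> is_iso p.
Proof. intros (i & _ & <-); apply functor_iso, si_grpd. Qed.

Lemma iso_pair_ofM (A B : C) (f : M C A B) : is_iso f -> exists p, iso_pair f p.
Proof.
intros H; destruct (si_M_creates (sharedP P) H) as (i & Hi & _).
now exists (fmap (si_E (sharedP P)) i), i.
Qed.

Lemma iso_pair_ofE (A B : C) (p : E C A B) : is_iso p -> exists f, iso_pair f p.
Proof.
intros H; destruct (si_E_creates (sharedP P) H) as (i & Hi & _).
now exists (fmap (si_M (sharedP P)) i), i.
Qed.

Lemma iso_pair_funE (A B : C) (f : M C A B) (p q : E C A B) :
  iso_pair f p -> iso_pair f q -> p = q.
Proof.
intros H (j & <- & <-); pose proof (iso_pair_isoM H) as K.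
destruct H as (i & e & <-), (si_M_creates (sharedP P) K) as (l & _ & L).
now rewrite <- (L i e), <- (L j eq_refl).
Qed.

Lemma iso_pair_funM (A B : C) (f g : M C A B) (p : E C A B) :
  iso_pair f p -> iso_pair g p -> f = g.
Proof.
intros H (j & <- & <-); pose proof (iso_pair_isoE H) as K.
destruct H as (i & <- & e), (si_E_creates (sharedP P) K) as (l & _ & L).
now rewrite <- (L i e), <- (L j eq_refl).
Qed.

Lemma iso_pair_id (A : C) : iso_pair (idm (M C) A) (idm (E C) A).
Proof. exists (idm (si_cat (sharedP P)) A); split; exact (fmap_id _ A). Qed.

Lemma iso_pair_comp (A B D : C) (f : M C A B) (g : M C B D) (p : E C A B) (q : E C B D) :
  iso_pair f p -> iso_pair g q -> iso_pair (f ;; g) (p ;; q).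
Proof. intros (i & <- & <-) (j & <- & <-); exists (i ;; j); split; exact (fmap_comp _ i j). Qed.

Lemma iso_pair_sqM (A B A' B' : C) (g : M C A B) (g' : M C A' B')
    (f : M C A A') (f' : M C B B') (p : E C A A') (p' : E C B B') :
  iso_pair f p -> iso_pair f' p' -> (has_sq g g' p p' <-> f ;; g' = g ;; f').
Proof. intros (i & <- & <-) (j & <- & <-); apply si_sq_M. Qed.

Lemma iso_pair_sqE (A B A' B' : C) (g : E C A B) (g' : E C A' B')
    (f : M C A A') (f' : M C B B') (p : E C A A') (p' : E C B B') :
  iso_pair f p -> iso_pair f' p' -> (has_sq f f' g g' <-> p ;; g' = g ;; p').
Proof. intros (i & <- & <-) (j & <- & <-); apply si_sq_E. Qed.

Lemma sq_top_unique (A B A' B' : C) (f g : M C A B) (f' : M C A' B')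
    (p : E C A A') (q : E C B B') :
  has_sq f f' p q -> has_sq g f' p q -> f = g.
Proof. intros [s] [t]; apply (sq_eq_bd (thinM P s t)). Qed.

Lemma kmap_unique (A B A' B' : C) (f : M C A B) (f' : M C A' B')
    (p : E C A A') (q : E C B B') (s : Sq f f' p q) g :
  g ;; kmor (kP P) q = kmor (kP P) p ;; f' -> g = kmap (kP P) s.
Proof.
intros e; apply (monoM P (kmor (kP P) q)); rewrite e.
exact (good_comm (kmap_good (kP P) s)).
Qed.

(** Initiality of [B] gives [f] a section, and a monic map with a section is invertible. *)
Lemma initialM_strict (A B : C) (f : M C A B) : is_initial (M C) B -> is_iso f.
Proof.
intros H; destruct (H A) as (g & _); exists g; split.
- apply (monoM P f); rewrite comp_assoc, comp_idl.
  rewrite (initial_unique (g ;; f) (idm (M C) B) H); apply comp_idr.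
- now apply initial_unique.
Qed.

(** Fullness lifts the isomorphism of kernels and its inverse to squares over the identity of [B],
    thinness makes their upper sides inverse, and the shared isomorphism reads such a square as a
    commuting triangle of e-morphisms. *)
Lemma k_reflects (A A' B : C) (p : E C A B) (q : E C A' B) :
  over_iso (kmor (kP P) p) (kmor (kP P) q) -> over_iso p q.
Proof.
intros (g & Hg & e); destruct (iso_inverse Hg) as (h & Hh & e1 & e2).
assert (e' : h ;; kmor (kP P) p = kmor (kP P) q).
{ now rewrite <- e, <- comp_assoc, e2, comp_idl. }
assert (G1 : good (goodMP P) (kmor (kP P) p) g (idm (M C) B) (kmor (kP P) q)).
{ apply good_triangle; split; trivial; now rewrite comp_idr. }
assert (G2 : good (goodMP P) (kmor (kP P) q) h (idm (M C) B) (kmor (kP P) p)).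
{ apply good_triangle; split; trivial; now rewrite comp_idr. }
destruct (kP_full P G1) as (f & S), (kP_full P G2) as (f' & S').
assert (Hf : is_iso f).
{ exists f'; split.
  - apply (sq_top_unique (has_sq_hcomp S S')); rewrite comp_idl; exact (inhabits (hid p)).
  - apply (sq_top_unique (has_sq_hcomp S' S)); rewrite comp_idl; exact (inhabits (hid q)). }
destruct (iso_pair_ofM Hf) as (j & Hj); exists j; split; [exact (iso_pair_isoE Hj) |].
pose proof (proj1 (iso_pair_sqE _ _ Hj (iso_pair_id B)) S) as H; now rewrite comp_idr in H.
Qed.

Lemma k_preserves (A A' B : C) (p : E C A B) (q : E C A' B) :
  over_iso p q -> over_iso (kmor (kP P) p) (kmor (kP P) q).
Proof.
intros (j & Hj & e); destruct (iso_inverse Hj) as (l & Hl & e1 & e2).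
assert (e' : l ;; p = q) by now rewrite <- e, <- comp_assoc, e2, comp_idl.
destruct (iso_pair_ofE Hj) as (f & Hf), (iso_pair_ofE Hl) as (g & Hg).
destruct (proj2 (iso_pair_sqE p q Hf (iso_pair_id B))) as [s]; [now rewrite comp_idr |].
destruct (proj2 (iso_pair_sqE q p Hg (iso_pair_id B))) as [t]; [now rewrite comp_idr |].
pose proof (good_comm (kmap_good (kP P) s)) as H; rewrite comp_idr in H.
pose proof (good_comm (kmap_good (kP P) t)) as K; rewrite comp_idr in K.
exists (kmap (kP P) s); split; [| now symmetry].
exists (kmap (kP P) t); split; apply (monoM P (kmor (kP P) _));
  rewrite comp_idl, comp_assoc; congruence.
Qed.

End IsoPairs.

(** * Kernels and cokernels as mutually inverse operations *)

Section Complements.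
Variables (C : DoubleCat) (P : PreECGW C).

Lemma sq_left_unique (A B A' B' : C) (f : M C A B) (f' : M C A' B')
    (p r : E C A A') (q : E C B B') :
  has_sq f f' p q -> has_sq f f' r q -> p = r.
Proof. exact (@sq_top_unique (tr C) (tr_pre P) A A' B B' p r q f f'). Qed.

Lemma initialE_strict (A B : C) (p : E C A B) : is_initial (E C) B -> is_iso p.
Proof. exact (@initialM_strict (tr C) (tr_pre P) A B p). Qed.

Lemma c_reflects (A A' B : C) (f : M C A B) (g : M C A' B) :
  over_iso (kmor (cP P) f) (kmor (cP P) g) -> over_iso f g.
Proof. exact (@k_reflects (tr C) (tr_pre P) A A' B f g). Qed.

Lemma c_preserves (A A' B : C) (f : M C A B) (g : M C A' B) :
  over_iso f g -> over_iso (kmor (cP P) f) (kmor (cP P) g).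
Proof. exact (@k_preserves (tr C) (tr_pre P) A A' B f g). Qed.

(** (K) at the identity of [A] identifies [e] with the cokernel of that identity; (K) at [e] shows
    that the cokernel of [k(e)] is initial too. As [c] reflects isomorphism of subobjects, [k(e)]
    agrees with the identity. *)
Lemma ker_empty (A : C) (e : E C (emptyP P) A) : is_iso (kmor (kP P) e).
Proof.
destruct (axK_MP P (idm (M C) A)) as (i & e0 & s & H1 & H2).
assert (e0 = e) as -> by (apply initial_unique, emptyE).
set (q := kmor (cP P) (idm (M C) A)) in *.
assert (Hq : over_iso e q).
{ apply (k_reflects (P := P)); exists (kmap (kP P) s); split; trivial.
  now rewrite <- H1, comp_idr. }
destruct (axK_EP P e) as (i1 & e1 & t & H3 & H4).
assert (H5 : is_initial (E C) (ker (cP P) (kmor (kP P) e))).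
{ destruct (iso_inverse H4) as (y & Hy & _).
  apply (iso_initial Hy).
  apply (iso_initial (initialE_strict (kmor (cP P) e1) (emptyE P)) (emptyE P)). }
assert (H6 : over_iso (kmor (kP P) e) (idm (M C) A)).
{ apply c_reflects; fold q; refine (over_iso_trans _ Hq).
  destruct (H5 (emptyP P)) as (y & _); exists y; split.
  - exact (initial_initial y H5 (emptyE P)).
  - now apply initial_unique. }
destruct H6 as (x & Hx & <-); rewrite comp_idr; exact Hx.
Qed.

(* p is, up to isomorphism, the cokernel of f, equivalently f is the kernel of p *)
Definition cpl (A B X : C) (f : M C A B) (p : E C X B) : Prop :=
  over_iso f (kmor (kP P) p).

Lemma cpl_k (A B : C) (p : E C A B) : cpl (kmor (kP P) p) p.
Proof. apply over_iso_refl. Qed.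

(** The distinguished square of (K) identifies the kernel of [c(f)] with that of the e-morphism from
    the initial object to [A], which is [A] by [ker_empty]. *)
Lemma cpl_c (A B : C) (f : M C A B) : cpl f (kmor (cP P) f).
Proof.
destruct (axK_MP P f) as (i & e & s & H1 & H2).
destruct (iso_inverse (ker_empty e)) as (j & Hj & e1 & e2).
exists (j ;; kmap (kP P) s); split; [now apply iso_comp |].
now rewrite comp_assoc, <- H1, <- comp_assoc, e2, comp_idl.
Qed.

End Complements.

Section ComplementDuality.
Variables (C : DoubleCat) (P : PreECGW C).

Lemma cpl_k_dual (A B : C) (p : E C A B) : over_iso p (kmor (cP P) (kmor (kP P) p)).
Proof. exact (@cpl_c (tr C) (tr_pre P) A B p). Qed.

Lemma cpl_cok (A B X : C) (f : M C A B) (p : E C X B) :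
  cpl P f p <-> over_iso p (kmor (cP P) f).
Proof.
split; intros H.
- apply (over_iso_trans (cpl_k_dual p)), (c_preserves P), over_iso_sym, H.
- apply (over_iso_trans (cpl_c P f)), (k_preserves P), over_iso_sym, H.
Qed.

(** Self-duality of [cpl], through which the lemmas on complements are transposed. *)
Lemma cpl_tr (A B X : C) (f : M C A B) (p : E C X B) :
  cpl P f p <-> @cpl (tr C) (tr_pre P) X B A p f.
Proof. exact (cpl_cok f p). Qed.

Lemma cpl_over_l (A A' B X : C) (f : M C A B) (f' : M C A' B) (p : E C X B) :
  over_iso f' f -> cpl P f p -> cpl P f' p.
Proof. apply over_iso_trans. Qed.

Lemma cpl_over_r (A B X X' : C) (f : M C A B) (p : E C X B) (p' : E C X' B) :
  over_iso p' p -> cpl P f p -> cpl P f p'.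
Proof. intros H K; apply cpl_cok in K; apply cpl_cok; exact (over_iso_trans H K). Qed.

Lemma cpl_unique_l (A A' B X : C) (f : M C A B) (f' : M C A' B) (p : E C X B) :
  cpl P f p -> cpl P f' p -> over_iso f f'.
Proof. intros H K; exact (over_iso_trans H (over_iso_sym K)). Qed.

Lemma cpl_unique_r (A B X X' : C) (f : M C A B) (p : E C X B) (p' : E C X' B) :
  cpl P f p -> cpl P f p' -> over_iso p p'.
Proof.
intros H K; apply cpl_cok in H; apply cpl_cok in K; exact (over_iso_trans H (over_iso_sym K)).
Qed.

(** Both directions compare [p] with the e-morphism from the initial object, whose kernel is
    invertible by [ker_empty]. *)
Lemma cpl_iso (A B X : C) (f : M C A B) (p : E C X B) :
  cpl P f p -> (is_iso f <-> is_initial (E C) X).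
Proof.
intros H; destruct (emptyE P B) as (e & _); pose proof (ker_empty e) as He; split; intros K.
- assert (L : over_iso p e).
  { refine (cpl_unique_r H _); apply over_iso_sym; destruct (iso_inverse K) as (g & Hg & _ & e1).
    exists (kmor (kP P) e ;; g); split; [now apply iso_comp |].
    now rewrite comp_assoc, e1, comp_idr. }
  destruct L as (i & Hi & _); exact (iso_initial Hi (emptyE P)).
- assert (L : over_iso p e).
  { destruct (K (emptyP P)) as (i & _); exists i; split.
    - exact (initial_initial i K (emptyE P)).
    - now apply initial_unique. }
  destruct (cpl_over_r (over_iso_sym L) H) as (i & Hi & <-); now apply iso_comp.
Qed.

Lemma good_over_iso (A A0 B A' A0' B' : C) (f : M C A B) (f0 : M C A0 B)
    (f' : M C A' B') (f0' : M C A0' B') (g : M C A A') (h : M C B B') :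
  over_iso f f0 -> over_iso f' f0' -> good (goodMP P) f g h f' ->
  exists g0, good (goodMP P) f0 g0 h f0'.
Proof.
intros H (i' & Hi' & e') K; destruct (over_iso_sym H) as (i & Hi & e).
exists ((i ;; g) ;; i'); rewrite <- (comp_idr h), <- (comp_idl h).
refine (good_comp (good_comp _ K) _); apply good_triangle; split; trivial;
  now rewrite comp_idr.
Qed.

Lemma good_sq (A B A' B' X X' : C) (f : M C A B) (f' : M C A' B') (p : E C X B) (p' : E C X' B')
    (g : M C A A') (h : M C B B') :
  cpl P f p -> cpl P f' p' -> good (goodMP P) f g h f' -> exists r, has_sq r h p p'.
Proof.
intros H H' K; destruct (good_over_iso H H' K) as (g0 & L); exact (kP_full P L).
Qed.

Lemma sq_good (A B A' B' X X' : C) (f : M C A B) (f' : M C A' B') (p : E C X B) (p' : E C X' B')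
    (r : M C X X') (h : M C B B') :
  cpl P f p -> cpl P f' p' -> has_sq r h p p' -> exists g, good (goodMP P) f g h f'.
Proof.
intros H H' [s].
exact (good_over_iso (over_iso_sym H) (over_iso_sym H') (kmap_good (kP P) s)).
Qed.

(** The working test for goodness: [f'] is monic, so a commuting square over [h] must be the good
    one induced by the square of cokernels. *)
Lemma sq_good_comm (A B A' B' X X' : C) (f : M C A B) (f' : M C A' B')
    (p : E C X B) (p' : E C X' B') (g : M C A A') (r : M C X X') (h : M C B B') :
  cpl P f p -> cpl P f' p' -> has_sq r h p p' -> f ;; h = g ;; f' ->
  good (goodMP P) f g h f'.
Proof.
intros H H' K e; destruct (sq_good H H' K) as (g' & L).
replace g with g'; trivial; apply (monoM P f'); rewrite <- e; symmetry; exact (good_comm L).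
Qed.

End ComplementDuality.

(** * Quotients of composites and a five lemma *)

Section CompositesAndComplements.
Variables (C : DoubleCat) (P : PreECGW C).

Lemma goodE_sq (A B A' B' X X' : C) (f : M C A B) (f' : M C A' B') (p : E C X B) (p' : E C X' B')
    (g : E C X X') (h : E C B B') :
  cpl P f p -> cpl P f' p' -> good (goodEP P) p g h p' -> exists e, has_sq f f' e h.
Proof.
intros H H'; apply cpl_tr in H; apply cpl_tr in H'.
exact (@good_sq (tr C) (tr_pre P) X B X' B' A A' p p' f f' g h H H').
Qed.

Lemma sq_goodE (A B A' B' X X' : C) (f : M C A B) (f' : M C A' B') (p : E C X B) (p' : E C X' B')
    (e : E C A A') (h : E C B B') :
  cpl P f p -> cpl P f' p' -> has_sq f f' e h ->
  exists g : E C X X', good (goodEP P) p g h p'.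
Proof.
intros H H'; apply cpl_tr in H; apply cpl_tr in H'.
exact (@sq_good (tr C) (tr_pre P) X B X' B' A A' p p' f f' e h H H').
Qed.

(* The quotients of a composite A >-> B >-> D: D/B ~> D/A with kernel B/A. *)
Lemma cpl_comp (A B D X Y Z : C) (f : M C A B) (h : M C B D)
    (p : E C X D) (q : E C Y D) (r : E C Z B) :
  cpl P (f ;; h) p -> cpl P h q -> cpl P f r ->
  exists (t : E C Y X) (n : M C Z X), t ;; p = q /\ cpl P n t /\ has_sq n h r p.
Proof.
intros Hp Hq Hr.
assert (K : good (goodMP P) f (idm (M C) A) h (f ;; h)).
{ apply good_triangle; split; [now rewrite comp_idl | apply iso_id]. }
destruct (good_sq Hr Hp K) as (n & [s]).
assert (T : ktriangle (kP P) s).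
{ split; [exact (good_comm (kmap_good (kP P) s)) |].
  destruct Hp as (j & Hj & ej), Hr as (i & Hi & ei).
  apply (@iso_cancel_l _ _ _ _ _ i); trivial.
  replace (i ;; kmap (kP P) s) with j; trivial.
  apply (monoM P (kmor (kP P) p)).
  rewrite ej, comp_assoc, <- (good_comm (kmap_good (kP P) s)), <- comp_assoc; now rewrite ei. }
apply (distP P) in T; destruct T as (e & T).
set (m := kmap (cP P) _) in *.
destruct (iso_inverse T) as (m' & Hm' & e1 & e2).
apply cpl_cok in Hq; destruct Hq as (y & Hy & <-).
exists (y ;; (m' ;; kmor (cP P) n)), n; split; [| split].
- rewrite !comp_assoc; f_equal; change (comp (c := E C)) with (comp (c := M (tr C))).
  rewrite e, <- comp_assoc, e2; apply comp_idl.
- apply cpl_cok; rewrite <- comp_assoc; apply over_iso_pre; now apply iso_comp.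
- exact (inhabits s).
Qed.

(** A five lemma. Invertibility of [g] makes the square distinguished, so (D) identifies the
    cokernels of [n] and [h]; the former is initial, hence so is the latter, and [h] is
    invertible. *)
Lemma sq_iso_bot (A B A' D X Z : C) (f : M C A B) (f' : M C A' D) (g : M C A A')
    (n : M C Z X) (h : M C B D) (r : E C Z B) (p : E C X D) :
  cpl P f r -> cpl P f' p -> has_sq n h r p -> f ;; h = g ;; f' -> is_iso g -> is_iso n ->
  is_iso h.
Proof.
intros Hr Hp [s] e Hg Hn.
assert (T : ktriangle (kP P) s).
{ split; [exact (good_comm (kmap_good (kP P) s)) |].
  destruct Hp as (j & Hj & ej), Hr as (i & Hi & ei).
  apply (@iso_cancel_l _ _ _ _ _ i); trivial.
  replace (i ;; kmap (kP P) s) with (g ;; j); [now apply iso_comp |].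
  apply (monoM P (kmor (kP P) p)).
  rewrite !comp_assoc, ej, <- (good_comm (kmap_good (kP P) s)), <- comp_assoc; now rewrite ei. }
apply (distP P) in T; destruct T as (_ & T); destruct (iso_inverse T) as (m' & Hm' & _).
apply (cpl_iso (cpl_c P h)); apply (iso_initial Hm').
now apply (cpl_iso (cpl_c P n)).
Qed.

End CompositesAndComplements.

(** * Squares and star-pushouts *)

Section SquareCalculus.
Variables (C : DoubleCat) (P : PreECGW C).

Lemma pbl_v (a b c a' b' c' : C) (f : E C a b) (g : E C b c) (f' : E C a' b') (g' : E C b' c')
    (p : M C a a') (q : M C b b') (r : M C c c') :
  has_sq q r g g' -> has_sq p r (f ;; g) (f' ;; g') -> has_sq p q f f'.
Proof. exact (@pblE C P a b c a' b' c' f g f' g' p q r). Qed.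

Lemma pbl_h (a b c a' b' c' : C) (f : M C a b) (g : M C b c) (f' : M C a' b') (g' : M C b' c')
    (p : E C a a') (q : E C b b') (r : E C c c') :
  has_sq g g' q r -> has_sq (f ;; g) (f' ;; g') p r -> has_sq f f' p q.
Proof. apply (pblM P). Qed.

Lemma iso_pair_inv (A B : C) (f : M C A B) (g : M C B A) (p : E C A B) :
  iso_pair P f p -> f ;; g = idm (M C) A -> g ;; f = idm (M C) B ->
  exists q, iso_pair P g q /\ p ;; q = idm (E C) A /\ q ;; p = idm (E C) B.
Proof.
intros H e1 e2.
destruct (iso_pair_ofM P (f := g)) as (q & Hq); [now exists f |].
exists q; repeat split; trivial.
- apply (iso_pair_funE (iso_pair_comp H Hq)); rewrite e1; apply iso_pair_id.
- apply (iso_pair_funE (iso_pair_comp Hq H)); rewrite e2; apply iso_pair_id.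
Qed.

Lemma sq_pre_iso (A0 A B A' B' : C) (i : M C A0 A) (j : E C A0 A) (f : M C A B)
    (f' : M C A' B') (p : E C A A') (q : E C B B') :
  iso_pair P i j -> has_sq f f' p q -> has_sq (i ;; f) f' (j ;; p) q.
Proof.
intros H S; rewrite <- (comp_idl q); refine (has_sq_vcomp _ S).
apply (iso_pair_sqM _ _ H (iso_pair_id P B)); now rewrite comp_idr.
Qed.

(** A shared isomorphism can be carried around a corner of a square, from an m-side to an e-side. *)
Lemma sq_post_iso (A B B0 A' B' : C) (i : M C B B0) (j : E C B B0) (f : M C A B)
    (f' : M C A' B') (p : E C A A') (q : E C B0 B') :
  iso_pair P i j -> (has_sq (f ;; i) f' p q <-> has_sq f f' p (j ;; q)).
Proof.
intros H; split; intros S.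
- rewrite <- (comp_idl p); refine (has_sq_vcomp _ S).
  apply (iso_pair_sqM _ _ (iso_pair_id P A) H); now rewrite comp_idl.
- destruct (iso_pair_isoM H) as (i' & e1 & e2).
  destruct (iso_pair_inv H e1 e2) as (j' & H' & _ & e3).
  rewrite <- (comp_idl p), <- (comp_idl q), <- e3, comp_assoc; refine (has_sq_vcomp _ S).
  apply (iso_pair_sqM _ _ (iso_pair_id P A) H'); now rewrite comp_idl, comp_assoc, e1, comp_idr.
Qed.

(** Fullness is applied to the isomorphism of kernels and to its inverse; thinness makes the two
    upper sides inverse to each other. *)
Lemma iso_ker_sq (X X' Y Y' N N' : C) (n : M C N X') (al : E C X X') (n' : M C N' Y')
    (be : E C Y Y') (rho : M C N N') (r' : M C X' Y') :
  cpl P n al -> cpl P n' be -> is_iso rho -> is_iso r' -> n ;; r' = rho ;; n' ->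
  exists r : M C X Y, is_iso r /\ has_sq r r' al be.
Proof.
intros H H' (rh' & e1 & e2) (s' & e3 & e4) e.
assert (K : good (goodMP P) n rho r' n') by (apply good_triangle; split; trivial; now exists rh').
assert (K' : good (goodMP P) n' rh' s' n).
{ apply good_triangle; split; [| now exists rho].
  rewrite <- (comp_idl n'), <- e2, !comp_assoc, <- (comp_assoc _ n'), <- e, comp_assoc, e3.
  now rewrite comp_idr. }
destruct (good_sq H H' K) as (r & S), (good_sq H' H K') as (s & S').
exists r; split; trivial; exists s; split.
- apply (sq_top_unique P (has_sq_hcomp S S')); rewrite e3; exact (inhabits (hid al)).
- apply (sq_top_unique P (has_sq_hcomp S' S)); rewrite e4; exact (inhabits (hid be)).
Qed.

Lemma cpl_post_iso (A X B D : C) (n : M C A B) (al : E C X B) (i : M C B D) (j : E C B D) :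
  cpl P n al -> iso_pair P i j -> cpl P (n ;; i) (al ;; j).
Proof.
intros H Hi; destruct (iso_pair_isoM Hi) as (i' & e1 & e2).
destruct (iso_pair_inv Hi e1 e2) as (j' & Hi' & e3 & e4).
apply (over_iso_trans (over_iso_post i H)).
destruct (proj2 (iso_pair_sqE al (al ;; j) (iso_pair_id P X) Hi)) as [s]; [apply comp_idl |].
destruct (proj2 (iso_pair_sqE (al ;; j) al (iso_pair_id P X) Hi')) as [t].
{ now rewrite comp_idl, comp_assoc, e3, comp_idr. }
pose proof (good_comm (kmap_good (kP P) s)) as S.
pose proof (good_comm (kmap_good (kP P) t)) as T.
exists (kmap (kP P) s); split; [| now symmetry].
exists (kmap (kP P) t); split; apply (monoM P (kmor (kP P) _)); rewrite comp_idl, comp_assoc.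
- now rewrite <- T, <- comp_assoc, <- S, comp_assoc, e1, comp_idr.
- now rewrite <- S, <- comp_assoc, <- T, comp_assoc, e2, comp_idr.
Qed.

Lemma iso_sq_ker (X X' Y Y' N N' : C) (n : M C N X') (al : E C X X') (n' : M C N' Y')
    (be : E C Y Y') (rho : M C N N') (r : M C X Y) (r' : M C X' Y') :
  cpl P n al -> cpl P n' be -> is_iso r -> is_iso r' -> has_sq r r' al be ->
  n ;; r' = rho ;; n' -> is_iso rho.
Proof.
intros H H' Hr Hr' S e.
destruct (iso_pair_ofM P Hr) as (r1 & K), (iso_pair_ofM P Hr') as (r1' & K').
apply (iso_pair_sqE _ _ K K') in S.
assert (L : over_iso (n ;; r') n').
{ apply (cpl_unique_l (cpl_post_iso H K')); apply (fun h => cpl_over_r h H').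
  exists r1; split; trivial; exact (iso_pair_isoE K). }
destruct L as (i & Hi & ei); replace rho with i; trivial.
apply (monoM P n'); congruence.
Qed.

(* Good squares are pullbacks, so k p and k r are both the pullback of k q along f'. *)
Lemma mixed_unique (A1 A2 B A' B' : C) (f : M C A1 B) (g : M C A2 B) (f' : M C A' B')
    (p : E C A1 A') (r : E C A2 A') (q : E C B B') :
  has_sq f f' p q -> has_sq g f' r q -> over_iso f g /\ over_iso p r.
Proof.
intros [s] [t].
pose proof (good_pullback (kmap_good (kP P) s)) as (S1 & S2).
pose proof (good_pullback (kmap_good (kP P) t)) as (T1 & T2).
destruct (T2 _ _ _ S1) as (x & (x1 & _) & _), (S2 _ _ _ T1) as (y & (y1 & _) & _).
assert (H : over_iso p r).
{ apply (k_reflects (P := P)); exists x; split; trivial; exists y; split;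
    apply (monoM P (kmor (kP P) _)); rewrite comp_idl, comp_assoc; congruence. }
split; trivial; destruct H as (j & Hj & <-), (iso_pair_ofE P Hj) as (i & Hi).
exists i; split; [exact (iso_pair_isoM Hi) |].
exact (sq_top_unique P (sq_pre_iso Hi (inhabits t)) (inhabits s)).
Qed.

(* coker (ker a -> ker b) and ker (coker f ~> coker f') both complete the mixed cospan
   (kb, p') to a square. *)
Lemma three_by_three (A B A' B' N N' X X' W : C) (f : M C A B) (f' : M C A' B')
    (a : E C A A') (b : E C B B') (ka : M C N A') (kb : M C N' B') (phi : M C N N')
    (p : E C X B) (p' : E C X' B') (al : E C X X') (w : E C W N') :
  cpl P ka a -> cpl P kb b -> good (goodMP P) ka phi f' kb ->
  cpl P f p -> cpl P f' p' -> good (goodEP P) p al b p' -> cpl P phi w ->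
  exists n : M C W X', cpl P n al /\ has_sq n kb w p'.
Proof.
intros Ha Hb K Hp Hp' L Hw.
destruct (good_sq Hw Hp' (good_sym K)) as (n & Sn); exists n; split; trivial.
destruct (goodE_sq (cpl_k P al) Hb (good_sym L)) as (e & S).
apply (fun h => cpl_over_l h (cpl_k P al)).
apply (mixed_unique Sn S).
Qed.

(* Passing to the quotients A3/A1, B3/B1 of the rows reduces this to (PBL) in both
   directions. *)
Lemma good_cancel (A1 A2 A3 B1 B2 B3 : C) (m1 : M C A1 B1) (m2 : M C A2 B2) (m3 : M C A3 B3)
    (a0 : M C A1 A2) (a : M C A2 A3) (b0 : M C B1 B2) (b : M C B2 B3) :
  good (goodMP P) m1 (a0 ;; a) (b0 ;; b) m3 -> good (goodMP P) m2 a b m3 ->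
  good (goodMP P) m1 a0 b0 m2.
Proof.
intros H K.
destruct (cpl_comp (cpl_c P (a0 ;; a)) (cpl_c P a) (cpl_c P a0)) as (ta & na & e1 & H1 & S1).
destruct (cpl_comp (cpl_c P (b0 ;; b)) (cpl_c P b) (cpl_c P b0)) as (tb & nb & e2 & H2 & S2).
destruct (good_sq (cpl_c P _) (cpl_c P _) (good_sym H)) as (r' & R').
destruct (good_sq (cpl_c P _) (cpl_c P _) (good_sym K)) as (r & R).
assert (T : has_sq r r' ta tb) by (apply (pbl_v R'); now rewrite e1, e2).
destruct (sq_good H1 H2 T) as (n & L).
assert (e : m1 ;; b0 = a0 ;; m2).
{ apply (monoM P b); now rewrite !comp_assoc, (good_comm H), (good_comm K), comp_assoc. }
apply good_sym, (sq_good_comm (cpl_c P a0) (cpl_c P b0) (r := n)); [| now symmetry].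
apply (pbl_h S2); rewrite <- (good_comm L), (good_comm K).
exact (has_sq_hcomp S1 R').
Qed.

Lemma starM_exists (A B D : C) (f : M C A B) (g : M C A D) :
  has_good_completion (goodMP P) f g ->
  exists (Q : C) (h : M C B Q) (k : M C D Q), is_star (goodMP P) f g h k.
Proof. apply starMP. Qed.

(** The axiom concerns the chosen cokernels; the isomorphisms [j] and [j'] carry it over to
    arbitrary ones. *)
Lemma star_cok (A B D Q X Y : C) (f : M C A B) (g : M C A D) (h : M C B Q) (k : M C D Q)
    (p : E C X B) (q : E C Y Q) (r : M C X Y) :
  is_star (goodMP P) f g h k -> cpl P f p -> cpl P k q -> has_sq r h p q -> is_iso r.
Proof.
intros S Hp Hq R.
destruct (proj2 (starMP P A B D f g (ex_intro _ Q (ex_intro _ h (ex_intro _ k (proj1 S))))) Q h k S)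
  as ((r0 & s & Hr) & _).
apply cpl_cok in Hp; apply cpl_cok in Hq.
destruct Hp as (j & Hj & <-), Hq as (j' & Hj' & <-).
destruct (iso_pair_ofE P Hj) as (i & Hi), (iso_pair_ofE P Hj') as (i' & Hi').
apply (iso_cancel_r (iso_pair_isoM Hi')).
rewrite (sq_top_unique P (proj2 (sq_post_iso _ _ _ _ Hi') R) (sq_pre_iso Hi (inhabits s))).
apply iso_comp; trivial; exact (iso_pair_isoM Hi).
Qed.

(** The criterion that recognises star-pushouts. The comparison [u] from the actual star-pushout is
    the identity on [D] and invertible on quotients by [D], so [sq_iso_bot] applies. *)
Lemma cok_star (A B D Q X Y : C) (f : M C A B) (g : M C A D) (h : M C B Q) (k : M C D Q)
    (p : E C X B) (q : E C Y Q) (r : M C X Y) :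
  good (goodMP P) f g h k -> cpl P f p -> cpl P k q -> has_sq r h p q -> is_iso r ->
  is_star (goodMP P) f g h k.
Proof.
intros H Hp Hq R Hr.
destruct (good_star starM_exists H) as (Q0 & h0 & k0 & u & S & <- & <-).
destruct (good_sq Hp (cpl_c P k0) (proj1 S)) as (r0 & R0).
assert (K : good (goodMP P) k0 (idm (M C) D) u (k0 ;; u)).
{ apply good_triangle; split; [now rewrite comp_idl | apply iso_id]. }
destruct (good_sq (cpl_c P k0) Hq K) as (t & T).
apply (star_post_iso S), (sq_iso_bot (cpl_c P k0) Hq T (good_comm K) (iso_id _ _)).
apply (iso_cancel_l (star_cok S Hp (cpl_c P k0) R0)).
now rewrite (sq_top_unique P (has_sq_hcomp R0 T) R).
Qed.

(* K/Q = (K/B)/(Q/B), and Q/B = D/A as Q is the star-pushout of B and D over A. *)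
Lemma star_target_cok (A B D Q K X Y : C) (f : M C A B) (g : M C A D) (h : M C B Q)
    (k : M C D Q) (w : M C Q K) (p : E C X D) (q : E C Y K) :
  is_star (goodMP P) f g h k -> cpl P g p -> cpl P (h ;; w) q ->
  exists (r : M C X Y) (Z : C) (t : E C Z Y),
    has_sq r (k ;; w) p q /\ cpl P r t /\ cpl P w (t ;; q).
Proof.
intros S Hp Hq.
destruct (cpl_comp Hq (cpl_c P w) (cpl_c P h)) as (t & n & et & Ht & Sn).
destruct (good_sq Hp (cpl_c P h) (proj1 (star_sym S))) as (r & R).
pose proof (star_cok (star_sym S) Hp (cpl_c P h) R) as Hr.
exists (r ;; n), _, t; split; [exact (has_sq_hcomp R Sn) | split].
- exact (cpl_over_l (over_iso_pre n Hr) Ht).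
- rewrite et; apply cpl_c.
Qed.

(** [star_target_cok] yields a square with the same lower side and e-sides as the given one, so its
    upper side is [f] and the cokernel it produces is that of [f]. *)
Lemma star_kernel_cok (A B A' B' N N' Q X : C) (f : M C A B) (f' : M C A' B')
    (p : E C A A') (q : E C B B') (kp : M C N A') (kq : M C N' B') (phi : M C N N')
    (h : M C A' Q) (l : M C N' Q) (u : M C Q B') (x : E C X B) :
  has_sq f f' p q -> cpl P kp p -> cpl P kq q -> is_star (goodMP P) kp phi h l ->
  h ;; u = f' -> l ;; u = kq -> cpl P f x -> cpl P u (x ;; q).
Proof.
intros S Hp Hq H <- <- Hx.
destruct (star_target_cok (star_sym H) Hp Hq) as (r & Z & t & R & Ht & Hu).
rewrite (sq_top_unique P R S) in Ht.
exact (cpl_over_r (over_iso_post q (cpl_unique_r Hx Ht)) Hu).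
Qed.

End SquareCalculus.

(** * Extension of e-morphisms and squares to star-pushouts *)

Section StarSquares.
Variables (C : DoubleCat) (P : PreECGW C).

Lemma goodE_comm (A B A' B' : C) (p : E C A B) (p' : E C A' B') (g : E C A A') (h : E C B B') :
  good (goodEP P) p g h p' -> p ;; h = g ;; p'.
Proof. intros H; exact (good_comm H). Qed.

(* Both star-pushouts (A',B';D',Q') and (N,Nb;Nd,Ne) turn into isomorphisms
   of cokernels, which [three_by_three] relates. *)
Lemma star_compare (A B D Q A' B' D' Q' N Nb Nd Ne : C)
    (f : M C A B) (k : M C D Q) (h : M C B Q)
    (f' : M C A' B') (g' : M C A' D') (h' : M C B' Q') (k' : M C D' Q')
    (a : E C A A') (b : E C B B') (d : E C D D') (e : E C Q Q')
    (ka : M C N A') (kb : M C Nb B') (kd : M C Nd D') (ke : M C Ne Q')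
    (phi : M C N Nb) (psi : M C N Nd) (hN : M C Nb Ne) (kN : M C Nd Ne) :
  is_star (goodMP P) f' g' h' k' ->
  has_sq f f' a b -> has_sq h h' b e -> has_sq k k' d e ->
  cpl P ka a -> cpl P kb b -> cpl P kd d -> cpl P ke e ->
  good (goodMP P) ka phi f' kb -> good (goodMP P) kb hN h' ke ->
  good (goodMP P) kd kN k' ke -> good (goodMP P) phi psi hN kN ->
  exists (al : E C (ker (cP P) f) (ker (cP P) f')) (be : E C (ker (cP P) k) (ker (cP P) k'))
    (n : M C (ker (cP P) phi) (ker (cP P) f')) (n' : M C (ker (cP P) kN) (ker (cP P) k'))
    (r' : M C (ker (cP P) f') (ker (cP P) k')) (rho : M C (ker (cP P) phi) (ker (cP P) kN)),
    (comp (c := E C) (kmor (cP P) f) b = al ;; kmor (cP P) f' /\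
     comp (c := E C) (kmor (cP P) k) e = be ;; kmor (cP P) k') /\
    (cpl P n al /\ cpl P n' be) /\
    (has_sq r' h' (kmor (cP P) f') (kmor (cP P) k') /\ is_iso r') /\
    has_sq rho hN (kmor (cP P) phi) (kmor (cP P) kN) /\ n ;; r' = rho ;; n'.
Proof.
intros S' Sf Sh Sk Ha Hb Hd He Kf Kh Kk KN.
destruct (sq_goodE (cpl_c P f) (cpl_c P f') Sf) as (al & Gal).
destruct (sq_goodE (cpl_c P k) (cpl_c P k') Sk) as (be & Gbe).
destruct (three_by_three Ha Hb Kf (cpl_c P f) (cpl_c P f') Gal (cpl_c P phi)) as (n & Hn & Sn).
destruct (three_by_three Hd He Kk (cpl_c P k) (cpl_c P k') Gbe (cpl_c P kN)) as (n' & Hn' & Sn').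
destruct (good_sq (cpl_c P f') (cpl_c P k') (proj1 S')) as (r' & R').
destruct (good_sq (cpl_c P phi) (cpl_c P kN) KN) as (rho & R).
exists al, be, n, n', r', rho.
refine (conj (conj _ _) (conj (conj Hn Hn') (conj (conj R' _) (conj R _)))).
- exact (goodE_comm Gal).
- exact (goodE_comm Gbe).
- exact (star_cok S' (cpl_c P f') (cpl_c P k') R').
- refine (sq_top_unique P (has_sq_hcomp Sn R') _); rewrite (good_comm Kh).
  exact (has_sq_hcomp R Sn').
Qed.

(** The kernel square over [f'] pasted with the good square below it also factors through the kernel
    square over [k'], which [good_cancel] removes. *)
Lemma kernel_good (B D Q A' B' D' Q' A : C) (f' : M C A' B') (g' : M C A' D')
    (h' : M C B' Q') (k' : M C D' Q')
    (a : E C A A') (b : E C B B') (d : E C D D') (e : E C Q Q')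
    (phi : M C (ker (kP P) a) (ker (kP P) b)) (psi : M C (ker (kP P) a) (ker (kP P) d))
    (hN : M C (ker (kP P) b) (ker (kP P) e)) (kN : M C (ker (kP P) d) (ker (kP P) e)) :
  good (goodMP P) f' g' h' k' ->
  good (goodMP P) (kmor (kP P) a) phi f' (kmor (kP P) b) ->
  good (goodMP P) (kmor (kP P) a) psi g' (kmor (kP P) d) ->
  good (goodMP P) (kmor (kP P) b) hN h' (kmor (kP P) e) ->
  good (goodMP P) (kmor (kP P) d) kN k' (kmor (kP P) e) ->
  good (goodMP P) phi psi hN kN.
Proof.
intros G Gf Gg Gh Gk.
refine (good_cancel _ (good_sym Gk)).
rewrite <- (good_comm Gg), <- (good_comm Gh).
exact (good_comp (good_sym Gf) G).
Qed.

Section TwoStars.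
Variables (A B D Q A' B' D' Q' : C)
  (f : M C A B) (g : M C A D) (h : M C B Q) (k : M C D Q)
  (f' : M C A' B') (g' : M C A' D') (h' : M C B' Q') (k' : M C D' Q')
  (a : E C A A') (b : E C B B') (d : E C D D').
Hypotheses (S : is_star (goodMP P) f g h k) (S' : is_star (goodMP P) f' g' h' k')
  (Sf : has_sq f f' a b) (Sg : has_sq g g' a d).

(* The e-morphism is the cokernel of Ne -> Q', with Ne the star-pushout of the kernels
   of a, b and d. *)
Lemma star_e_exists :
  (forall phi psi, good (goodMP P) (kmor (kP P) a) phi f' (kmor (kP P) b) ->
     good (goodMP P) (kmor (kP P) a) psi g' (kmor (kP P) d) ->
     has_good_completion (goodMP P) phi psi) ->
  exists e : E C Q Q', has_sq h h' b e /\ has_sq k k' d e.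
Proof.
intros HN.
destruct (sq_good (cpl_k P a) (cpl_k P b) Sf) as (phi & Gphi).
destruct (sq_good (cpl_k P a) (cpl_k P d) Sg) as (psi & Gpsi).
destruct (starM_exists (HN _ _ Gphi Gpsi)) as (Ne & hN & kN & SN).
destruct (star_lift SN (good_span (good_sym Gphi) (good_sym Gpsi) (proj1 S')))
  as (w & w1 & w2).
pose proof (star_face (polM P) (good_sym Gphi) (good_sym Gpsi) SN (proj1 S') w1 w2) as Gh.
pose proof (star_face (polM P) (good_sym Gpsi) (good_sym Gphi) (star_sym SN)
  (good_sym (proj1 S')) w2 w1) as Gk.
set (e0 := kmor (cP P) w).
destruct (good_sq (cpl_k P b) (cpl_c P w) Gh) as (h0 & Sh).
destruct (good_sq (cpl_k P d) (cpl_c P w) Gk) as (k0 & Sk).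
(* [h0] and [k0] land in the domain of [e0]; it remains to recognise this domain as the star-pushout
   of [f] and [g]. *)
assert (e1 : f ;; h0 = g ;; k0).
{ refine (sq_top_unique P (has_sq_hcomp Sf Sh) _); rewrite (good_comm (proj1 S')).
  exact (has_sq_hcomp Sg Sk). }
destruct (star_compare S' Sf Sh Sk (cpl_k P a) (cpl_k P b) (cpl_k P d) (cpl_c P w)
  Gphi Gh Gk (proj1 SN))
  as (al & be & n & n' & r' & rho & (e2 & e3) & (Hn & Hn') & (R' & Hr') & R & e4).
pose proof (star_cok SN (cpl_c P phi) (cpl_c P kN) R) as Hrho.
destruct (iso_ker_sq Hn Hn' Hrho Hr' e4) as (r & Hr & Sr).
assert (Sr' : has_sq r h0 (kmor (cP P) f) (kmor (cP P) k0)).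
{ apply (pbl_v P Sh); pose proof (has_sq_vcomp Sr R') as L.
  rewrite <- e2, <- e3 in L; exact L. }
(* The map [r] of cokernels is invertible because its counterparts on the kernels [n], [n'] and on
   the lower row are. *)
assert (S0 : is_star (goodMP P) f g h0 k0).
{ refine (cok_star (sq_good_comm (cpl_c P f) (cpl_c P k0) Sr' e1) (cpl_c P f) (cpl_c P k0)
    Sr' Hr). }
destruct (star_unique S S0) as (i & Hi & i1 & i2), (iso_pair_ofM P Hi) as (j & Hj).
exists (j ;; e0); split; apply (sq_post_iso _ _ _ _ Hj); [now rewrite i1 | now rewrite i2].
Qed.

(** [star_compare] read in the other direction: the cokernel maps of both given star-pushouts are
    invertible, which forces [rho] to be invertible, and [cok_star] concludes. *)
Lemma star_kernel (e : E C Q Q') (phi : M C (ker (kP P) a) (ker (kP P) b))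
    (psi : M C (ker (kP P) a) (ker (kP P) d))
    (hN : M C (ker (kP P) b) (ker (kP P) e)) (kN : M C (ker (kP P) d) (ker (kP P) e)) :
  has_sq h h' b e -> has_sq k k' d e ->
  good (goodMP P) (kmor (kP P) a) phi f' (kmor (kP P) b) ->
  good (goodMP P) (kmor (kP P) a) psi g' (kmor (kP P) d) ->
  good (goodMP P) (kmor (kP P) b) hN h' (kmor (kP P) e) ->
  good (goodMP P) (kmor (kP P) d) kN k' (kmor (kP P) e) ->
  is_star (goodMP P) phi psi hN kN.
Proof.
intros Sh Sk Gf Gg Gh Gk; pose proof (kernel_good (proj1 S') Gf Gg Gh Gk) as G.
destruct (star_compare S' Sf Sh Sk (cpl_k P a) (cpl_k P b) (cpl_k P d) (cpl_k P e)
  Gf Gh Gk G)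
  as (al & be & n & n' & r' & rho & (e2 & e3) & (Hn & Hn') & (R' & Hr') & R & e4).
apply (cok_star G (cpl_c P phi) (cpl_c P kN) R).
destruct (good_sq (cpl_c P f) (cpl_c P k) (proj1 S)) as (r & Sr).
refine (iso_sq_ker Hn Hn' (star_cok S (cpl_c P f) (cpl_c P k) Sr) Hr' _ e4).
apply (pbl_v P R'); rewrite <- e2, <- e3; exact (has_sq_vcomp Sr Sh).
Qed.

(** By [star_kernel] both kernels are star-pushouts of the same span, so [e] and [e'] differ by an
    isomorphism of [Q]. It fixes the legs [h] and [k], hence is the identity. *)
Lemma star_e_unique (e e' : E C Q Q') :
  has_sq h h' b e -> has_sq k k' d e -> has_sq h h' b e' -> has_sq k k' d e' -> e = e'.
Proof.
intros Sh Sk Sh' Sk'.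
destruct (sq_good (cpl_k P a) (cpl_k P b) Sf) as (phi & Gf).
destruct (sq_good (cpl_k P a) (cpl_k P d) Sg) as (psi & Gg).
destruct (sq_good (cpl_k P b) (cpl_k P e) Sh) as (hN & Gh).
destruct (sq_good (cpl_k P d) (cpl_k P e) Sk) as (kN & Gk).
destruct (sq_good (cpl_k P b) (cpl_k P e') Sh') as (hN' & Gh').
destruct (sq_good (cpl_k P d) (cpl_k P e') Sk') as (kN' & Gk').
pose proof (star_kernel Sh Sk Gf Gg Gh Gk) as SN.
pose proof (star_kernel Sh' Sk' Gf Gg Gh' Gk') as SN'.
destruct (star_unique SN SN') as (th & Hth & t1 & t2).
assert (O : over_iso e e').
{ apply (k_reflects (P := P)); exists th; split; trivial; symmetry; apply (star_ext SN).
  - rewrite <- (good_comm Gh), <- (good_comm Gk).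
    exact (good_span (good_sym Gf) (good_sym Gg) (proj1 S')).
  - now rewrite <- comp_assoc, t1, <- (good_comm Gh), <- (good_comm Gh').
  - now rewrite <- comp_assoc, t2, <- (good_comm Gk), <- (good_comm Gk'). }
destruct O as (j & Hj & <-), (iso_pair_ofE P Hj) as (i & Hi).
assert (i = idm (M C) Q) as ->.
{ symmetry; apply (star_ext S); rewrite !comp_idr.
  - apply S.
  - exact (sq_top_unique P Sh' (proj2 (sq_post_iso _ _ _ _ Hi) Sh)).
  - exact (sq_top_unique P Sk' (proj2 (sq_post_iso _ _ _ _ Hi) Sk)). }
rewrite <- (iso_pair_funE (iso_pair_id P Q) Hi); apply comp_idl.
Qed.

(* K/Q ~> K is (K/B)/(D/A) ~> K/B ~> K by [star_target_cok], and both steps extend to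
   good squares of e-morphisms. *)
Lemma star_sq (e : E C Q Q') (K K' : C) (w : M C Q K) (w' : M C Q' K') (ka : E C K K') :
  has_sq h h' b e -> has_sq k k' d e ->
  has_sq (h ;; w) (h' ;; w') b ka -> has_sq (k ;; w) (k' ;; w') d ka -> has_sq w w' e ka.
Proof.
intros Sh Sk Rh Rk.
destruct (star_target_cok S (cpl_c P g) (cpl_c P (h ;; w))) as (r & Z & t & R & Ht & Hw).
destruct (star_target_cok S' (cpl_c P g') (cpl_c P (h' ;; w')))
  as (r' & Z' & t' & R' & Ht' & Hw').
destruct (sq_goodE (cpl_c P g) (cpl_c P g') Sg) as (al & Gal).
destruct (sq_goodE (cpl_c P (h ;; w)) (cpl_c P (h' ;; w')) Rh) as (be & Gbe).
assert (L : has_sq r r' al be).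
{ apply (pbl_v P R').
  rewrite <- (goodE_comm Gal), <- (goodE_comm Gbe); exact (has_sq_vcomp R Rk). }
destruct (sq_goodE Ht Ht' L) as (y & Gy).
destruct (goodE_sq Hw Hw' (good_comp_r Gy Gbe)) as (e' & Se).
replace e with e'; trivial; apply star_e_unique; trivial.
- exact (pbl_h P Se Rh).
- exact (pbl_h P Se Rk).
Qed.

End TwoStars.
End StarSquares.

(** * Fullness, thinness and equivalences *)

Section Equivalences.
Variables (O O' : Type) (X : CatOn O) (Y : CatOn O') (F : Functor X Y).

Lemma equivalence_faithful : is_equivalence F ->
  forall A B (f g : X A B), fmap (farr F) f = fmap (farr F) g -> f = g.
Proof.
intros (G & (eta & Hi & Hn) & _) A B f g e.
pose proof (Hn A B f) as Hf; pose proof (Hn A B g) as Hg; simpl in Hf, Hg.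
rewrite e, Hg in Hf; destruct (Hi A) as (j & _ & H); simpl in *.
now rewrite <- (comp_idl f), <- (comp_idl g), <- H, !comp_assoc, Hf.
Qed.

End Equivalences.

Section EquivalenceCriterion.
Variables (O O' : Type) (X : CatOn O) (Y : CatOn O') (F : Functor X Y).

Lemma equivalence_full : is_equivalence F ->
  forall A B (phi : Y (F A) (F B)), exists f, fmap (farr F) f = phi.
Proof.
intros (G & H1 & H2) A B phi.
assert (EG : is_equivalence G) by (now exists F).
destruct H1 as (eta & Hi & Hn); simpl in *.
destruct (Hi A) as (j & e1 & e2), (Hi B) as (j' & e3 & e4).
exists (j ;; fmap (farr G) phi ;; eta B); apply (equivalence_faithful EG).
pose proof (Hn A B (j ;; fmap (farr G) phi ;; eta B)) as e; simpl in e.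
rewrite <- (comp_idr (fmap (farr G) _)), <- e3, <- comp_assoc, e.
now rewrite <- !comp_assoc, e1, comp_idl, comp_assoc, e3, comp_idr.
Qed.

Lemma equivalence_intro :
  (forall A B (f g : X A B), fmap (farr F) f = fmap (farr F) g -> f = g) ->
  (forall A B (phi : Y (F A) (F B)), exists f, fmap (farr F) f = phi) ->
  (forall y, exists x (i : Y (F x) y), is_iso i) ->
  is_equivalence F.
Proof.
intros Hff Hfl Hes.
assert (c : forall y, {x : O & {i : Y (F x) y & {j : Y y (F x) |
    i ;; j = idm Y (F x) /\ j ;; i = idm Y y}}}).
{ intros y; destruct (constructive_indefinite_description _ (Hes y)) as (x & H).
  destruct (constructive_indefinite_description _ H) as (i & K).
  destruct (constructive_indefinite_description _ K) as (j & L).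
  exact (existT _ x (existT _ i (exist _ j L))). }
pose (g := fun y => projT1 (c y)).
pose (i := fun y => projT1 (projT2 (c y)) : Y (F (g y)) y).
pose (j := fun y => proj1_sig (projT2 (projT2 (c y))) : Y y (F (g y))).
assert (ij : forall y, i y ;; j y = idm Y _)
  by (intros y; apply (proj2_sig (projT2 (projT2 (c y))))).
assert (ji : forall y, j y ;; i y = idm Y _)
  by (intros y; apply (proj2_sig (projT2 (projT2 (c y))))).
pose (lift := fun A B (phi : Y (F A) (F B)) =>
  proj1_sig (constructive_indefinite_description _ (Hfl A B phi))).
assert (liftE : forall A B (phi : Y (F A) (F B)), fmap (farr F) (lift A B phi) = phi).
{ intros A B phi; exact (proj2_sig (constructive_indefinite_description _ (Hfl A B phi))). }
clearbody i j; clearbody lift.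
unshelve refine (let G : Functor Y X := @Build_Functor _ _ Y X g
  (@Build_FunctorOn _ _ g Y X (fun y y' f => lift _ _ (i y ;; f ;; j y')) _ _) in _).
- intros y; apply Hff; rewrite liftE, comp_idr, ij; symmetry; apply fmap_id.
- intros y y' y'' f f'; apply Hff; rewrite fmap_comp, !liftE, !comp_assoc.
  now rewrite <- (comp_assoc (j y')), ji, comp_idl.
- exists G; split.
  + exists (fun A => lift (g (F A)) A (i (F A))); split.
    * intros A; exists (lift A (g (F A)) (j (F A))).
      split; apply Hff; rewrite fmap_comp, !liftE, fmap_id; [apply ij | apply ji].
    * intros A B f; apply Hff; simpl; rewrite !fmap_comp, !liftE, !comp_assoc.
      now rewrite ji, comp_idr.
  + exists i; split.
    * intros y; exists (j y); split; [apply ij | apply ji].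
    * intros y y' f; simpl; now rewrite liftE, !comp_assoc, ji, comp_idr.
Qed.

End EquivalenceCriterion.

Lemma equivalence_k_full (C : DoubleCat) (G : GoodClass (M C)) (k : KerData G) :
  is_equivalence (kfunctor k) -> k_full k.
Proof.
intros H A B A' B' p q g f' K.
destruct (equivalence_full H (A := MkArr p) (B := MkArr q)
  (@Build_ArG_hom _ _ G (MkArr (kmor k p)) (MkArr (kmor k q)) g f' K)) as (x & e).
apply (f_equal (@ag_bot _ _ _ _ _)) in e; simpl in e; subst f'.
exists (ar_top x); exact (inhabits (ar_sq x)).
Qed.

(** As [kmor k q] is monic, the image of a square under [k] depends only on its lower side;
    faithfulness then leaves at most one square. *)
Lemma equivalence_thin (C : DoubleCat) (G : GoodClass (M C)) (k : KerData G) :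
  (forall A B (f : M C A B), is_monic f) -> is_equivalence (kfunctor k) -> thin C.
Proof.
intros Hm H A B A' B' f g f' p q s t.
assert (e : @Build_ArSq_hom C (MkArr p) (MkArr q) f f' s =
            @Build_ArSq_hom C (MkArr p) (MkArr q) g f' t).
{ apply (equivalence_faithful H), ArG_hom_eq; [| reflexivity]; simpl.
  apply (Hm _ _ (kmor k q)).
  rewrite <- (good_comm (kmap_good k s)); exact (good_comm (kmap_good k t)). }
change (sq_eq (ar_sq (@Build_ArSq_hom C (MkArr p) (MkArr q) f f' s))
  (ar_sq (@Build_ArSq_hom C (MkArr p) (MkArr q) g f' t))).
rewrite e; constructor.
Qed.

Definition pre_of_ECGW (C : DoubleCat) (S : ECGW C) : PreECGW C.
Proof.
refine (@Build_PreECGW C (shared S) (goodM S) (goodE S) (kD S) (cD S)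
  _ _ _ _ (empty S) (axZ_M S) (axZ_E S) (@axM_M C S) (@axM_E C S) (@axD C S)
  (@axK_M C S) _ (@axStar_M C S) (@axStar_E C S) (@axPBL_M C S) (@axPBL_E C S)
  (@axPOL_M C S) (@axPOL_E C S)).
- exact (equivalence_thin (@axM_M C S) (k_equiv S)).
- exact (equivalence_thin (C := tr C) (@axM_E C S) (c_equiv S)).
- exact (equivalence_k_full (k_equiv S)).
- exact (equivalence_k_full (C := tr C) (c_equiv S)).
- intros A B g; destruct (axK_E S g) as (i & e & s & H).
  exists e, i, s; exact (proj1 (axD S s) H).
Defined.

Lemma pre_k_equivalence (C : DoubleCat) (P : PreECGW C) : is_equivalence (kfunctor (kP P)).
Proof.
apply equivalence_intro.
- intros p q x y e; apply ArSq_hom_eq.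
  destruct x as [f f' s], y as [g g' t]; simpl.
  apply (f_equal (@ag_bot _ _ _ _ _)) in e; simpl in e; subst g'; apply (thinM P).
- intros p q x.
  destruct (kP_full P (ag_good x)) as (f & [s]).
  exists (Build_ArSq_hom s); apply ArG_hom_eq; [| reflexivity].
  symmetry; apply kmap_unique; symmetry; exact (good_comm (ag_good x)).
- intros [A B f]; destruct (over_iso_sym (cpl_c P f)) as (i & Hi & e).
  destruct (iso_inverse Hi) as (j & Hj & e1 & e2).
  exists (MkArr (kmor (cP P) f)).
  assert (G1 : good (goodMP P) (kmor (kP P) (kmor (cP P) f)) i (idm (M C) B) f).
  { apply good_triangle; split; trivial; now rewrite comp_idr. }
  assert (G2 : good (goodMP P) f j (idm (M C) B) (kmor (kP P) (kmor (cP P) f))).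
  { apply good_triangle; split; trivial.
    now rewrite <- e, <- comp_assoc, e2, comp_idl, comp_idr. }
  exists (@Build_ArG_hom _ _ _ (MkArr (kmor (kP P) (kmor (cP P) f))) (MkArr f) _ _ G1).
  exists (@Build_ArG_hom _ _ _ (MkArr f) (MkArr (kmor (kP P) (kmor (cP P) f))) _ _ G2).
  split; apply ArG_hom_eq; simpl; rewrite ?comp_idl; trivial.
Qed.

Definition ECGW_of_pre (C : DoubleCat) (P : PreECGW C)
    (PO : forall (A B D : C) (f : M C A B) (g : M C A D), has_good_completion (goodMP P) f g) :
  ECGW C.
Proof.
refine (@Build_ECGW C (sharedP P) (goodMP P) (goodEP P) (kP P) (cP P)
  (pre_k_equivalence P) (pre_k_equivalence (tr_pre P)) (emptyP P) (emptyM P) (emptyE P)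
  (@monoM C P) (@monoE C P) (@distP C P) (@axK_MP C P) _ (starMP P) (starEP P) PO
  (pblM P) (pblE P) (polM P) (polE P)).
intros A B g; destruct (axK_EP P g) as (i & e & s & H).
exists e, i, s; exact (proj2 (distP P s) H).
Defined.

(** * Natural transformations, pointwise *)

Definition the_sq (C : DoubleCat) (A B A' B' : C) (f : M C A B) (f' : M C A' B')
    (p : E C A A') (q : E C B B') (H : has_sq f f' p q) : Sq f f' p q :=
  epsilon H (fun _ => True).

Definition the_ex (A : Type) (Q : A -> Prop) (H : exists x, Q x) : A :=
  proj1_sig (constructive_indefinite_description Q H).

Lemma the_exP (A : Type) (Q : A -> Prop) (H : exists x, Q x) : Q (the_ex H).
Proof. exact (proj2_sig (constructive_indefinite_description Q H)). Qed.

Lemma thin_eq (C : DoubleCat) (P : PreECGW C) (A B A' B' : C) (f g : M C A B)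
    (f' g' : M C A' B') (p r : E C A A') (q t : E C B B') (x : Sq f f' p q) (y : Sq g g' r t) :
  f = g -> f' = g' -> p = r -> q = t -> sq_eq x y.
Proof. intros; subst; apply (thinM P). Qed.

Section Naturality.
Variables (C : DoubleCat) (P : PreECGW C) (D : DoubleCat).

(** Commutation with m-morphisms is contained in goodness, and thinness supplies all coherence, so
    this is everything [mkNat] needs. *)
Definition is_nat (F G : DFun D C) (m : forall x : D, M C (F x) (G x)) : Prop :=
  (forall (x y : D) (u : E D x y), has_sq (m x) (m y) (fmap (dE F) u) (fmap (dE G) u)) /\
  (forall (x y : D) (f : M D x y),
     good (goodMP P) (fmap (dM F) f) (m x) (m y) (fmap (dM G) f)).

Definition mkNat (F G : DFun D C) (m : forall x : D, M C (F x) (G x)) (H : is_nat m) :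
  FunM D (goodMP P) F G.
Proof.
unshelve refine (@Build_GNat D C (goodMP P) F G
  (@Build_MNat D C F G m (fun x y u => the_sq (proj1 H x y u)) _ _ _ _) _).
- abstract (intros x; apply (thin_eq P); trivial; apply fmap_id).
- abstract (intros x y z u v; apply (thin_eq P); trivial; apply fmap_comp).
- abstract (intros x y f; exact (good_comm (proj2 H x y f))).
- abstract (intros x y x' y' f f' u v s; apply (thin_eq P); trivial;
    [exact (good_comm (proj2 H x y f)) | exact (good_comm (proj2 H x' y' f'))]).
- exact (proj2 H).
Defined.

Lemma mm_is_nat (F G : DFun D C) (m : FunM D (goodMP P) F G) : is_nat (mm m).
Proof.
split.
- intros x y u; exact (inhabits (msq m u)).
- exact (gnat_good m).
Qed.

Lemma mm_ext (F G : DFun D C) (m n : FunM D (goodMP P) F G) :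
  (forall x, mm m x = mm n x) -> m = n.
Proof. intros H; apply mm_eq; trivial; intros; now apply (thin_eq P). Qed.

Lemma mm_natural (F G : DFun D C) (m : FunM D (goodMP P) F G) (x y : D) (f : M D x y) :
  fmap (dM F) f ;; mm m y = mm m x ;; fmap (dM G) f.
Proof. exact (good_comm (proj2 (mm_is_nat m) x y f)). Qed.

(** A square with invertible m-sides amounts to a commuting square of e-morphisms, which can be
    inverted. *)
Lemma iso_sq_inv (A B A' B' : C) (f : M C A B) (f' : M C A' B') (p : E C A A') (q : E C B B')
    (g : M C B A) (g' : M C B' A') :
  has_sq f f' p q -> f ;; g = idm (M C) A -> g ;; f = idm (M C) B ->
  f' ;; g' = idm (M C) A' -> g' ;; f' = idm (M C) B' -> has_sq g g' q p.
Proof.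
intros S e1 e2 e3 e4.
destruct (iso_pair_ofM P (f := f)) as (j & Hj); [now exists g |].
destruct (iso_pair_ofM P (f := f')) as (j' & Hj'); [now exists g' |].
destruct (iso_pair_inv Hj e1 e2) as (l & Hl & e5 & e6).
destruct (iso_pair_inv Hj' e3 e4) as (l' & Hl' & e7 & e8).
apply (iso_pair_sqE _ _ Hj Hj') in S; apply (iso_pair_sqE _ _ Hl Hl').
rewrite <- (comp_idl q), <- e6, !comp_assoc, <- (comp_assoc j), S.
now rewrite !comp_assoc, e7, comp_idr.
Qed.

Lemma is_nat_inv (F G : DFun D C) (m : forall x : D, M C (F x) (G x))
    (n : forall x : D, M C (G x) (F x)) :
  (forall x, m x ;; n x = idm (M C) (F x)) -> (forall x, n x ;; m x = idm (M C) (G x)) ->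
  is_nat m -> is_nat n.
Proof.
intros e1 e2 (H & K); split.
- intros x y u; exact (iso_sq_inv (H x y u) (e1 x) (e2 x) (e1 y) (e2 y)).
- intros x y f; apply good_triangle; split; [| exists (m x); now split].
  rewrite <- (comp_idl (fmap (dM G) f)), <- e2, !comp_assoc, <- (comp_assoc (m x)).
  now rewrite <- (good_comm (K x y f)), !comp_assoc, e1, comp_idr.
Qed.

Lemma iso_pointwise (F G : DFun D C) (m : FunM D (goodMP P) F G) :
  is_iso m <-> forall x, is_iso (mm m x).
Proof.
split.
- intros (n & e1 & e2) x; exists (mm n x); split.
  + exact (f_equal (fun m => mm m x) e1).
  + exact (f_equal (fun m => mm m x) e2).
- intros H; pose (n := fun x => the_ex (H x)).
  assert (Hn : forall x, mm m x ;; n x = idm (M C) (F x) /\ n x ;; mm m x = idm (M C) (G x))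
    by (intros x; exact (the_exP (H x))).
  exists (mkNat (is_nat_inv (fun x => proj1 (Hn x)) (fun x => proj2 (Hn x)) (mm_is_nat m))).
  split; apply mm_ext; intros x; apply (Hn x).
Qed.

Lemma mono_pointwise (F G : DFun D C) (m : FunM D (goodMP P) F G) : is_monic m.
Proof.
intros Z g h e; apply mm_ext; intros x; apply (monoM P (mm m x)).
exact (f_equal (fun m => mm m x) e).
Qed.

Definition mkDF (ob : D -> C) (fM : FunctorOn ob (M D) (M C)) (fE : FunctorOn ob (E D) (E C))
    (H : forall (A B A' B' : D) (f : M D A B) (f' : M D A' B') (p : E D A A') (q : E D B B'),
       Sq f f' p q -> has_sq (fmap fM f) (fmap fM f') (fmap fE p) (fmap fE q)) : DFun D C.
Proof.
refine (@Build_DFun D C ob fM fE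
  (fun A B A' B' f f' p q s => the_sq (H A B A' B' f f' p q s)) _ _ _ _);
abstract (intros; apply (thin_eq P); trivial; try apply fmap_id; apply fmap_comp).
Defined.

End Naturality.

(** * Kernels of natural transformations and of modifications *)

Section Kernels.
Variables (C : DoubleCat) (P : PreECGW C) (D : DoubleCat).

Section Kernel.
Variables (F G : DFun D C) (p : forall x : D, E C (F x) (G x)).
Hypothesis (Hp : @is_nat (tr C) (tr_pre P) (tr D) (trF F) (trF G) p).

Lemma enat_sq (x y : D) (f : M D x y) : has_sq (fmap (dM F) f) (fmap (dM G) f) (p x) (p y).
Proof. exact (proj1 Hp x y f). Qed.

Lemma enat_good (x y : D) (u : E D x y) :
  good (goodEP P) (p x) (fmap (dE F) u) (fmap (dE G) u) (p y).
Proof. exact (good_sym (proj2 Hp x y u)). Qed.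

Lemma enat_comm (x y : D) (u : E D x y) : p x ;; fmap (dE G) u = fmap (dE F) u ;; p y.
Proof. exact (goodE_comm (enat_good u)). Qed.

(** Goodness of the naturality square at [u] turns it into a square between the kernels; its left
    side is the value of the kernel diagram at [u]. *)
Lemma ker_e_exists (x y : D) (u : E D x y) :
  exists e, has_sq (kmor (kP P) (p x)) (kmor (kP P) (p y)) e (fmap (dE G) u).
Proof. exact (goodE_sq (cpl_k P (p x)) (cpl_k P (p y)) (enat_good u)). Qed.

Definition kerM : FunctorOn (fun x => ker (kP P) (p x)) (M D) (M C).
Proof.
refine (@Build_FunctorOn _ _ (fun x => ker (kP P) (p x)) (M D) (M C)
  (fun x y f => kmap (kP P) (the_sq (enat_sq f))) _ _).
- abstract (intros x; symmetry; apply kmap_unique; rewrite fmap_id, comp_idr; apply comp_idl).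
- abstract (intros x y z f g; symmetry; apply kmap_unique;
  rewrite comp_assoc, <- (good_comm (kmap_good (kP P) _)), <- comp_assoc,
    <- (good_comm (kmap_good (kP P) _)), comp_assoc; now rewrite fmap_comp).
Defined.

Definition kerE : FunctorOn (fun x => ker (kP P) (p x)) (E D) (E C).
Proof.
refine (@Build_FunctorOn _ _ (fun x => ker (kP P) (p x)) (E D) (E C)
  (fun x y u => the_ex (ker_e_exists u)) _ _).
- abstract (intros x; apply (sq_left_unique P (the_exP (ker_e_exists (idm (E D) x))));
  rewrite fmap_id; exact (inhabits (vid _))).
- abstract (intros x y z u v; apply (sq_left_unique P (the_exP (ker_e_exists (u ;; v))));
  rewrite fmap_comp;
  exact (has_sq_vcomp (the_exP (ker_e_exists u)) (the_exP (ker_e_exists v)))).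
Defined.

Lemma kerM_good (x y : D) (f : M D x y) :
  good (goodMP P) (fmap kerM f) (kmor (kP P) (p x)) (kmor (kP P) (p y)) (fmap (dM G) f).
Proof. apply good_sym; exact (kmap_good (kP P) (the_sq (enat_sq f))). Qed.

Lemma kerM_comm (x y : D) (f : M D x y) :
  kmor (kP P) (p x) ;; fmap (dM G) f = fmap kerM f ;; kmor (kP P) (p y).
Proof. symmetry; exact (good_comm (kerM_good f)). Qed.

Lemma kerE_sq (x y : D) (u : E D x y) :
  has_sq (kmor (kP P) (p x)) (kmor (kP P) (p y)) (fmap kerE u) (fmap (dE G) u).
Proof. exact (the_exP (ker_e_exists u)). Qed.

(** (PBL) cancels the kernel square at [v] from the square of [G] precomposed with the kernel square
    at [u]. *)
Lemma ker_sq (x y x' y' : D) (f : M D x y) (f' : M D x' y') (u : E D x x') (v : E D y y') :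
  Sq f f' u v -> has_sq (fmap kerM f) (fmap kerM f') (fmap kerE u) (fmap kerE v).
Proof.
intros s; apply (pbl_h P (kerE_sq v)).
rewrite <- !kerM_comm; exact (has_sq_hcomp (kerE_sq u) (inhabits (dSq G s))).
Qed.

Definition kerF : DFun D C := mkDF P ker_sq.

Lemma kmor_nat : is_nat (F := kerF) P (fun x => kmor (kP P) (p x)).
Proof.
split.
- intros x y u; exact (kerE_sq u).
- exact kerM_good.
Qed.

End Kernel.

Section KernelMap.
Variables (F F' G G' : DFun D C) (p : forall x : D, E C (F x) (F' x))
  (q : forall x : D, E C (G x) (G' x)) (m : forall x : D, M C (F x) (G x))
  (m' : forall x : D, M C (F' x) (G' x)).
Hypotheses (Hp : @is_nat (tr C) (tr_pre P) (tr D) (trF F) (trF F') p)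
  (Hq : @is_nat (tr C) (tr_pre P) (tr D) (trF G) (trF G') q)
  (Hm' : is_nat P m').

Lemma top_nat_sq : (forall x, has_sq (m x) (m' x) (p x) (q x)) ->
  forall (x y : D) (u : E D x y), has_sq (m x) (m y) (fmap (dE F) u) (fmap (dE G) u).
Proof.
intros S x y u; apply (pbl_v P (S y)); rewrite <- (enat_comm Hp), <- (enat_comm Hq).
exact (has_sq_vcomp (S x) (proj1 Hm' x y u)).
Qed.

Lemma top_nat_comm : (forall x, has_sq (m x) (m' x) (p x) (q x)) ->
  forall (x y : D) (f : M D x y), fmap (dM F) f ;; m y = m x ;; fmap (dM G) f.
Proof.
intros S x y f; apply (sq_top_unique P (has_sq_hcomp (enat_sq Hp f) (S y))).
rewrite (good_comm (proj2 Hm' x y f)); exact (has_sq_hcomp (S x) (enat_sq Hq f)).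
Qed.

Lemma top_nat_iso : (forall x, has_sq (m x) (m' x) (p x) (q x)) ->
  (forall x, is_iso (m x)) -> is_nat P m.
Proof.
intros S H; split; [exact (top_nat_sq S) |].
intros x y f; apply good_triangle; split; trivial; exact (top_nat_comm S f).
Qed.

(* By [star_kernel_cok] the goodness condition of the cube is the existence of a square
   between coker m ~> G ~> G' at x and at y, and (PBL) removes the second factor.
   [kmap_cube] is the converse. *)
Lemma top_nat_cube (g : forall x, M C (ker (kP P) (p x)) (ker (kP P) (q x))) :
  (forall x, has_sq (m x) (m' x) (p x) (q x)) ->
  (forall (x y : D) (f : M D x y),
    good_cube (goodMP P) (kmor (kP P) (p x)) (g x) (m' x) (kmor (kP P) (q x))
      (kmor (kP P) (p y)) (g y) (m' y) (kmor (kP P) (q y))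
      (fmap (kerM Hp) f) (fmap (dM F') f) (fmap (kerM Hq) f) (fmap (dM G') f)) ->
  is_nat P m.
Proof.
intros S H; split; [exact (top_nat_sq S) |].
intros x y f; pose proof (H x y f) as K.
pose proof K as ((K1 & K2 & K3 & K4 & K5 & K6) & _).
destruct (good_star (starM_exists (P := P)) K1) as (Q & h & l & u & T & e1 & e2).
destruct (good_star (starM_exists (P := P)) K2) as (Q' & h' & l' & u' & T' & e1' & e2').
destruct (star_lift T (good_span K3 K4 (proj1 T'))) as (w & e3 & e4).
pose proof (good_cube_elim K T T' e3 e4 e1 e2 e1' e2') as L.
pose proof (star_kernel_cok (S x) (cpl_k P _) (cpl_k P _) T e1 e2 (cpl_c P (m x))) as Hu.
pose proof (star_kernel_cok (S y) (cpl_k P _) (cpl_k P _) T' e1' e2' (cpl_c P (m y))) as Hu'.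
destruct (good_sq Hu Hu' (good_sym L)) as (r & R).
apply good_sym, (sq_good_comm (cpl_c P (m x)) (cpl_c P (m y)) (r := r)).
- exact (pbl_v P (enat_sq Hq f) R).
- symmetry; exact (top_nat_comm S f).
Qed.

Lemma top_nat_exists (g : forall x, M C (ker (kP P) (p x)) (ker (kP P) (q x))) :
  (forall (x y : D) (f : M D x y),
    good_cube (goodMP P) (kmor (kP P) (p x)) (g x) (m' x) (kmor (kP P) (q x))
      (kmor (kP P) (p y)) (g y) (m' y) (kmor (kP P) (q y))
      (fmap (kerM Hp) f) (fmap (dM F') f) (fmap (kerM Hq) f) (fmap (dM G') f)) ->
  exists n : forall x : D, M C (F x) (G x), forall x, has_sq (n x) (m' x) (p x) (q x).
Proof.
intros H.
assert (W : forall x, exists n, has_sq n (m' x) (p x) (q x)).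
(* The cube over the identity of [x] has the good square at [x] as its first face. *)
{ intros x; exact (kP_full P (proj1 (proj1 (H x x (idm (M D) x))))). }
exists (fun x => the_ex (W x)); intros x; exact (the_exP (W x)).
Qed.

Variable s : forall x, Sq (m x) (m' x) (p x) (q x).

Lemma kmap_nat : is_nat (F := kerF Hp) (G := kerF Hq) P (fun x => kmap (kP P) (s x)).
Proof.
split.
- intros x y u; pose proof (has_sq_hcomp (kerE_sq Hp u) (proj1 Hm' x y u)) as L.
  rewrite (good_comm (kmap_good (kP P) (s x))), (good_comm (kmap_good (kP P) (s y))) in L.
  exact (pbl_h P (kerE_sq Hq u) L).
- intros x y f; pose proof (good_comp (kerM_good Hp f) (proj2 Hm' x y f)) as L.
  rewrite (good_comm (kmap_good (kP P) (s x))), (good_comm (kmap_good (kP P) (s y))) in L.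
  exact (good_cancel L (kerM_good Hq f)).
Qed.

Lemma kmap_cube : is_nat P m -> forall (x y : D) (f : M D x y),
  good_cube (goodMP P) (kmor (kP P) (p x)) (kmap (kP P) (s x)) (m' x) (kmor (kP P) (q x))
    (kmor (kP P) (p y)) (kmap (kP P) (s y)) (m' y) (kmor (kP P) (q y))
    (fmap (kerM Hp) f) (fmap (dM F') f) (fmap (kerM Hq) f) (fmap (dM G') f).
Proof.
intros Hm x y f; apply good_cube_intro.
- exact (starM_exists (P := P)).
- exact (conj (kmap_good (kP P) (s x)) (conj (kmap_good (kP P) (s y))
    (conj (good_sym (kerM_good Hp f)) (conj (good_sym (proj2 kmap_nat x y f))
    (conj (good_sym (proj2 Hm' x y f)) (good_sym (kerM_good Hq f))))))).
- intros Q h l Q' h' l' w u u' T T' e3 e4 e1 e2 e1' e2' e.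
  pose proof (star_kernel_cok (inhabits (s x)) (cpl_k P _) (cpl_k P _) T e1 e2
    (cpl_c P (m x))) as Hu.
  pose proof (star_kernel_cok (inhabits (s y)) (cpl_k P _) (cpl_k P _) T' e1' e2'
    (cpl_c P (m y))) as Hu'.
  destruct (good_sq (cpl_c P (m x)) (cpl_c P (m y)) (good_sym (proj2 Hm x y f))) as (r & R).
  apply good_sym; refine (sq_good_comm Hu Hu' (r := r) _ (eq_sym e)).
  exact (has_sq_vcomp R (enat_sq Hq f)).
Qed.

End KernelMap.
End Kernels.

(** * Good squares and star-pushouts of diagrams *)

Section GoodSquares.
Variables (C : DoubleCat) (P : PreECGW C) (D : DoubleCat).

Lemma nat_good (F G : DFun D C) (m : FunM D (goodMP P) F G) (x y : D) (f : M D x y) :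
  good (goodMP P) (mm m x) (fmap (dM F) f) (fmap (dM G) f) (mm m y).
Proof. exact (good_sym (proj2 (mm_is_nat m) x y f)). Qed.

Lemma nat_sq (F G : DFun D C) (m : FunM D (goodMP P) F G) (x y : D) (u : E D x y) :
  has_sq (mm m x) (mm m y) (fmap (dE F) u) (fmap (dE G) u).
Proof. exact (proj1 (mm_is_nat m) x y u). Qed.

Lemma mm_comp (F G H : DFun D C) (m : FunM D (goodMP P) F G) (n : FunM D (goodMP P) G H) x :
  mm (m ;; n) x = mm m x ;; mm n x.
Proof. reflexivity. Qed.

Lemma mm_square (F G H K : DFun D C) (a : FunM D (goodMP P) F G) (b : FunM D (goodMP P) F H)
    (g : FunM D (goodMP P) G K) (h : FunM D (goodMP P) H K) :
  a ;; g = b ;; h -> forall x, mm a x ;; mm g x = mm b x ;; mm h x.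
Proof. intros e x; exact (f_equal (fun m => mm m x) e). Qed.

(** The component at [x] is a face of the cube over the identity of [x]. *)
Lemma nat_square_good (F G H K : DFun D C)
    (a : FunM D (goodMP P) F G) (b : FunM D (goodMP P) F H)
    (g : FunM D (goodMP P) G K) (h : FunM D (goodMP P) H K) (x : D) :
  good_nat_square a b g h -> good (goodMP P) (mm a x) (mm b x) (mm g x) (mm h x).
Proof. intros (_ & Q); apply (Q x x (idm (M D) x)). Qed.

(** The lift is taken pointwise. Cancelling [a], (PBL) gives its squares at e-morphisms and
    [good_cancel] its good squares at m-morphisms. *)
Lemma good_nat_pullback (F G H K : DFun D C)
    (a : FunM D (goodMP P) F G) (b : FunM D (goodMP P) F H)
    (g : FunM D (goodMP P) G K) (h : FunM D (goodMP P) H K) :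
  good_nat_square a b g h -> is_pullback a b g h.
Proof.
intros Q; split; [apply Q |].
intros Z u v e.
assert (W : forall x, exists w, w ;; mm a x = mm u x /\ w ;; mm b x = mm v x).
{ intros x; pose proof (mm_square e x) as ex.
  destruct (good_pullback (nat_square_good x Q)) as (_ & U).
  destruct (U _ _ _ ex) as (w & Hw & _); now exists w. }
pose (w := fun x => the_ex (W x)).
assert (Hw : forall x, w x ;; mm a x = mm u x /\ w x ;; mm b x = mm v x)
  by (intros x; exact (the_exP (W x))).
clearbody w.
assert (N : is_nat P w).
{ split.
  - intros x y e'; apply (pbl_h P (nat_sq a e')).
    rewrite (proj1 (Hw x)), (proj1 (Hw y)); apply nat_sq.
  - intros x y f; refine (good_cancel _ (good_sym (nat_good a f))).
    rewrite (proj1 (Hw x)), (proj1 (Hw y)); apply good_sym, nat_good. }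
exists (mkNat N); split.
- split; apply mm_ext; intros x; apply (Hw x).
- intros w' (e1 & _); apply mm_ext; intros x; apply (monoM P (mm a x)).
  etransitivity; [exact (proj1 (Hw x)) |].
  symmetry; exact (f_equal (fun m => mm m x) e1).
Qed.

Definition FunGood : GoodClass (FunM D (goodMP P)).
Proof.
refine (@Build_GoodClass _ (FunM D (goodMP P)) (@good_nat_square D C (goodMP P))
  good_nat_pullback _ _ _).
- intros F G H K a b g h (e & Q); split; [now symmetry |].
  intros x y f; exact (good_cube_sym (starM_exists (P := P)) (Q x y f)).
- intros F G H K a b g h (e & I); split; trivial.
  intros x y f; rewrite iso_pointwise in I.
  apply good_cube_iso; trivial; try apply nat_good; now apply mm_square.
- intros F G F' G' F'' G'' f f' f'' g h g' h' (e & Q) (e' & Q'); split.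
  + now rewrite <- comp_assoc, e, comp_assoc, e', comp_assoc.
  + intros x y u.
    exact (good_cube_comp (polM P) (starM_exists (P := P)) (Q x y u) (Q' x y u)).
Defined.

(** The lift [w] is taken pointwise; [star_sq] gives its squares at e-morphisms, the cube condition
    its good squares at m-morphisms. *)
Lemma pointwise_star (F G H K : DFun D C)
    (a : FunM D (goodMP P) F G) (b : FunM D (goodMP P) F H)
    (g : FunM D (goodMP P) G K) (h : FunM D (goodMP P) H K) :
  (forall x, is_star (goodMP P) (mm a x) (mm b x) (mm g x) (mm h x)) ->
  is_star FunGood a b g h.
Proof.
intros S; split.
- split; [apply mm_ext; intros x; exact (good_comm (proj1 (S x))) |].
  intros x y f; apply (good_cube_star (polM P)); trivial; try apply nat_good;
    symmetry; apply mm_natural.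
- intros L g' h' Q.
  assert (W : forall x, exists w, mm g x ;; w = mm g' x /\ mm h x ;; w = mm h' x).
  { intros x; exact (star_lift (S x) (nat_square_good x Q)). }
  pose (w := fun x => the_ex (W x)).
  assert (Hw : forall x, mm g x ;; w x = mm g' x /\ mm h x ;; w x = mm h' x)
    by (intros x; exact (the_exP (W x))).
  clearbody w.
  assert (N : is_nat P w).
  { split.
    - intros x y u.
      refine (star_sq (S x) (S y) (nat_sq a u) (nat_sq b u) (nat_sq g u) (nat_sq h u) _ _).
      + rewrite (proj1 (Hw x)), (proj1 (Hw y)); apply nat_sq.
      + rewrite (proj2 (Hw x)), (proj2 (Hw y)); apply nat_sq.
    (* With [K x] and [K y] as the star-pushouts, the comparison square of the cube of [Q] is the
       naturality square of [w] at [f]. *)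
    - intros x y f; destruct (Hw x), (Hw y).
      exact (good_cube_elim (proj2 Q x y f) (S x) (S y)
        (good_comm (nat_good g f)) (good_comm (nat_good h f))
        H0 H1 H2 H3). }
  exists (mkNat N); split.
  + split; apply mm_ext; intros x; apply (Hw x).
  + intros w' (e1 & e2); apply mm_ext; intros x.
    apply (f_equal (fun m => mm m x)) in e1; apply (f_equal (fun m => mm m x)) in e2.
    destruct (Hw x) as (e3 & e4); refine (star_ext (d := w x) (d' := mm w' x) (S x) _ _ _).
    * rewrite e3, e4; exact (nat_square_good x Q).
    * rewrite e3; now symmetry.
    * rewrite e4; now symmetry.
Qed.

(** The second hypothesis feeds [star_e_exists] and keeps the construction valid for e-spans, where
    (PO) is absent. Functoriality follows from the uniqueness statements [Um] and [Ue]. *)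
Lemma star_construct (F G H : DFun D C)
    (a : FunM D (goodMP P) F G) (b : FunM D (goodMP P) F H) :
  (forall x, has_good_completion (goodMP P) (mm a x) (mm b x)) ->
  (forall (x y : D) (u : E D x y) phi psi,
    good (goodMP P) (kmor (kP P) (fmap (dE F) u)) phi (mm a y) (kmor (kP P) (fmap (dE G) u)) ->
    good (goodMP P) (kmor (kP P) (fmap (dE F) u)) psi (mm b y) (kmor (kP P) (fmap (dE H) u)) ->
    has_good_completion (goodMP P) phi psi) ->
  exists (K : DFun D C) (g : FunM D (goodMP P) G K) (h : FunM D (goodMP P) H K),
    forall x, is_star (goodMP P) (mm a x) (mm b x) (mm g x) (mm h x).
Proof.
intros Hc Hk.
assert (W : forall x, {Q : C & {g : M C (G x) Q & {h : M C (H x) Q |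
    is_star (goodMP P) (mm a x) (mm b x) g h}}}).
{ intros x; pose proof (starM_exists (Hc x)) as E0.
  destruct (constructive_indefinite_description _ E0) as (Q & E1).
  destruct (constructive_indefinite_description _ E1) as (g & E2).
  destruct (constructive_indefinite_description _ E2) as (h & E3).
  exact (existT _ Q (existT _ g (exist _ h E3))). }
pose (Q := fun x => projT1 (W x)).
pose (g := fun x => projT1 (projT2 (W x)) : M C (G x) (Q x)).
pose (h := fun x => proj1_sig (projT2 (projT2 (W x))) : M C (H x) (Q x)).
assert (S : forall x, is_star (goodMP P) (mm a x) (mm b x) (g x) (h x))
  by (intros x; exact (proj2_sig (projT2 (projT2 (W x))))).
clearbody h; clearbody g; clearbody Q; clear W Hc.
assert (Hspan : forall (x y : D) (f : M D x y), good (goodMP P) (mm a x) (mm b x)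
    (fmap (dM G) f ;; g y) (fmap (dM H) f ;; h y)).
{ intros x y f; exact (good_span (nat_good a f) (nat_good b f) (proj1 (S y))). }
assert (Wm : forall (x y : D) (f : M D x y), exists w : M C (Q x) (Q y),
    g x ;; w = fmap (dM G) f ;; g y /\ h x ;; w = fmap (dM H) f ;; h y).
{ intros x y f; exact (star_lift (S x) (Hspan x y f)). }
pose (wm := fun x y f => the_ex (Wm x y f)).
assert (Hm : forall (x y : D) (f : M D x y), g x ;; wm x y f = fmap (dM G) f ;; g y /\
    h x ;; wm x y f = fmap (dM H) f ;; h y) by (intros x y f; exact (the_exP (Wm x y f))).
clearbody wm; clear Wm.
assert (Um : forall (x y : D) (f : M D x y) w, g x ;; w = fmap (dM G) f ;; g y ->
    h x ;; w = fmap (dM H) f ;; h y -> wm x y f = w).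
{ intros x y f w e1 e2; destruct (Hm x y f) as (e3 & e4); apply (star_ext (S x)).
  - rewrite e3, e4; apply Hspan.
  - congruence.
  - congruence. }
assert (We : forall (x y : D) (u : E D x y), exists e : E C (Q x) (Q y),
    has_sq (g x) (g y) (fmap (dE G) u) e /\ has_sq (h x) (h y) (fmap (dE H) u) e).
{ intros x y u; exact (star_e_exists (S x) (S y) (nat_sq a u) (nat_sq b u) (Hk x y u)). }
pose (we := fun x y u => the_ex (We x y u)).
assert (He : forall (x y : D) (u : E D x y), has_sq (g x) (g y) (fmap (dE G) u) (we x y u) /\
    has_sq (h x) (h y) (fmap (dE H) u) (we x y u))
  by (intros x y u; exact (the_exP (We x y u))).
clearbody we; clear We Hk.
assert (Ue : forall (x y : D) (u : E D x y) e, has_sq (g x) (g y) (fmap (dE G) u) e ->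
    has_sq (h x) (h y) (fmap (dE H) u) e -> we x y u = e).
{ intros x y u e H1 H2; destruct (He x y u) as (H3 & H4).
  exact (star_e_unique (S x) (S y) (nat_sq a u) (nat_sq b u) H3 H4 H1 H2). }
unshelve refine
  (let fM : FunctorOn Q (M D) (M C) := @Build_FunctorOn _ _ Q (M D) (M C) wm _ _ in _).
{ intros x; apply Um; now rewrite fmap_id, comp_idl, comp_idr. }
{ intros x y z f f'; destruct (Hm x y f) as (e1 & e2), (Hm y z f') as (e3 & e4); apply Um;
    rewrite fmap_comp, <- comp_assoc; rewrite ?e1, ?e2, comp_assoc, ?e3, ?e4, comp_assoc;
    reflexivity. }
unshelve refine
  (let fE : FunctorOn Q (E D) (E C) := @Build_FunctorOn _ _ Q (E D) (E C) we _ _ in _).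
{ intros x; apply Ue; rewrite fmap_id; exact (inhabits (vid _)). }
{ intros x y z u v; destruct (He x y u) as (e1 & e2), (He y z v) as (e3 & e4); apply Ue;
    rewrite fmap_comp; [exact (has_sq_vcomp e1 e3) | exact (has_sq_vcomp e2 e4)]. }
unshelve refine (let K : DFun D C := @mkDF C P D Q fM fE _ in _).
{ intros x y x' y' f f' u v s; simpl.
  destruct (Hm x y f) as (e1 & e2), (Hm x' y' f') as (e3 & e4).
  destruct (He x x' u) as (H1 & H2), (He y y' v) as (H3 & H4).
  refine (star_sq (S x) (S x') (nat_sq a u) (nat_sq b u) H1 H2 _ _).
  - rewrite e1, e3; exact (has_sq_hcomp (inhabits (dSq G s)) H3).
  - rewrite e2, e4; exact (has_sq_hcomp (inhabits (dSq H s)) H4). }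
assert (Ng : is_nat (F := G) (G := K) P g).
{ split.
  - intros x y u; exact (proj1 (He x y u)).
  - intros x y f; destruct (Hm x y f) as (e1 & e2).
    exact (star_face (polM P) (nat_good a f) (nat_good b f) (S x) (proj1 (S y)) e1 e2). }
assert (Nh : is_nat (F := H) (G := K) P h).
{ split.
  - intros x y u; exact (proj2 (He x y u)).
  - intros x y f; destruct (Hm x y f) as (e1 & e2).
    exact (star_face (polM P) (nat_good b f) (nat_good a f) (star_sym (S x))
      (good_sym (proj1 (S y))) e2 e1). }
exists K, (mkNat Ng), (mkNat Nh); exact S.
Qed.

(** The given completion [L] supplies both hypotheses of [star_construct]: its values complete the
    component spans, and the kernels of its e-morphisms complete the spans of kernels. *)
Lemma FunGood_star_exists (F G H : DFun D C)
    (a : FunM D (goodMP P) F G) (b : FunM D (goodMP P) F H) :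
  has_good_completion FunGood a b ->
  exists (K : DFun D C) (g : FunM D (goodMP P) G K) (h : FunM D (goodMP P) H K),
    forall x, is_star (goodMP P) (mm a x) (mm b x) (mm g x) (mm h x).
Proof.
intros (L & g & h & Q); apply star_construct.
- intros x; exists (L x), (mm g x), (mm h x); exact (nat_square_good x Q).
- intros x y u phi psi H1 H2.
  destruct (sq_good (cpl_k P (fmap (dE G) u)) (cpl_k P (fmap (dE L) u)) (nat_sq g u)) as (n & N).
  destruct (sq_good (cpl_k P (fmap (dE H) u)) (cpl_k P (fmap (dE L) u)) (nat_sq h u)) as (n' & N').
  exists _, n, n'; exact (kernel_good (nat_square_good y Q) H1 H2 N N').
Qed.

(** Any star-pushout is isomorphic to a pointwise one, and isomorphisms of diagrams are
    pointwise. *)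
Lemma FunGood_star (F G H K : DFun D C)
    (a : FunM D (goodMP P) F G) (b : FunM D (goodMP P) F H)
    (g : FunM D (goodMP P) G K) (h : FunM D (goodMP P) H K) :
  is_star FunGood a b g h <->
  forall x, is_star (goodMP P) (mm a x) (mm b x) (mm g x) (mm h x).
Proof.
split; [| apply pointwise_star].
intros S x.
destruct (@FunGood_star_exists F G H a b) as (K' & g' & h' & S').
{ exists K, g, h; apply S. }
destruct (star_unique (pointwise_star S') S) as (i & Hi & <- & <-).
rewrite !mm_comp; apply star_post_iso; trivial; now apply iso_pointwise.
Qed.

(** By [star_trans] a star-pushout of [d] and [h] is also one of the outer span, so the two cubes
    share their comparison square. *)
Lemma FunGood_POL : POL FunGood.
Proof.
intros A B L Q K F f g h k d e m S c (e1 & H); split; trivial.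
rewrite FunGood_star in S.
pose proof (mm_square c) as c'; intros x y u; apply good_cube_intro.
- exact (starM_exists (P := P)).
- pose proof (H x y u) as ((H1 & H2 & _) & _).
  refine (conj _ (conj _ (conj (nat_good d u) (conj (nat_good h u)
    (conj (nat_good m u) (nat_good e u)))))).
  + eapply (polM P); [exact (S x) | exact (c' x) | exact H1].
  + eapply (polM P); [exact (S y) | exact (c' y) | exact H2].
- intros P1 h1 k1 P2 h2 k2 w v v' S1 S2 e2 e3 e4 e5 e6 e7 _.
  refine (good_cube_elim (H x y u) (star_trans (polM P) (S x) S1)
    (star_trans (polM P) (S y) S2) e2 _ e4 _ e6 _).
  + rewrite comp_assoc, e3, <- !comp_assoc; now rewrite (good_comm (nat_good k u)).
  + now rewrite comp_assoc, e5.
  + now rewrite comp_assoc, e7.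
Qed.

End GoodSquares.

(** * Transfer of good squares along the transpose of diagrams *)

Section Pull.
Variables (O O' : Type) (X : CatOn O') (phi : O -> O') (G : GoodClass X).

Definition pull_good : GoodClass (pull_cat X phi).
Proof.
refine (@Build_GoodClass O (pull_cat X phi)
  (fun A B C D f g h k => @good _ _ G (phi A) (phi B) (phi C) (phi D) f g h k) _ _ _ _).
- intros A B C D f g h k H; destruct (good_pullback H) as (e & U); split; [exact e |].
  intros Z; exact (U (phi Z)).
- intros A B C D f g h k; apply good_sym.
- intros A B C D f g h k; apply (@good_triangle _ _ G).
- intros A B A' B' A'' B'' f f' f'' g h g' h'; apply (@good_comp _ _ G).
Defined.

Hypothesis phi_surj : forall y, exists x, phi x = y.

(** The pulled-back universal property tests only objects in the image of [phi], so surjectivity is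
    needed to recover the original one. *)
Lemma pull_star A B C D (f : pull_cat X phi A B) (g : pull_cat X phi A C)
    (h : pull_cat X phi B D) (k : pull_cat X phi C D) :
  is_star pull_good f g h k <->
  @is_star _ X G (phi A) (phi B) (phi C) (phi D) f g h k.
Proof.
split; intros (H & U); split; trivial.
- intros D' h' k'; destruct (phi_surj D') as (x & <-); exact (U x h' k').
- intros D'; exact (U (phi D')).
Qed.

Lemma pull_POL : POL G -> POL pull_good.
Proof.
intros H A B C Q D F f g h k d e m S.
rewrite pull_star in S; exact (H _ _ _ _ _ _ f g h k d e m S).
Qed.

End Pull.

(* [trF (untr X)] is X only up to the proof fields. *)
Definition untr (D C : DoubleCat) (X : DFun (tr D) (tr C)) : DFun D C.
Proof.
refine (@Build_DFun D C (dobj X) (dE X) (dM X)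
  (fun A B A' B' f f' p q s => @dSq (tr D) (tr C) X A A' B B' p q f f' s) _ _ _ _).
- intros A A' p; exact (sq_eq_tr (dSq_vid X p)).
- intros A B f; exact (sq_eq_tr (dSq_hid X f)).
- intros; exact (sq_eq_tr (dSq_vcomp X x y)).
- intros; exact (sq_eq_tr (dSq_hcomp X x y)).
Defined.

Lemma trF_surj (D C : DoubleCat) (X : DFun (tr D) (tr C)) : exists F : DFun D C, trF F = X.
Proof.
exists (untr X); destruct X; unfold trF, untr; simpl.
f_equal; apply proof_irrelevance.
Qed.

(** * The initial diagram *)

Section Empty.
Variables (C : DoubleCat) (P : PreECGW C) (D : DoubleCat).

Lemma cpl_initial (A B : C) (i : M C A B) : is_initial (M C) A -> cpl P i (idm (E C) B).
Proof.
intros H; pose proof (proj1 (@cpl_iso (tr C) (tr_pre P) _ _ _ (idm (E C) B) _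
  (proj1 (cpl_tr P _ _) (cpl_k P (idm (E C) B))))) as K.
specialize (K (iso_id _ _)).
destruct (H (ker (kP P) (idm (E C) B))) as (j & _); exists j; split.
- exact (initial_initial j H K).
- now apply initial_unique.
Qed.

(** A map out of an initial object has an identity as cokernel, so the required square corresponds
    to the good identity square on [q]; its left side is forced by initiality. *)
Lemma initial_sq (A B A' B' : C) (i : M C A B) (i' : M C A' B') (p : E C A A') (q : E C B B') :
  is_initial (M C) A -> is_initial (M C) A' -> is_initial (E C) A -> has_sq i i' p q.
Proof.
intros H H' K; assert (S : good (goodEP P) (idm (E C) B) q q (idm (E C) B')).
{ apply good_sym; exact (good_id (goodEP P) q). }
destruct (goodE_sq (cpl_initial i H) (cpl_initial i' H') S) as (e & L).
now rewrite (initial_unique p e K).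
Qed.

Lemma initial_pointwise (F : DFun D C) :
  (forall x, is_initial (M C) (F x)) -> (forall x, is_initial (E C) (F x)) ->
  is_initial (FunM D (goodMP P)) F.
Proof.
intros HM HE G.
assert (N : is_nat (F := F) (G := G) P (fun x => the_ex (HM x (G x)))).
{ split.
  - intros x y u; now apply initial_sq.
  - intros x y f; apply good_sym, good_triangle; split.
    + now apply initial_unique.
    + now apply initial_initial. }
exists (mkNat N); intros m; apply mm_ext; intros x; now apply initial_unique.
Qed.

Definition emptyF : DFun D C.
Proof.
refine (@mkDF C P D (fun _ => emptyP P)
  (@Build_FunctorOn _ _ (fun _ => emptyP P) (M D) (M C) (fun _ _ _ => idm (M C) _)
    (fun _ => eq_refl) (fun _ _ _ _ _ => eq_sym (comp_idl _)))
  (@Build_FunctorOn _ _ (fun _ => emptyP P) (E D) (E C) (fun _ _ _ => idm (E C) _)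
    (fun _ => eq_refl) (fun _ _ _ _ _ => eq_sym (comp_idl _))) _).
intros; exact (inhabits (hid _)).
Defined.

End Empty.

Lemma iso_pair_nat (C : DoubleCat) (P : PreECGW C) (D : DoubleCat) (F G : DFun D C)
    (m : forall x, M C (F x) (G x)) (p : forall x, E C (F x) (G x)) :
  (forall x, iso_pair P (m x) (p x)) -> is_nat P m ->
  @is_nat (tr C) (tr_pre P) (tr D) (trF F) (trF G) p.
Proof.
intros H (N1 & N2); split.
- intros x y f; exact (proj2 (iso_pair_sqM _ _ (H x) (H y))
    (eq_sym (good_comm (N2 x y f)))).
- intros x y u; apply (@good_triangle _ _ (goodEP P)).
  split; [| exact (iso_pair_isoE (H x))].
  symmetry; exact (proj1 (iso_pair_sqE _ _ (H x) (H y)) (N1 x y u)).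
Qed.

Lemma iso_pair_tr (C : DoubleCat) (P : PreECGW C) (A B : C) (f : M C A B) (p : E C A B) :
  iso_pair P f p -> @iso_pair (tr C) (tr_pre P) A B p f.
Proof. intros (i & e1 & e2); now exists i. Qed.

Lemma iso_pair_nat_inv (C : DoubleCat) (P : PreECGW C) (D : DoubleCat) (F G : DFun D C)
    (m : forall x, M C (F x) (G x)) (p : forall x, E C (F x) (G x)) :
  (forall x, iso_pair P (m x) (p x)) ->
  @is_nat (tr C) (tr_pre P) (tr D) (trF F) (trF G) p -> is_nat P m.
Proof.
intros H; exact (@iso_pair_nat (tr C) (tr_pre P) (tr D) (trF F) (trF G) p m
  (fun x => iso_pair_tr (H x))).
Qed.

(** * The functor double category *)

Section FunctorPre.
Variables (C : DoubleCat) (P : PreECGW C) (D : DoubleCat).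

Definition FunC : DoubleCat := FunDC (goodMP P) (goodEP P) D.

(** The transpose of the functor double category is not literally the functor double category of the
    transposes; its m-morphisms are pulled back along [trF]. *)
Definition FunGoodE : GoodClass (M (tr FunC)) :=
  pull_good (@trF D C) (@FunGood (tr C) (tr_pre P) (tr D)).

Lemma em_is_nat (F G : DFun D C) (p : E FunC F G) :
  @is_nat (tr C) (tr_pre P) (tr D) (trF F) (trF G) (em p).
Proof. exact (@mm_is_nat (tr C) (tr_pre P) (tr D) (trF F) (trF G) p). Qed.

Definition mkENat (F G : DFun D C) (p : forall x, E C (F x) (G x))
    (H : @is_nat (tr C) (tr_pre P) (tr D) (trF F) (trF G) p) : E FunC F G :=
  @mkNat (tr C) (tr_pre P) (tr D) (trF F) (trF G) p H.

Lemma em_ext (F G : DFun D C) (p q : E FunC F G) : (forall x, em p x = em q x) -> p = q.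
Proof. exact (@mm_ext (tr C) (tr_pre P) (tr D) (trF F) (trF G) p q). Qed.

Lemma em_natural (F G : DFun D C) (p : E FunC F G) (x y : D) (u : E D x y) :
  fmap (dE F) u ;; em p y = em p x ;; fmap (dE G) u.
Proof. exact (@mm_natural (tr C) (tr_pre P) (tr D) (trF F) (trF G) p x y u). Qed.

Lemma em_iso (F G : DFun D C) (p : E FunC F G) : is_iso p <-> forall x, is_iso (em p x).
Proof. exact (@iso_pointwise (tr C) (tr_pre P) (tr D) (trF F) (trF G) p). Qed.

Lemma mod_exists (F G F' G' : DFun D C) (m : M FunC F G) (m' : M FunC F' G')
    (p : E FunC F F') (q : E FunC G G') :
  has_sq m m' p q <-> forall x, has_sq (mm m x) (mm m' x) (em p x) (em q x).
Proof.
split; [intros [s] x; exact (inhabits (md s x)) |].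
intros S; constructor.
refine (@Build_Mod C (goodMP P) (goodEP P) D F G F' G' m m' p q (fun x => the_sq (S x)) _ _).
- intros x y f; apply (thin_eq P); trivial; apply mm_natural.
- intros x y u; apply (thin_eq P); trivial; apply em_natural.
Qed.

Lemma mod_thin (F G F' G' : DFun D C) (m n : M FunC F G) (m' n' : M FunC F' G')
    (p r : E FunC F F') (q t : E FunC G G') (a : Mod m m' p q) (b : Mod n n' r t) :
  m = n -> m' = n' -> p = r -> q = t ->
  @sq_eq (DFun D C) (FunM D (goodMP P)) (FunE D (goodEP P)) (@Mod C (goodMP P) (goodEP P) D)
    _ _ _ _ _ _ _ _ a _ _ _ _ b.
Proof. intros; subst; apply Mod_eq; trivial; intros; apply (thinM P). Qed.

Definition kF : KerData (FunGood P D : GoodClass (M FunC)).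
Proof.
refine (@Build_KerData FunC (FunGood P D)
  (fun F G p => kerF (em_is_nat p))
  (fun F G p => mkNat (kmor_nat (em_is_nat p)))
  (fun F G F' G' m m' p q s =>
    mkNat (kmap_nat (em_is_nat p) (em_is_nat q) (mm_is_nat m') (fun x => md s x))) _ _ _).
- intros F G F' G' m m' p q s; split.
  + apply mm_ext; intros x; exact (good_comm (kmap_good (kP P) (md s x))).
  + exact (kmap_cube (em_is_nat p) (em_is_nat q) (mm_is_nat m') (fun x => md s x) (mm_is_nat m)).
- intros F G p; apply mm_ext; intros x; exact (kmap_id (kP P) (em p x)).
- intros F G H F' G' H' m n m' n' p q r s t; apply mm_ext; intros x.
  exact (kmap_comp (kP P) (md s x) (md t x)).
Defined.

Lemma mm_is_nat_tr (F G : DFun D C) (m : M FunC F G) :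
  @is_nat (tr (tr C)) (tr_pre (tr_pre P)) (tr (tr D)) (trF (trF F)) (trF (trF G)) (mm m).
Proof. exact (@mm_is_nat C P D F G m). Qed.

(** The transposed kernel construction yields a double functor between the transposes, which [untr]
    reads back. *)
Definition cokF (F G : DFun D C) (m : M FunC F G) : DFun D C :=
  untr (@kerF (tr C) (tr_pre P) (tr D) (trF F) (trF G) (mm m) (mm_is_nat_tr m)).

Definition cokmor (F G : DFun D C) (m : M FunC F G) : E FunC (cokF m) G :=
  @mkENat (cokF m) G (fun x => kmor (cP P) (mm m x))
    (@kmor_nat (tr C) (tr_pre P) (tr D) (trF F) (trF G) (mm m) (mm_is_nat_tr m)).

Definition cokmap (F G F' G' : DFun D C) (m : M FunC F G) (m' : M FunC F' G')
    (p : E FunC F F') (q : E FunC G G') (s : Sq m m' p q) : E FunC (cokF m) (cokF m') :=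
  @mkENat (cokF m) (cokF m')
     (fun x => @kmap (tr C) _ (cP P) _ _ _ _ (em p x) (em q x) (mm m x) (mm m' x) (md s x))
     (@kmap_nat (tr C) (tr_pre P) (tr D) (trF F) (trF G) (trF F') (trF G')
        (mm m) (mm m') (em p) (em q) (mm_is_nat_tr m) (mm_is_nat_tr m') (em_is_nat q)
        (fun x => md s x)).

Lemma cokmap_comm (F G F' G' : DFun D C) (m : M FunC F G) (m' : M FunC F' G')
    (p : E FunC F F') (q : E FunC G G') (s : Sq m m' p q) :
  cokmor m ;; q = cokmap s ;; cokmor m'.
Proof.
apply em_ext; intros x.
exact (@good_comm _ _ _ _ _ _ _ _ _ _ _
      (@kmap_good (tr C) _ (cP P) _ _ _ _ (em p x) (em q x) (mm m x) (mm m' x) (md s x))).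
Qed.

Lemma cokmap_good (F G F' G' : DFun D C) (m : M FunC F G) (m' : M FunC F' G')
    (p : E FunC F F') (q : E FunC G G') (s : Sq m m' p q) :
  good FunGoodE (cokmor m) (cokmap s) q (cokmor m').
Proof.
split; [exact (cokmap_comm s) |].
exact (@kmap_cube (tr C) (tr_pre P) (tr D) (trF F) (trF G) (trF F') (trF G')
      (mm m) (mm m') (em p) (em q) (mm_is_nat_tr m) (mm_is_nat_tr m') (em_is_nat q)
      (fun x => md s x) (em_is_nat p)).
Qed.

Definition cF : @KerData (tr FunC) FunGoodE.
Proof.
refine (@Build_KerData (tr FunC) FunGoodE cokF cokmor
  (fun F G F' G' p p' m m' s => @cokmap F F' G G' m m' p p' s) _ _ _).
- intros F G F' G' p p' m m' s; apply cokmap_good.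
- intros F G m; apply em_ext; intros x; exact (kmap_id (cP P) (mm m x)).
- intros F G H F' G' H' p q p' q' m n r s t; apply em_ext; intros x.
  exact (@kmap_comp (tr C) _ (cP P) _ _ _ _ _ _ _ _ _ _ _ _ _ (md s x) (md t x)).
Defined.

(** The shared groupoid is taken to be the isomorphisms of m-type; their e-type partners are found
    pointwise. *)
Definition FunShared_cat : CatOn (DFun D C).
Proof.
refine (@Build_CatOn (DFun D C) (fun F G => {m : M FunC F G | is_iso m})
  (fun F => exist _ (idm (M FunC) F) (iso_id (M FunC) F))
  (fun F G H m n => exist _ (proj1_sig m ;; proj1_sig n)
     (iso_comp (proj2_sig m) (proj2_sig n))) _ _ _);
  intros; apply eq_sig_hprop; try (intros; apply proof_irrelevance); simpl.
- apply (comp_idl (c := M FunC)).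
- apply (comp_idr (c := M FunC)).
- apply (comp_assoc (c := M FunC)).
Defined.

Definition iso_e (A B : C) (f : M C A B) (H : is_iso f) : E C A B :=
  the_ex (iso_pair_ofM P H).

Lemma iso_eP (A B : C) (f : M C A B) (H : is_iso f) : iso_pair P f (iso_e H).
Proof. exact (the_exP (iso_pair_ofM P H)). Qed.

Definition FunShared_E : FunctorOn (fun F => F) FunShared_cat (E FunC).
Proof.
refine (@Build_FunctorOn _ _ (fun F => F) FunShared_cat (E FunC)
  (fun F G m => mkENat (iso_pair_nat
     (fun x => iso_eP (proj1 (iso_pointwise (proj1_sig m)) (proj2_sig m) x))
     (mm_is_nat (proj1_sig m)))) _ _).
- intros F; apply em_ext; intros x.
  exact (iso_pair_funE (iso_eP _) (iso_pair_id P (F x))).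
- intros F G H m n; apply em_ext; intros x.
  exact (iso_pair_funE (iso_eP _) (iso_pair_comp (iso_eP _) (iso_eP _))).
Defined.

Lemma FunShared_pair (F G : DFun D C) (m : FunShared_cat F G) (x : D) :
  iso_pair P (mm (proj1_sig m) x) (em (fmap FunShared_E m) x).
Proof. exact (iso_eP (proj1 (iso_pointwise (proj1_sig m)) (proj2_sig m) x)). Qed.

Definition FunShared_M : FunctorOn (fun F => F) FunShared_cat (M FunC) :=
  @Build_FunctorOn _ _ (fun F => F) FunShared_cat (M FunC)
    (fun F G m => proj1_sig m) (fun F => eq_refl) (fun F G H m n => eq_refl).

Definition FunShared : SharedIso FunC.
Proof.
refine (@Build_SharedIso FunC FunShared_cat _ FunShared_M FunShared_E _ _ _ _ _ _).
- intros F G (m & Hm); destruct (iso_inverse Hm) as (n & Hn & e1 & e2).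
  exists (exist _ n Hn); split; apply eq_sig_hprop; trivial; intros; apply proof_irrelevance.
- intros F G m Hm; exists (exist _ m Hm); split; trivial.
  intros m' <-; apply eq_sig_hprop; trivial; intros; apply proof_irrelevance.
- intros F G p Hp; rewrite em_iso in Hp.
  pose (m := fun x => the_ex (iso_pair_ofE P (Hp x))).
  assert (Hm : forall x, iso_pair P (m x) (em p x))
    by (intros x; exact (the_exP (iso_pair_ofE P (Hp x)))).
  clearbody m.
  pose (n := mkNat (iso_pair_nat_inv Hm (em_is_nat p))).
  assert (Hn : is_iso (n : M FunC F G)).
  { apply iso_pointwise; intros x; exact (iso_pair_isoM (Hm x)). }
  exists (exist _ n Hn); split.
  + apply em_ext; intros x.
    exact (iso_pair_funE (FunShared_pair (exist _ n Hn) x) (Hm x)).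
  + intros n' <-; apply eq_sig_hprop; [intros; apply proof_irrelevance |].
    apply mm_ext; intros x; exact (iso_pair_funM (Hm x) (FunShared_pair n' x)).
- intros F G F' G' f f' g g'; etransitivity; [apply mod_exists |]; split.
  + intros S; apply mm_ext; intros x.
    exact (proj1 (iso_pair_sqM _ _ (FunShared_pair f x) (FunShared_pair f' x)) (S x)).
  + intros e x; apply (iso_pair_sqM _ _ (FunShared_pair f x) (FunShared_pair f' x)).
    exact (mm_square e x).
- intros; apply (sq_eq_eq (M := M FunC) (E := E FunC)), mod_thin; trivial.
- intros F G F' G' f f' g g'; etransitivity; [apply mod_exists |]; split.
  + intros S; apply em_ext; intros x.
    exact (proj1 (iso_pair_sqE _ _ (FunShared_pair f x) (FunShared_pair f' x)) (S x)).
  + intros e x; apply (iso_pair_sqE _ _ (FunShared_pair f x) (FunShared_pair f' x)).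
    exact (f_equal (fun p => em p x) e).
- intros; apply (sq_eq_eq (M := M FunC) (E := E FunC)), mod_thin; trivial.
Defined.

Lemma kF_triangle (F G F' G' : DFun D C) (m : M FunC F G) (m' : M FunC F' G')
    (p : E FunC F F') (q : E FunC G G') (s : Sq m m' p q) :
  ktriangle kF s <-> forall x, ktriangle (kP P) (md s x).
Proof.
split.
- intros (e & I) x; split; [exact (good_comm (kmap_good (kP P) (md s x))) |].
  exact (proj1 (iso_pointwise _) I x).
- intros T; split; [exact (good_comm (kmap_good kF s)) |].
  apply iso_pointwise; intros x; exact (proj2 (T x)).
Qed.

Lemma cF_triangle (F G F' G' : DFun D C) (m : M FunC F G) (m' : M FunC F' G')
    (p : E FunC F F') (q : E FunC G G') (s : Sq m m' p q) :
  @ktriangle (tr FunC) FunGoodE cF _ _ _ _ p q m m' s <->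
  forall x, @ktriangle (tr C) (goodEP P) (cP P) _ _ _ _ _ _ _ _ (md s x).
Proof.
split.
- intros (e & I) x; split; [| exact (proj1 (em_iso _) I x)].
  exact (@good_comm _ _ _ _ _ _ _ _ _ _ _
      (@kmap_good (tr C) _ (cP P) _ _ _ _ (em p x) (em q x) (mm m x) (mm m' x) (md s x))).
- intros T; split; [exact (cokmap_comm s) |].
  apply em_iso; intros x; exact (proj2 (T x)).
Qed.

(** Thinness identifies the components of the modification with the given distinguished squares. *)
Lemma mod_ktriangle (F G F' G' : DFun D C) (m : M FunC F G) (m' : M FunC F' G')
    (p : E FunC F F') (q : E FunC G G') :
  (forall x, exists s : Sq (mm m x) (mm m' x) (em p x) (em q x), ktriangle (kP P) s) ->
  exists s : Sq m m' p q, ktriangle kF s.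
Proof.
intros H; assert (S : has_sq m m' p q).
{ apply mod_exists; intros x; destruct (H x) as (s & _); exact (inhabits s). }
destruct S as [s]; exists s; apply kF_triangle; intros x.
destruct (H x) as (t & T); rewrite (sq_eq_eq (thinM P (md s x) t)); exact T.
Qed.

End FunctorPre.

(** * Verification of the axioms for diagrams *)

Section FunctorAxioms.
Variables (C : DoubleCat) (P : PreECGW C) (D : DoubleCat).

Lemma FunC_thin : thin (FunC P D).
Proof.
intros F G F' G' m n m' p q s t; apply mod_thin; trivial.
apply mm_ext; intros x; exact (sq_top_unique P (inhabits (md s x)) (inhabits (md t x))).
Qed.

Lemma FunC_thin_tr : thin (tr (FunC P D)).
Proof.
intros F G F' G' p p' q m m' s t.
refine (sq_eq_tr (mod_thin (P := P) s t _ _ _ _)); trivial.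
apply em_ext; intros x; exact (sq_left_unique P (inhabits (md s x)) (inhabits (md t x))).
Qed.

Lemma kF_full : k_full (kF P D).
Proof.
intros F G F' G' p q g m' (_ & Q).
destruct (top_nat_exists (Hp := em_is_nat p) (Hq := em_is_nat q) (m' := mm m') (g := mm g) Q)
  as (n & S).
exists (mkNat (top_nat_cube (mm_is_nat m') S Q)); apply mod_exists; exact S.
Qed.

Lemma cF_full : @k_full (tr (FunC P D)) (FunGoodE P D) (cF P D).
Proof.
intros F G F' G' m m' g q (_ & Q).
destruct (@top_nat_exists (tr C) (tr_pre P) (tr D) (trF F) (trF F') (trF G) (trF G')
  (mm m) (mm m') (em q) (mm_is_nat_tr m) (mm_is_nat_tr m') (em g) Q) as (n & S).
exists (mkENat (@top_nat_cube (tr C) (tr_pre P) (tr D) (trF F) (trF F') (trF G) (trF G')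
  (mm m) (mm m') n (em q) (mm_is_nat_tr m) (mm_is_nat_tr m') (em_is_nat q) (em g) S Q)).
refine (proj2 (mod_exists m m' _ q) _); exact S.
Qed.

Lemma FunC_dist (F G F' G' : DFun D C) (m : M (FunC P D) F G) (m' : M (FunC P D) F' G')
    (p : E (FunC P D) F F') (q : E (FunC P D) G G') (s : Sq m m' p q) :
  ktriangle (kF P D) s <-> @ktriangle (tr (FunC P D)) (FunGoodE P D) (cF P D) _ _ _ _ p q m m' s.
Proof.
rewrite kF_triangle, cF_triangle; split; intros H x; apply (distP P), H.
Qed.

Lemma emptyF_initialM : is_initial (M (FunC P D)) (emptyF P D).
Proof. apply initial_pointwise; intros x; [apply emptyM | apply emptyE]. Qed.

Lemma emptyF_initialE : is_initial (E (FunC P D)) (emptyF P D).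
Proof.
intros G; apply (@initial_pointwise (tr C) (tr_pre P) (tr D) (trF (emptyF P D)));
  intros x; [apply (emptyE P) | apply (emptyM P)].
Qed.

Lemma FunC_axK : axiomK (kF P D) (emptyF P D) (fun A B f => kmor (cF P D) f).
Proof.
intros F G m; destruct (emptyF_initialM (cokF m)) as (i & _).
destruct (emptyF_initialE F) as (e & _).
exists i, e; apply mod_ktriangle; intros x.
destruct (axK_MP P (mm m x)) as (i0 & e0 & s & T).
assert (i0 = mm i x) as -> by apply initial_unique, emptyM.
assert (e0 = em e x) as -> by apply initial_unique, emptyE.
now exists s.
Qed.

Lemma FunC_axK_tr :
  @axiomK (tr (FunC P D)) (FunGoodE P D) (cF P D) (emptyF P D)
    (fun A B p => ker (kF P D) p) (fun A B p => kmor (kF P D) p).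
Proof.
intros F G p; destruct (emptyF_initialE (ker (kF P D) p)) as (e & _).
destruct (emptyF_initialM F) as (i & _).
exists e, i.
enough (exists s : Sq (d := FunC P D) i (kmor (kF P D) p) e p, ktriangle (kF P D) s)
  as (s & T) by (exists s; exact (proj1 (FunC_dist s) T)).
apply mod_ktriangle; intros x.
destruct (axK_EP P (em p x)) as (e0 & i0 & s & T).
assert (i0 = mm i x) as -> by exact (@initial_unique _ (M C) _ _ i0 (mm i x) (emptyM P)).
assert (e0 = em e x) as -> by exact (@initial_unique _ (E C) _ _ e0 (em e x) (emptyE P)).
exists s; exact (proj2 (distP P s) T).
Qed.

(** The pointwise maps of cokernels are invertible, so their naturality squares are good by
    [top_nat_iso]. *)
Lemma star_cok_nat (F G H K : DFun D C) (a : M (FunC P D) F G) (b : M (FunC P D) F H)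
    (g : M (FunC P D) G K) (h : M (FunC P D) H K) :
  (forall x, is_star (goodMP P) (mm a x) (mm b x) (mm g x) (mm h x)) ->
  exists (r : M (FunC P D) (cokF a) (cokF h)) (_ : Sq r g (cokmor a) (cokmor h)), is_iso r.
Proof.
intros S.
assert (W : forall x, exists r, is_iso r /\
    has_sq r (mm g x) (kmor (cP P) (mm a x)) (kmor (cP P) (mm h x))).
{ intros x.
  destruct (good_sq (cpl_c P (mm a x)) (cpl_c P (mm h x)) (proj1 (S x))) as (r & R).
  exists r; split; trivial; exact (star_cok (S x) (cpl_c P _) (cpl_c P _) R). }
pose (r := fun x => the_ex (W x)).
assert (Hi : forall x, is_iso (r x)) by (intros x; exact (proj1 (the_exP (W x)))).
assert (Hs : forall x, has_sq (r x) (mm g x) (em (cokmor a) x) (em (cokmor h) x))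
  by (intros x; exact (proj2 (the_exP (W x)))).
clearbody r.
pose (n := mkNat (top_nat_iso (em_is_nat (cokmor a)) (em_is_nat (cokmor h))
  (mm_is_nat g) Hs Hi)).
destruct (proj2 (mod_exists (n : M (FunC P D) _ _) g (cokmor a) (cokmor h)) Hs) as [s].
exists n, s; apply iso_pointwise; exact Hi.
Qed.

(** The counterpart of [star_cok_nat], rebuilt from its pointwise ingredients because of the
    mismatch between the two transposes. *)
Lemma star_ker_nat (F G H K : DFun D C) (a : E (FunC P D) F G) (b : E (FunC P D) F H)
    (g : E (FunC P D) G K) (h : E (FunC P D) H K) :
  (forall x, is_star (goodEP P) (em a x) (em b x) (em g x) (em h x)) ->
  exists (r : E (FunC P D) (ker (kF P D) a) (ker (kF P D) h))
    (_ : Sq (d := FunC P D) (kmor (kF P D) a) (kmor (kF P D) h) r g), is_iso r.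
Proof.
intros S.
assert (W : forall x, exists r : E C (ker (kP P) (em a x)) (ker (kP P) (em h x)), is_iso r /\
    has_sq (kmor (kP P) (em a x)) (kmor (kP P) (em h x)) r (em g x)).
{ intros x.
  pose proof (proj1 (cpl_tr P _ _) (cpl_k P (em a x))) as Ha.
  pose proof (proj1 (cpl_tr P _ _) (cpl_k P (em h x))) as Hh.
  destruct (goodE_sq (cpl_k P (em a x)) (cpl_k P (em h x)) (proj1 (S x))) as (r & R).
  exists r; split; trivial.
  exact (@star_cok (tr C) (tr_pre P) _ _ _ _ _ _ _ _ _ _ _ _ _ (S x) Ha Hh R). }
pose (r := fun x => the_ex (W x)).
assert (Hi : forall x, is_iso (r x)) by (intros x; exact (proj1 (the_exP (W x)))).
assert (Hs : forall x, has_sq (mm (kmor (kF P D) a) x) (mm (kmor (kF P D) h) x) (r x) (em g x))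
  by (intros x; exact (proj2 (the_exP (W x)))).
clearbody r.
pose (n := @mkENat C P D (ker (kF P D) a) (ker (kF P D) h) r
  (@top_nat_iso (tr C) (tr_pre P) (tr D)
    (trF (ker (kF P D) a)) (trF G) (trF (ker (kF P D) h)) (trF K)
    (mm (kmor (kF P D) a)) (mm (kmor (kF P D) h)) r (em g)
    (mm_is_nat_tr (kmor (kF P D) a)) (mm_is_nat_tr (kmor (kF P D) h)) (em_is_nat g) Hs Hi)).
destruct (proj2 (mod_exists (kmor (kF P D) a) (kmor (kF P D) h) n g) Hs) as [s].
exists n, s; apply em_iso; exact Hi.
Qed.

Lemma FunC_starE (F G H K : DFun D C) (a : E (FunC P D) F G) (b : E (FunC P D) F H)
    (g : E (FunC P D) G K) (h : E (FunC P D) H K) :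
  is_star (FunGoodE P D) a b g h <->
  forall x, is_star (goodEP P) (em a x) (em b x) (em g x) (em h x).
Proof.
etransitivity; [apply pull_star, trF_surj |].
exact (@FunGood_star (tr C) (tr_pre P) (tr D) (trF F) (trF G) (trF H) (trF K) a b g h).
Qed.

Lemma FunC_star_axiom : @star_axiom (FunC P D) (FunGood P D) (fun A B f => ker (cF P D) f)
  (fun A B f => kmor (cF P D) f).
Proof.
intros F G H a b Hc; split.
- destruct (FunGood_star_exists Hc) as (K & g & h & S); exists K, g, h.
  now apply FunGood_star.
- intros K g h S; split.
  + apply star_cok_nat with (b := b); now apply FunGood_star.
  + apply star_cok_nat with (b := a); apply FunGood_star; now apply star_sym.
Qed.

Lemma FunC_star_axiom_tr : @star_axiom (tr (FunC P D)) (FunGoodE P D)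
  (fun A B p => ker (kF P D) p) (fun A B p => kmor (kF P D) p).
Proof.
intros F G H a b (K & g & h & Hc); split.
- destruct (@FunGood_star_exists (tr C) (tr_pre P) (tr D) (trF F) (trF G) (trF H) a b)
    as (K' & g' & h' & S).
  { exists (trF K), g, h; exact Hc. }
  (* The star-pushout was built among diagrams of the transposes and is brought back along [trF]. *)
  destruct (trF_surj K') as (L & <-); exists L, g', h'; apply FunC_starE; exact S.
- intros K' g' h' S; split.
  + apply star_ker_nat with (b := b); now apply FunC_starE.
  + apply star_ker_nat with (b := a); apply FunC_starE; now apply star_sym.
Qed.

Lemma FunC_PBL : PBL (FunC P D).
Proof.
intros a b c a' b' c' f g f' g' p q r S T; apply mod_exists; intros x.
apply (pbl_h P (proj1 (mod_exists g g' q r) S x)).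
exact (proj1 (mod_exists (f ;; g) (f' ;; g') p r) T x).
Qed.

Lemma FunC_PBL_tr : PBL (tr (FunC P D)).
Proof.
intros a b c a' b' c' f g f' g' p q r S T; apply (mod_exists (P := P) p q f f'); intros x.
apply (pbl_v P (proj1 (mod_exists q r g g') S x)).
exact (proj1 (mod_exists p r (f ;; g) (f' ;; g')) T x).
Qed.

Definition FunPre : PreECGW (FunC P D).
Proof.
refine (@Build_PreECGW (FunC P D) (FunShared P D) (FunGood P D) (FunGoodE P D)
  (kF P D) (cF P D) FunC_thin FunC_thin_tr kF_full cF_full (emptyF P D) emptyF_initialM
  emptyF_initialE _ _ FunC_dist FunC_axK FunC_axK_tr FunC_star_axiom FunC_star_axiom_tr
  FunC_PBL FunC_PBL_tr (@FunGood_POL C P D) _).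
- exact (@mono_pointwise C P D).
- intros F G p Z g h; apply (@mono_pointwise (tr C) (tr_pre P) (tr D) (trF F) (trF G) p).
- apply pull_POL; [exact (@trF_surj D C) | exact (@FunGood_POL (tr C) (tr_pre P) (tr D))].
Defined.

(** (PO) in [C] completes both the component spans and the spans of kernels. *)
Lemma FunC_PO :
  (forall (A B X : C) (f : M C A B) (g : M C A X), has_good_completion (goodMP P) f g) ->
  forall (F G H : DFun D C) (f : M (FunC P D) F G) (g : M (FunC P D) F H),
    has_good_completion (goodMP FunPre) f g.
Proof.
intros PO F G H a b; destruct (@star_construct C P D F G H a b) as (K & g & h & S).
- intros; apply PO.
- intros; apply PO.
- exists K, g, h; exact (proj1 (pointwise_star S)).
Qed.

End FunctorAxioms.

Theorem theorem3p27 (C : DoubleCat) (S : ECGW C) (D : DoubleCat) :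
  exists T : ECGW (functor_category S D),
    (* good squares *)
    (forall (F G H K : DFun D C)
        (a : M (functor_category S D) F G) (b : M (functor_category S D) F H)
        (g : M (functor_category S D) G K) (h : M (functor_category S D) H K),
      good (goodM T) a b g h <-> good_nat_square a b g h) /\
    (forall (F G H K : DFun D C)
        (a : E (functor_category S D) F G) (b : E (functor_category S D) F H)
        (g : E (functor_category S D) G K) (h : E (functor_category S D) H K),
      good (goodE T) a b g h <->
      @good_nat_square (tr D) (tr C) (goodE S) (trF F) (trF G) (trF H) (trF K) a b g h) /\
    (* the functor k, on objects and on maps *)
    (forall (F G : DFun D C) (p : E (functor_category S D) F G) (x : D),
      MkArr (mm (kmor (kD T) p) x) = MkArr (kmor (kD S) (em p x))) /\
    (forall (F G F' G' : DFun D C)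
        (m : M (functor_category S D) F G) (m' : M (functor_category S D) F' G')
        (p : E (functor_category S D) F F') (q : E (functor_category S D) G G')
        (s : Sq m m' p q) (x : D),
      MkArr (mm (kmap (kD T) s) x) = MkArr (kmap (kD S) (md s x))) /\
    (* the functor c, on objects and on maps *)
    (forall (F G : DFun D C) (m : M (functor_category S D) F G) (x : D),
      MkArr (em (kmor (cD T) m) x) = MkArr (kmor (cD S) (mm m x))) /\
    (forall (F G F' G' : DFun D C)
        (m : M (functor_category S D) F G) (m' : M (functor_category S D) F' G')
        (p : E (functor_category S D) F F') (q : E (functor_category S D) G G')
        (s : Sq m m' p q) (x : D),
      MkArr (em (@kmap (tr (functor_category S D)) (goodE T) (cD T) _ _ _ _ p q m m' s) x) =
      MkArr (@kmap (tr C) (goodE S) (cD S) _ _ _ _ (em p x) (em q x) (mm m x) (mm m' x)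
               (md s x))) /\
    (* star-pushouts *)
    (forall (F G H K : DFun D C)
        (a : M (functor_category S D) F G) (b : M (functor_category S D) F H)
        (g : M (functor_category S D) G K) (h : M (functor_category S D) H K),
      is_star (goodM T) a b g h <->
      forall x : D, is_star (goodM S) (mm a x) (mm b x) (mm g x) (mm h x)) /\
    (forall (F G H K : DFun D C)
        (a : E (functor_category S D) F G) (b : E (functor_category S D) F H)
        (g : E (functor_category S D) G K) (h : E (functor_category S D) H K),
      is_star (goodE T) a b g h <->
      forall x : D, is_star (goodE S) (em a x) (em b x) (em g x) (em h x)) /\
    (* distinguished squares *)
    (forall (F G F' G' : DFun D C)
        (m : M (functor_category S D) F G) (m' : M (functor_category S D) F' G')
        (p : E (functor_category S D) F F') (q : E (functor_category S D) G G')
        (s : Sq m m' p q),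
      distinguished T s <-> forall x : D, distinguished S (md s x)).
Proof.
pose (P := pre_of_ECGW S).
exists (@ECGW_of_pre (functor_category S D) (FunPre P D) (@FunC_PO C P D (axPO S))).
(* Good squares, [k] and [c] were defined by the stated formulas, so these clauses hold by
   conversion. *)
split; [reflexivity |].
split; [reflexivity |].
split; [reflexivity |].
split; [reflexivity |].
split; [reflexivity |].
split; [reflexivity |].
split; [intros F G H K a b g h; exact (@FunGood_star C P D F G H K a b g h) |].
split; [intros F G H K a b g h; exact (@FunC_starE C P D F G H K a b g h) |].
intros F G F' G' m m' p q s; exact (@kF_triangle C P D F G F' G' m m' p q s).
Qed.
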